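(* Let $(X_0,X_1)$ and $(Y_0,Y_1)$ be compatible pairs of quasi-Banach lattices and let $\varphi\in\mathcal P$. There is a constant $C>0$, depending only on $X_0,X_1,Y_0,Y_1$ and $\varphi$, such that for every bounded linear operator $T:X_0+X_1\to Y_0+Y_1$ for which the restriction $T|_{X_i}$ maps $X_i$ into $Y_i$ and $T|_{X_i}:X_i\to Y_i$ is $(\infty,1)$-regular for $i=0,1$, the operator $T$ maps $\varphi^c(X_0,X_1)$ into $\varphi^c(Y_0,Y_1)$, the operator $T:\varphi^c(X_0,X_1)\to\varphi^c(Y_0,Y_1)$ is $(\infty,1)$-regular, and $$\rho_{\infty,1}(T|_{\varphi^c(X_0,X_1)})\le C\max\{\rho_{\infty,1}(T|_{X_0}),\rho_{\infty,1}(T|_{X_1})\}.$$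
   Context: All spaces are real. A quasi-norm satisfies the norm axioms except that the triangle inequality is replaced by $\|x+y\|\le C(\|x\|+\|y\|)$ for some constant $C\ge1$. A quasi-Banach lattice is a vector lattice with a complete quasi-norm such that $\|x\|\le\|y\|$ whenever $|x|\le|y|$. Compatible pair: $(X_0,X_1)$ is a compatible pair of quasi-Banach lattices if there are a Hausdorff locally solid topological vector lattice $X$ and injective, continuous, interval preserving lattice homomorphisms $j_i:X_i\hookrightarrow X$ ($i=0,1$), where interval preserving means $j_i([0,x])=[0,j_i(x)]$ for $x\ge0$. One identifies $X_i$ with its image. Then $X_0+X_1=\{x_0+x_1: x_i\in X_i\}\subset X$ is a quasi-Banach lattice with quasi-norm $\|x\|=\inf\{\|x_0\|_{X_0}+\|x_1\|_{X_1}:x=x_0+x_1\}$, containing $X_0,X_1$ as (not necessarily closed) ideals. The class $\mathcal P$: all functions $\varphi:(0,\infty)\times(0,\infty)\to[0,\infty)$ with $\varphi(\lambda s,\lambda t)=\lambda\varphi(s,t)$ for $s,t,\lambda>0$ and non-decreasing in each variable, normalized by $\varphi(1,1)=1$. Such $\varphi$ extends uniquely to a continuous function on $[0,\infty)^2$, still denoted $\varphi$. Functional calculus: for positive $x_0,x_1$ in a quasi-Banach lattice, $\varphi(x_0,x_1)$ is defined by Krivine's functional calculus; concretely, the (non-closed) ideal generated by $e=x_0\vee x_1$ is lattice isomorphic to some $C(\Omega)$, $\Omega$ compact Hausdorff, with $e$ corresponding to $1_\Omega$, and $\varphi(x_0,x_1)$ corresponds to the function $\omega\mapsto\varphi(\hat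 x_0(\omega),\hat x_1(\omega))$. Calderón–Lozanovskii space: $\varphi(X_0,X_1)=\{x\in X_0+X_1:|x|\le\varphi(x_0,x_1)\text{ for some }x_0\in X_0^+,x_1\in X_1^+\}$, a quasi-Banach lattice with quasi-norm $\|x\|_{\varphi(X_0,X_1)}=\inf\{\lambda>0:|x|\le\lambda\varphi(x_0,x_1),\ x_i\in X_i^+,\ \|x_0\|_{X_0}\le1,\ \|x_1\|_{X_1}\le1\}$. $\varphi^c(X_0,X_1)$ is the Gagliardo completion of $\varphi(X_0,X_1)$ in $X_0+X_1$: the quasi-normed space whose unit ball is the closure in $X_0+X_1$ of the unit ball of $\varphi(X_0,X_1)$. A linear operator $T:E\to F$ between quasi-Banach lattices is $(\infty,1)$-regular if there is $K>0$ with $\big\|\bigvee_{i=1}^n|Tx_i|\big\|\le K\big\|\sum_{i=1}^n|x_i|\big\|$ for all finite families $(x_i)_{i=1}^n\subset E$; $\rho_{\infty,1}(T)$ denotes the smallest such $K$. *)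

(* Defs.v *)
From HB Require Import structures.
From mathcomp Require Import all_boot all_order all_algebra.
From mathcomp Require Import all_classical all_reals all_analysis.

Set Implicit Arguments.
Unset Strict Implicit.
Unset Printing Implicit Defensive.

Import Order.TTheory GRing.Theory Num.Theory.
Import numFieldNormedType.Exports.

Local Open Scope classical_set_scope.
Local Open Scope ring_scope.

(** An ordered vector space in which [vjoin] and [vmeet] are binary suprema and
    infima. The order is that of [porderZmodType]; [Order.Lattice] is not used
    since its join with [Zmodule] is reserved to ordered rings in the
    hierarchy. *)
HB.mixin Record Lmodule_POrder_isVectorLattice (R : realType) V
    & GRing.Lmodule R V & Num.POrderedZmodule V := {
  vjoin : V -> V -> V ;
  vmeet : V -> V -> V ;
  vleUx : forall x y z : V, (vjoin x y <= z) = (x <= z) && (y <= z) ;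
  vlexI : forall x y z : V, (z <= vmeet x y) = (z <= x) && (z <= y) ;
  vleD2r : forall x y z : V, x <= y -> x + z <= y + z ;
  vscale_ge0 : forall (a : R) (x : V), 0 <= a -> 0 <= x -> 0 <= a *: x
}.

#[short(type="vectorLatticeType")]
HB.structure Definition VectorLattice (R : realType) :=
  {V of GRing.Lmodule R V & Num.POrderedZmodule V
      & Lmodule_POrder_isVectorLattice R V}.

Definition vabs (R : realType) (V : vectorLatticeType R) (x : V) : V :=
  vjoin x (- x).

(** The quasi-norm is not assumed continuous; completeness refers to the
    metrizable linear topology with the balls [[set y | qnorm (y - x) < e]] as
    basic neighbourhoods of [x]. *)
HB.mixin Record VectorLattice_isQuasiBanach (R : realType) V
    & VectorLattice R V := {
  qnorm : V -> R ;
  qnorm_ge0 : forall x, 0 <= qnorm x ;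
  qnorm0_eq0 : forall x, qnorm x = 0 -> x = 0 ;
  qnormZ : forall (a : R) x, qnorm (a *: x) = `|a| * qnorm x ;
  ler_qnormD : exists2 C : R, 1 <= C &
    forall x y, qnorm (x + y) <= C * (qnorm x + qnorm y) ;
  ler_qnorm : forall x y : V, vabs x <= vabs y -> qnorm x <= qnorm y ;
  qnorm_complete : forall u : nat -> V,
    (forall e : R, 0 < e -> exists N : nat, forall m n,
       (N <= m)%N -> (N <= n)%N -> qnorm (u m - u n) < e) ->
    exists l : V, qnorm (u n - l) @[n --> \oo] --> (0 : R)
}.

#[short(type="quasiBanachLatticeType")]
HB.structure Definition QuasiBanachLattice (R : realType) :=
  {V of VectorLattice R V & VectorLattice_isQuasiBanach R V}.

Definition qnbhs (R : realType) (V : quasiBanachLatticeType R) (x : V) :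
    set_system V :=
  filter_from [set e : R | 0 < e] (fun e => [set y : V | qnorm (y - x) < e]).

Definition solid (R : realType) (V : vectorLatticeType R) (A : set V) : Prop :=
  forall x y, vabs x <= vabs y -> A y -> A x.

HB.mixin Record TopologicalLmodule_isLocallySolid (R : realType) V
    & VectorLattice R V & TopologicalLmodule R V := {
  locally_solid : forall U : set V, nbhs 0 U ->
    exists A : set V, [/\ nbhs 0 A, solid A & A `<=` U]
}.

#[short(type="locallySolidType")]
HB.structure Definition LocallySolid (R : realType) :=
  {V of VectorLattice R V & TopologicalLmodule R V
      & TopologicalLmodule_isLocallySolid R V}.

Section CompatiblePairs.
Context {R : realType}.

Definition lattice_morphism (V W : vectorLatticeType R) (j : V -> W) : Prop :=
  (forall x y, j (vjoin x y) = vjoin (j x) (j y)) /\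
  (forall x y, j (vmeet x y) = vmeet (j x) (j y)).

Definition interval_preserving (V W : vectorLatticeType R) (j : V -> W) : Prop :=
  forall x, 0 <= x ->
    j @` [set y | 0 <= y /\ y <= x] = [set z | 0 <= z /\ z <= j x].

Definition compatible_embedding (E : quasiBanachLatticeType R)
    (X : locallySolidType R) (j : {linear E -> X}) : Prop :=
  [/\ injective j,
      forall x, j y @[y --> qnbhs x] --> j x,
      lattice_morphism j &
      interval_preserving j].

Definition compatible_pair (X0 X1 : quasiBanachLatticeType R)
    (X : locallySolidType R) (j0 : {linear X0 -> X}) (j1 : {linear X1 -> X}) :
    Prop :=
  [/\ hausdorff_space X, compatible_embedding j0 & compatible_embedding j1].

End CompatiblePairs.

Section ClassP.
Context {R : realType}.

(** Only the values of [phi] at positive arguments are relevant. *)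
Definition class_P (phi : R -> R -> R) : Prop :=
  [/\ forall s t, 0 < s -> 0 < t -> 0 <= phi s t,
      forall l s t, 0 < l -> 0 < s -> 0 < t ->
        phi (l * s) (l * t) = l * phi s t,
      forall s s' t, 0 < s -> 0 < t -> s <= s' -> phi s t <= phi s' t,
      forall s t t', 0 < s -> 0 < t -> t <= t' -> phi s t <= phi s t' &
      phi 1 1 = 1].

Definition open_quadrant : set (R * R) := [set p | 0 < p.1 /\ 0 < p.2].

(** The continuous extension of [phi] to [[0, +oo[ x [0, +oo[]. *)
Definition quadrant_ext (phi : R -> R -> R) (s t : R) : R :=
  lim (phi p.1 p.2 @[p --> within open_quadrant (nbhs ((s, t) : R * R))]).

End ClassP.

Section FunctionalCalculus.
Context {R : realType} {V : vectorLatticeType R}.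

Definition principal_ideal (E : set V) (e : V) : set V :=
  [set x | E x /\ exists c : R, vabs x <= c *: e].

Definition linear_on (W : lmodType R) (A : set V) (f : V -> W) : Prop :=
  forall (a : R) x y, A x -> A y -> f (a *: x + y) = a *: f x + f y.

(** [h] restricts to a lattice isomorphism of the sublattice [A] of [V] onto
    [C(Omega)]; its values outside [A] are irrelevant. *)
Definition lattice_iso_C (Omega : topologicalType) (A : set V)
    (h : V -> Omega -> R) : Prop :=
  [/\ set_bij A [set f : Omega -> R | continuous f] h,
      forall (a : R) x y, A x -> A y ->
        forall w, h (a *: x + y) w = a * h x w + h y w,
      forall x y, A x -> A y ->
        forall w, h (vjoin x y) w = Num.max (h x w) (h y w) &
      forall x y, A x -> A y ->
        forall w, h (vmeet x y) w = Num.min (h x w) (h y w)].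

(** [z] is [phi(x0, x1)], computed in the sublattice [E] of [V]. *)
Definition func_calculus (E : set V) (phi : R -> R -> R) (x0 x1 z : V) : Prop :=
  let e := vjoin x0 x1 in
  exists (Omega : topologicalType) (h : V -> Omega -> R),
    [/\ compact [set: Omega] /\ hausdorff_space Omega,
        lattice_iso_C (principal_ideal E e) h,
        forall w, h e w = 1,
        principal_ideal E e z &
        forall w, h z w = quadrant_ext phi (h x0 w) (h x1 w)].

End FunctionalCalculus.

(** Each space is given by its carrier, a subset of the ambient lattice [X],
    and a quasi-norm, a function on [X] that is only meaningful on the
    carrier. All carriers are ideals of [X], so their lattice operations are
    those of [X]. *)

Section Spaces.
Context {R : realType} {X0 X1 : quasiBanachLatticeType R} {X : locallySolidType R}.
Variables (j0 : {linear X0 -> X}) (j1 : {linear X1 -> X}).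

Definition sum_space : set X := [set x | exists x0 x1, x = j0 x0 + j1 x1].

Definition sum_qnorm (x : X) : R :=
  inf [set r | exists x0 x1, x = j0 x0 + j1 x1 /\ r = qnorm x0 + qnorm x1].

Variable phi : R -> R -> R.

Definition CL_space : set X :=
  [set x | sum_space x /\ exists x0 x1 z,
    [/\ 0 <= x0, 0 <= x1,
        func_calculus sum_space phi (j0 x0) (j1 x1) z & vabs x <= z]].

Definition CL_qnorm (x : X) : R :=
  inf [set l : R | 0 < l /\ exists x0 x1 z,
    [/\ 0 <= x0 /\ qnorm x0 <= 1, 0 <= x1 /\ qnorm x1 <= 1,
        func_calculus sum_space phi (j0 x0) (j1 x1) z & vabs x <= l *: z]].

Definition CL_unit_ball : set X := [set x | CL_space x /\ CL_qnorm x <= 1].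

Definition sum_closure (A : set X) : set X :=
  [set x | sum_space x /\
    forall e : R, 0 < e -> exists2 y, A y & sum_qnorm (x - y) < e].

Definition Gagliardo_unit_ball : set X := sum_closure CL_unit_ball.

(** The quasi-normed space with unit ball [Gagliardo_unit_ball]. *)
Definition Gagliardo_space : set X :=
  [set x | exists2 l : R, 0 < l & Gagliardo_unit_ball (l^-1 *: x)].

Definition Gagliardo_qnorm (x : X) : R :=
  inf [set l : R | 0 < l /\ Gagliardo_unit_ball (l^-1 *: x)].

End Spaces.

Section Regular.
Context {R : realType} {V W : vectorLatticeType R}.
Variables (E : set V) (nE : V -> R) (nF : W -> R) (T : V -> W).

(** The base point [0] of the join is harmless since the terms are positive;
    it only gives a meaning to the empty family. *)
Definition inf1_bound (K : R) : Prop :=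
  forall (n : nat) (x : 'I_n -> V), (forall i, E (x i)) ->
    nF (\big[vjoin/0]_(i < n) vabs (T (x i))) <=
    K * nE (\sum_(i < n) vabs (x i)).

Definition inf1_regular : Prop := exists2 K : R, 0 < K & inf1_bound K.

Definition rho_inf1 : R := inf [set K : R | 0 < K /\ inf1_bound K].

End Regular.

(* Main.v *)
Require Import Defs.
From HB Require Import structures.
From mathcomp Require Import all_boot all_order all_algebra.
From mathcomp Require Import all_classical all_reals all_analysis.
From mathcomp Require Import ring lra.

(** Let [f t = phi 1 t]. Choose points [s] such that from each one to the next
    both [f] doubles and [f t / t] halves, while one of the two is almost
    constant in between. Then [phi(a, b)] is equivalent to the sum of the pieces
    [min (f s a) (f s b / s)], and at each point it is also equivalent to the
    largest of them. If [sum_i |x_i| <= phi(a, b)], multiplication in [C(Omega)]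
    by weights concentrated on the large pieces splits each [x_i], up to an
    arbitrarily small error in [X0 + X1], into finitely many parts [u_(i, s)]
    such that [sum_(i, s) |u_(i, s)| / f s] is bounded by a multiple of [a] and
    [sum_(i, s) s |u_(i, s)| / f s] by a multiple of [b]. By regularity the joins
    [y0] and [y1] of the correspondingly weighted [|T u_(i, s)|] are controlled in
    [Y0] and [Y1], and [|T x_i| <= sum_s |T u_(i, s)|] is at most the sum of the
    pieces at [(y0, y1)], hence at most a multiple of [phi(y0, y1)]. The errors
    are absorbed by the Gagliardo completion.

    The existence of [phi(y0, y1)] is Kakutani's theorem, proved with the real
    lattice homomorphisms of a principal ideal; these also determine the order,
    which reduces inequalities in [X] to inequalities between real numbers. *)

Set Implicit Arguments.
Unset Strict Implicit.
Unset Printing Implicit Defensive.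

Import Order.TTheory GRing.Theory Num.Theory.
Import numFieldNormedType.Exports.

Local Open Scope classical_set_scope.
Local Open Scope ring_scope.

(** * Vector lattices *)

(** The number of pieces grows as the error shrinks, so cutting the [x_i] must not cost anything in
    the quasi-triangle inequality. This is why regularity is used only once in each coordinate, for
    the whole family indexed by the pairs (i, s): the join over all pairs enters the quasi-norm as a
    single element, and the final constant [6 * 192] depends neither on the number of pieces nor on
    the spaces. The quasi-triangle inequality only meets the errors, and these are chosen after the
    family [x_i] is known.

    Finitely many pieces of the form above cannot resolve [phi(a, b)] where [b / a] is close to 0 or
    to infinity. If [phi(1, 0)] or [phi(0, 1)] is positive, a degenerate piece proportional to [a]
    or to [b] takes over there. Otherwise [phi(a, b)] is a small multiple of [max(a, b)], which is
    small in X0 + X1 but not necessarily in [phi(X0, X1)]. *)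

Section VectorLatticeTheory.
Context {R : realType} {V : vectorLatticeType R}.
Implicit Types (x y z a b : V) (c : R).

Lemma vleD x y z t : x <= y -> z <= t -> x + z <= y + t :> V.
Proof.
move=> xy zt; apply: (le_trans (vleD2r _ _ z xy)).
by rewrite addrC [leRHS]addrC; exact: vleD2r.
Qed.

Lemma vsubr_ge0 x y : (0 <= y - x) = (x <= y).
Proof.
apply/idP/idP => [/(vleD2r _ _ x)|/(vleD2r _ _ (- x))]; first by rewrite add0r subrK.
by rewrite subrr.
Qed.

Lemma vlerBlDr x y z : (x - y <= z) = (x <= z + y).
Proof.
by apply/idP/idP => [/(vleD2r _ _ y)|/(vleD2r _ _ (- y))]; rewrite ?subrK ?addrK.
Qed.

Lemma vleN x y : (- x <= - y) = (y <= x).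
Proof.
have le a b : a <= b -> - b <= - a.
  by move=> /(vleD2r _ _ (- a - b)); rewrite [a + _]addrA subrr add0r [b + _]addrC subrK.
by apply/idP/idP => [/le|/le//]; rewrite !opprK.
Qed.

Lemma vaddr_ge0 x y : 0 <= x -> 0 <= y -> 0 <= x + y.
Proof. by move=> x0 y0; rewrite -[0]addr0; exact: vleD. Qed.

Lemma vlerDl x y : 0 <= y -> x <= x + y.
Proof. by move=> y0; rewrite -vsubr_ge0 addrAC subrr add0r. Qed.

Lemma vlerDr x y : 0 <= y -> x <= y + x.
Proof. by rewrite addrC; exact: vlerDl. Qed.

Lemma vscale_le c x y : 0 <= c -> x <= y -> c *: x <= c *: y.
Proof.
by move=> c0; rewrite -vsubr_ge0 => xy; rewrite -vsubr_ge0 -scalerBr vscale_ge0.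
Qed.

Lemma vscaler_le c d x : 0 <= x -> c <= d -> c *: x <= d *: x.
Proof. by move=> x0 cd; rewrite -vsubr_ge0 -scalerBl vscale_ge0// subr_ge0. Qed.

Lemma vscale_ler_pdivl c x y : 0 < c -> (c *: x <= y) = (x <= c^-1 *: y).
Proof.
move=> c0; have cV0 : 0 < c^-1 by rewrite invr_gt0.
apply/idP/idP => [/(vscale_le (ltW cV0))|/(vscale_le (ltW c0))].
  by rewrite scalerA mulVf ?gt_eqF// scale1r.
by rewrite scalerA divff ?gt_eqF// scale1r.
Qed.

Lemma vsum_le (I : Type) (r : seq I) (F G : I -> V) :
  (forall i, F i <= G i) -> \sum_(i <- r) F i <= \sum_(i <- r) G i.
Proof. by move=> FG; elim/big_ind2 : _ => // *; exact: vleD. Qed.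

Lemma vsum_ge0 (I : Type) (r : seq I) (F : I -> V) :
  (forall i, 0 <= F i) -> 0 <= \sum_(i <- r) F i.
Proof. by move=> F0; elim/big_ind : _ => // *; exact: vaddr_ge0. Qed.

Lemma vsum_sup (I : eqType) (r : seq I) (F : I -> V) i :
  (forall i, 0 <= F i) -> i \in r -> F i <= \sum_(i <- r) F i.
Proof.
move=> F0; elim: r => // j r ih; rewrite inE big_cons => /predU1P[->|/ih h].
  exact/vlerDl/vsum_ge0.
exact: le_trans h (vlerDr _ _).
Qed.

Lemma vleUl x y : x <= vjoin x y.
Proof. by have := lexx (vjoin x y); rewrite vleUx => /andP[]. Qed.

Lemma vleUr x y : y <= vjoin x y.
Proof. by have := lexx (vjoin x y); rewrite vleUx => /andP[]. Qed.

Lemma vleIl x y : vmeet x y <= x.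
Proof. by have := lexx (vmeet x y); rewrite vlexI => /andP[]. Qed.

Lemma vleIr x y : vmeet x y <= y.
Proof. by have := lexx (vmeet x y); rewrite vlexI => /andP[]. Qed.

Lemma vjoinC x y : vjoin x y = vjoin y x.
Proof. by apply/eqP; rewrite eq_le !vleUx !vleUr !vleUl. Qed.

Lemma vjoin_idPr x y : vjoin x y = y <-> x <= y.
Proof.
split=> [<-|xy]; first exact: vleUl.
by apply/eqP; rewrite eq_le vleUr vleUx xy lexx.
Qed.

Lemma vmeetE x y : vmeet x y = - vjoin (- x) (- y).
Proof.
apply/eqP; rewrite eq_le vlexI -[X in _ && (X && _)]vleN -[X in _ && (_ && X)]vleN.
rewrite opprK vleUl vleUr -vleN opprK vleUx !vleN.
by rewrite vleIl vleIr.
Qed.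

Lemma vabs_le x y : (vabs x <= y) = (x <= y) && (- x <= y).
Proof. by rewrite /vabs vleUx. Qed.

Lemma vabs_ge x : x <= vabs x. Proof. exact: vleUl. Qed.

Lemma vabs_geN x : - x <= vabs x. Proof. exact: vleUr. Qed.

Lemma vabs_geNl x : - vabs x <= x.
Proof. by rewrite -vleN opprK vabs_geN. Qed.

Lemma vabs_ge0 x : 0 <= vabs x.
Proof.
have := vleD (vabs_ge x) (vabs_geN x); rewrite subrr => h.
have c0 : 0 <= 2^-1 :> R by rewrite invr_ge0.
have := vscale_ge0 _ _ c0 h.
rewrite scalerDr -scalerDl (_ : 2^-1 + 2^-1 = 1); last by field.
by rewrite scale1r.
Qed.

Lemma vabsN x : vabs (- x) = vabs x.
Proof. by rewrite /vabs opprK vjoinC. Qed.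

Lemma vabs_id x : 0 <= x -> vabs x = x.
Proof.
move=> x0; apply/eqP; rewrite eq_le vabs_ge vabs_le lexx/= (le_trans _ x0)//.
by rewrite -vleN opprK oppr0.
Qed.

Lemma vabs0 : vabs (0 : V) = 0. Proof. exact: vabs_id. Qed.

Lemma vabs_abs x : vabs (vabs x) = vabs x.
Proof. exact/vabs_id/vabs_ge0. Qed.

Lemma vabs_eq0 x : vabs x <= 0 -> x = 0.
Proof.
by rewrite vabs_le => /andP[h1 h2]; apply/eqP; rewrite eq_le h1 -vleN oppr0.
Qed.

Lemma vabsD x y : vabs (x + y) <= vabs x + vabs y.
Proof. by rewrite vabs_le opprD !vleD ?vabs_ge ?vabs_geN. Qed.

Lemma vabsB x y : vabs (x - y) = vabs (y - x).
Proof. by rewrite -vabsN opprB. Qed.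

Lemma vabsZ c x : vabs (c *: x) = `|c| *: vabs x.
Proof.
have le d y : vabs (d *: y) <= `|d| *: vabs y.
  rewrite vabs_le -scaleNr; apply/andP; split.
    have [d0|d0] := ger0P d; first exact/vscale_le/vabs_ge.
    rewrite -[d *: y]opprK -scalerN -scaleNr.
    by apply: vscale_le; rewrite ?oppr_ge0 ?vabs_geN// ltW.
  have [d0|d0] := ger0P d.
    by rewrite scaleNr -scalerN; apply/vscale_le/vabs_geN.
  by apply: vscale_le; rewrite ?oppr_ge0 ?vabs_ge// ltW.
have [->|c0] := eqVneq c 0; first by rewrite !scale0r normr0 scale0r vabs0.
apply/eqP; rewrite eq_le le/=.
have := le c^-1 (c *: x); rewrite scalerA mulVf// scale1r => h.
rewrite (le_trans (vscale_le (normr_ge0 c) h))// scalerA -normrM mulfV//.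
by rewrite normr1 scale1r.
Qed.

Definition vclamp a x := vmeet (vjoin x (- a)) a.

Lemma vabs_clamp a x : 0 <= a -> vabs (vclamp a x) <= a.
Proof.
move=> a0; have Na : - a <= a by rewrite (le_trans _ a0)// -vleN opprK oppr0.
by rewrite vabs_le vleIr -vleN opprK vlexI vleUr Na.
Qed.

(** Truncation makes the decomposition of an element below [a + b] explicit. It serves for the Riesz
    decomposition, for the splitting in X0 + X1 and for the solidity of the Gagliardo ball. *)
Lemma vabs_subclamp a b x : 0 <= a -> 0 <= b -> vabs x <= a + b ->
  vabs (x - vclamp a x) <= b.
Proof.
move=> a0 b0; rewrite vabs_le => /andP[x1 x2]; rewrite vabs_le opprB.
apply/andP; split.
  rewrite vlerBlDr addrC -vlerBlDr vlexI; apply/andP; split.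
    by rewrite vlerBlDr (le_trans (vleUl _ _) (vlerDl _ b0)).
  by rewrite vlerBlDr.
rewrite vlerBlDr; apply: (le_trans (vleIl _ _)); rewrite vleUx vlerDr//=.
by rewrite -vleN opprK opprD addrC vlerBlDr.
Qed.

(** A greedy cut: the head keeps its truncation to [vmeet w (vabs (x i))], and the rest of [w] still
    lies below the sum over the tail. No mass is lost in the second estimate, so one approximation
    of the sum of the [vabs (x i)] can be distributed over all the [x i]. *)
Lemma riesz_decomposition (I : eqType) (r : seq I) (x : I -> V) (w : V) :
  uniq r -> 0 <= w -> w <= \sum_(i <- r) vabs (x i) ->
  exists u : I -> V,
    \sum_(i <- r) vabs (u i) <= w /\
    \sum_(i <- r) vabs (x i - u i) <= \sum_(i <- r) vabs (x i) - w.
Proof.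
elim: r w => [|i r ih] w.
  move=> _ w0; rewrite !big_nil => w0'; exists (fun _ => 0).
  by rewrite !big_nil; split=> //; rewrite sub0r -vleN opprK oppr0.
move=> /= /andP[ir ur] w0; rewrite !big_cons => wle.
set w1 := vmeet w (vabs (x i)).
have w10 : 0 <= w1 by rewrite vlexI w0 vabs_ge0.
have ww1 : 0 <= w - w1 by rewrite vsubr_ge0 vleIl.
have wW : w - w1 <= \sum_(j <- r) vabs (x j).
  rewrite vlerBlDr addrC -vlerBlDr vlexI !vlerBlDr wle andbT.
  by apply/vlerDl/vsum_ge0 => j; exact: vabs_ge0.
have [u [u1 u2]] := ih _ ur ww1 wW.
(* Redefining the cut at the index [i] leaves the tail unchanged, since [uniq] keeps [i] out of
   it. *)
exists (fun j => if j == i then vclamp w1 (x i) else u j).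
have eq_r (F G : I -> V) : (forall j, j != i -> F j = G j) ->
    \sum_(j <- r) F j = \sum_(j <- r) G j.
  move=> FG; apply: eq_big_seq => j jr; apply: FG.
  by apply: contraNneq ir => <-.
rewrite !big_cons eqxx; split.
  rewrite (eq_r _ (fun j => vabs (u j))) => [|j /negPf ->//].
  by rewrite -[leRHS](subrK w1) addrC vleD// vabs_clamp.
rewrite (eq_r _ (fun j => vabs (x j - u j))) => [|j /negPf ->//].
have h : vabs (x i - vclamp w1 (x i)) <= vabs (x i) - w1.
  by apply: vabs_subclamp; rewrite ?vsubr_ge0 ?vleIr// addrC subrK.
apply: (le_trans (vleD h u2)).
by rewrite addrACA -opprD [w1 + _]addrC subrK.
Qed.

End VectorLatticeTheory.

Definition archimedean {R : realType} (V : vectorLatticeType R) : Prop :=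
  forall x e : V, (forall n : nat, n%:R *: x <= e) -> x <= 0.
(** * Real lattice homomorphisms on principal ideals *)

Section Homomorphisms.
Context {R : realType} {V : vectorLatticeType R}.
Implicit Types (x y z e : V) (c : R).

Definition order_ideal e : set V := [set x | exists c : R, vabs x <= c *: e].

Definition lattice_hom e (chi : V -> R) : Prop :=
  [/\ forall (a : R) x y, order_ideal e x -> order_ideal e y ->
        chi (a *: x + y) = a * chi x + chi y,
      forall x y, order_ideal e x -> order_ideal e y ->
        chi (vjoin x y) = Num.max (chi x) (chi y) &
      forall x y, order_ideal e x -> order_ideal e y ->
        chi (vmeet x y) = Num.min (chi x) (chi y)].

Section Ideal.
Variables (e : V) (e0 : 0 <= e).
Notation I := (order_ideal e).

Lemma order_ideal_bound x : I x -> exists2 c : R, 0 <= c & vabs x <= c *: e.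
Proof.
move=> [c xc]; exists `|c|; first exact: normr_ge0.
exact/(le_trans xc)/vscaler_le/ler_norm.
Qed.

Lemma order_ideal_e : I e.
Proof. by exists 1; rewrite scale1r vabs_id. Qed.

Lemma order_ideal_solid x y : vabs x <= vabs y -> I y -> I x.
Proof. by move=> xy [c yc]; exists c; exact: le_trans yc. Qed.

Lemma order_ideal0 : I 0.
Proof. by exists 0; rewrite scale0r vabs0. Qed.

Lemma order_idealD x y : I x -> I y -> I (x + y).
Proof.
move=> [c xc] [d yd]; exists (c + d); rewrite scalerDl.
exact: le_trans (vabsD _ _) (vleD xc yd).
Qed.

Lemma order_idealZ c x : I x -> I (c *: x).
Proof.
move=> [d xd]; exists (`|c| * d); rewrite vabsZ -scalerA.
exact: vscale_le.
Qed.

Lemma order_idealN x : I x -> I (- x).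
Proof. by rewrite -scaleN1r; exact: order_idealZ. Qed.

Lemma order_idealB x y : I x -> I y -> I (x - y).
Proof. by move=> ? /order_idealN; exact: order_idealD. Qed.

Lemma order_ideal_abs x : I x -> I (vabs x).
Proof. by apply: order_ideal_solid; rewrite vabs_abs. Qed.

Lemma order_ideal_join x y : I x -> I y -> I (vjoin x y).
Proof.
move=> [c xc] [d yd]; exists (c + d); rewrite scalerDl.
apply: le_trans (vleD xc yd); rewrite vabs_le vleUx.
have ax := vabs_ge0 x; have ay := vabs_ge0 y; apply/andP; split.
  apply/andP; split.
    exact: le_trans (vabs_ge x) (vlerDl _ ay).
  exact: le_trans (vabs_ge y) (vlerDr _ ax).
apply: le_trans (vlerDl _ ay); apply: le_trans (vabs_geN x).
by rewrite vleN vleUl.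
Qed.

Lemma order_ideal_meet x y : I x -> I y -> I (vmeet x y).
Proof.
move=> /order_idealN Ix /order_idealN Iy; rewrite vmeetE.
exact/order_idealN/order_ideal_join.
Qed.

Lemma order_ideal_le x y : 0 <= x -> x <= y -> I y -> I x.
Proof.
move=> x0 xy; apply: order_ideal_solid; rewrite (vabs_id x0).
exact: le_trans (vabs_ge y).
Qed.

Lemma order_ideal_sum (J : Type) (r : seq J) (F : J -> V) :
  (forall i, I (F i)) -> I (\sum_(i <- r) F i).
Proof.
move=> IF; elim/big_ind : _ => //; first exact: order_ideal0.
exact: order_idealD.
Qed.

Section Hom.
Variables (chi : V -> R) (hchi : lattice_hom e chi).

Lemma hom_lin a x y : I x -> I y -> chi (a *: x + y) = a * chi x + chi y.
Proof. by have [h _ _] := hchi; exact: h. Qed.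

Lemma hom_join x y : I x -> I y -> chi (vjoin x y) = Num.max (chi x) (chi y).
Proof. by have [_ h _] := hchi; exact: h. Qed.

Lemma hom_meet x y : I x -> I y -> chi (vmeet x y) = Num.min (chi x) (chi y).
Proof. by have [_ _ h] := hchi; exact: h. Qed.

Lemma hom0 : chi 0 = 0.
Proof.
have := hom_lin (-1) order_ideal0 order_ideal0.
by rewrite scaler0 addr0 mulN1r addNr.
Qed.

Lemma homD x y : I x -> I y -> chi (x + y) = chi x + chi y.
Proof. by move=> Ix Iy; have := hom_lin 1 Ix Iy; rewrite scale1r mul1r. Qed.

Lemma homZ c x : I x -> chi (c *: x) = c * chi x.
Proof.
by move=> Ix; have := hom_lin c Ix order_ideal0; rewrite hom0 !addr0.
Qed.

Lemma homN x : I x -> chi (- x) = - chi x.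
Proof. by move=> Ix; rewrite -scaleN1r homZ// mulN1r. Qed.

Lemma homB x y : I x -> I y -> chi (x - y) = chi x - chi y.
Proof. by move=> Ix Iy; rewrite homD ?homN//; exact: order_idealN. Qed.

Lemma hom_abs x : I x -> chi (vabs x) = `|chi x|.
Proof.
by move=> Ix; rewrite /vabs hom_join ?homN//; [rewrite maxrN|exact: order_idealN].
Qed.

Lemma hom_le x y : I x -> I y -> x <= y -> chi x <= chi y.
Proof.
by move=> Ix Iy /vjoin_idPr xy; rewrite -xy hom_join// le_max lexx.
Qed.

Lemma hom_ge0 x : I x -> 0 <= x -> 0 <= chi x.
Proof. by move=> Ix x0; rewrite -hom0; apply: hom_le => //; exact: order_ideal0. Qed.

Lemma hom_sum (J : Type) (r : seq J) (F : J -> V) :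
  (forall i, I (F i)) -> chi (\sum_(i <- r) F i) = \sum_(i <- r) chi (F i).
Proof.
move=> IF; elim: r => [|i r ih]; first by rewrite !big_nil hom0.
by rewrite !big_cons homD ?ih//; exact: order_ideal_sum.
Qed.

End Hom.

(** In [C(Omega)] these are the functionals [x |-> max_K x], for [K] closed and
    nonempty; the minimal ones are the point evaluations. *)
Definition sup_functional (p : V -> R) : Prop :=
  [/\ forall x y, I x -> I y -> x <= y -> p x <= p y,
      forall x y, I x -> I y -> p (vjoin x y) <= Num.max (p x) (p y),
      forall x y, I x -> I y -> p (x + y) <= p x + p y,
      forall c x, I x -> 0 < c -> p (c *: x) <= c * p x &
      p e <= 1 /\ p (- e) <= -1].

Section SupFunctional.
Variables (p : V -> R) (hp : sup_functional p).

Lemma supf_le x y : I x -> I y -> x <= y -> p x <= p y.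
Proof. by have [h _ _ _ _] := hp; exact: h. Qed.

Lemma supfD x y : I x -> I y -> p (x + y) <= p x + p y.
Proof. by have [_ _ h _ _] := hp; exact: h. Qed.

Lemma supf0 : p 0 = 0.
Proof.
have [_ _ _ h _] := hp.
(* The factor 2 gives [0 <= p 0], the factor 1/2 gives [p 0 <= 0]. *)
have := h 2 0 order_ideal0; have := h 2^-1 0 order_ideal0.
rewrite !scaler0 => h1 h2; have {}h1 := h1 (_ : _); have {}h2 := h2 (_ : _).
by have := h1 _; have := h2 _; lra.
Qed.

Lemma supfN x : I x -> - p (- x) <= p x.
Proof.
move=> Ix; have := supfD Ix (order_idealN Ix).
by rewrite subrr supf0 -subr_ge0; lra.
Qed.

Lemma supfZ c x : I x -> 0 < c -> p (c *: x) = c * p x.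
Proof.
have [_ _ _ h _] := hp; move=> Ix c0; apply/eqP; rewrite eq_le h//=.
have := h c^-1 (c *: x) (order_idealZ _ Ix) _.
rewrite scalerA mulVf ?gt_eqF// scale1r => /(_ _)h1.
by rewrite mulrC -ler_pdivlMr// mulrC h1// invr_gt0.
Qed.

(** The bound is the same for all [p], so that infima over chains are finite in Zorn's lemma. *)
Lemma supf_lb x c : I x -> - x <= c *: e -> 0 < c -> - c <= p x.
Proof.
move=> Ix xc c0; have [_ _ _ _ [pe _]] := hp.
have := supf_le (order_idealN Ix) (order_idealZ c order_ideal_e) xc.
rewrite supfZ//; last exact: order_ideal_e.
move=> h; have := supfN Ix; have : c * p e <= c by rewrite ler_piMr// ltW.
lra.
Qed.

(** In [C(Omega)], [max_K] becomes the maximum over the points of [K] where [z]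
    is maximal. *)
Definition supf_refine z x : R :=
  inf [set r | exists2 s : R, 0 <= s & r = p (x + s *: z) - s * p z].

Variables (z : V) (Iz : I z).

Let Ixz x s : I x -> I (x + s *: z).
Proof. by move=> Ix; apply: order_idealD => //; exact: order_idealZ. Qed.

Let sZ (s : R) : 0 <= s -> p (s *: z) = s * p z.
Proof.
rewrite le_eqVlt => /predU1P[<-|s0]; first by rewrite scale0r supf0 mul0r.
exact: supfZ.
Qed.

Let lb x : I x ->
  lbound [set r | exists2 s : R, 0 <= s & r = p (x + s *: z) - s * p z] (- p (- x)).
Proof.
move=> Ix _ [s s0 ->]; have := supfD (Ixz s Ix) (order_idealN Ix).
by rewrite addrAC subrr add0r sZ//; lra.
Qed.

Let ne x : [set r | exists2 s : R, 0 <= s & r = p (x + s *: z) - s * p z] !=set0.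
Proof. by exists (p (x + 0 *: z) - 0 * p z), 0. Qed.

Lemma supf_refine_le x s : I x -> 0 <= s ->
  supf_refine z x <= p (x + s *: z) - s * p z.
Proof.
move=> Ix s0; apply: ge_inf; last by exists s.
by exists (- p (- x)); exact: lb.
Qed.

Lemma supf_refine_le0 x : I x -> supf_refine z x <= p x.
Proof.
by move=> /supf_refine_le/(_ (lexx 0)); rewrite scale0r addr0 mul0r subr0.
Qed.

(** By subadditivity [p (x + t *: z) - t * p z] is non-increasing in [t]. The infimum is thus a
    limit, and two elements can be estimated at a common [t]. *)
Lemma supf_refine_lt x r : I x -> supf_refine z x < r ->
  exists2 s : R, 0 <= s & forall t, s <= t -> p (x + t *: z) - t * p z < r.
Proof.
move=> Ix /(inf_lt (ne x))[_ [s s0 ->] sr]; exists s => // t st.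
apply: le_lt_trans sr.
have ts0 : 0 <= t - s by rewrite subr_ge0.
have := supfD (Ixz s Ix) (order_idealZ (t - s) Iz).
by rewrite sZ// -addrA -scalerDl (_ : s + (t - s) = t); [lra|ring].
Qed.

Lemma supf_refineP : sup_functional (supf_refine z).
Proof.
have [_ hU _ _ [pe pNe]] := hp; have Ie := order_ideal_e.
split.
- move=> x y Ix Iy xy; apply: lb_le_inf => // _ [s s0 ->].
  apply: (le_trans (supf_refine_le Ix s0)); rewrite lerB//.
  by apply: supf_le; [exact: Ixz|exact: Ixz|exact: vleD2r].
- move=> x y Ix Iy; have Ixy := order_ideal_join Ix Iy.
  apply/ler_addgt0Pl => d d0; set m := Num.max _ _.
  have [s s0 hs] : exists2 s : R, 0 <= s &
      forall t, s <= t -> p (x + t *: z) - t * p z < d + m.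
    by apply: supf_refine_lt => //; rewrite ltr_pwDl// le_max lexx.
  have [t t0 ht] : exists2 s : R, 0 <= s &
      forall t, s <= t -> p (y + t *: z) - t * p z < d + m.
    by apply: supf_refine_lt => //; rewrite ltr_pwDl// le_max lexx orbT.
  have u0 : 0 <= Num.max s t by rewrite le_max s0.
  apply: (le_trans (supf_refine_le Ixy u0)).
  have hsu : p (x + Num.max s t *: z) - Num.max s t * p z < d + m.
    by apply: hs; rewrite le_max lexx.
  have htu : p (y + Num.max s t *: z) - Num.max s t * p z < d + m.
    by apply: ht; rewrite le_max lexx orbT.
  set u := Num.max s t in u0 hsu htu *.
  have h0 :
      p (vjoin x y + u *: z) <= p (vjoin (x + u *: z) (y + u *: z)).
    apply: supf_le; [exact: Ixz|by apply: order_ideal_join; exact: Ixz|].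
    rewrite -[leRHS](subrK (u *: z)); apply: vleD2r; rewrite vleUx.
    have := vleD2r _ _ (- (u *: z)) (vleUl (x + u *: z) (y + u *: z)).
    have := vleD2r _ _ (- (u *: z)) (vleUr (x + u *: z) (y + u *: z)).
    by rewrite !addrK => -> ->.
  have h := le_trans h0 (hU _ _ (Ixz u Ix) (Ixz u Iy)).
  apply: ltW; rewrite ltrBlDr; apply: (le_lt_trans h).
  by rewrite gt_max; apply/andP; split; rewrite -ltrBlDr.
- move=> x y Ix Iy; have Ixy := order_idealD Ix Iy.
  apply/ler_addgt0Pl => d d0.
  have d20 : 0 < d / 2 by rewrite divr_gt0.
  have [s s0 /(_ s (lexx s)) hs] : exists2 s : R, 0 <= s &
      forall t, s <= t -> p (x + t *: z) - t * p z < d / 2 + supf_refine z x.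
    by apply: supf_refine_lt => //; rewrite ltrDr.
  have [t t0 /(_ t (lexx t)) ht] : exists2 s : R, 0 <= s &
      forall t, s <= t -> p (y + t *: z) - t * p z < d / 2 + supf_refine z y.
    by apply: supf_refine_lt => //; rewrite ltrDr.
  apply: (le_trans (supf_refine_le Ixy (addr_ge0 s0 t0))).
  have := supfD (Ixz s Ix) (Ixz t Iy).
  by rewrite addrACA -scalerDl mulrDl; lra.
- move=> c x Ix c0; apply/ler_addgt0Pl => d d0.
  have [s s0 /(_ s (lexx s)) hs] : exists2 s : R, 0 <= s &
      forall t, s <= t -> p (x + t *: z) - t * p z < d / c + supf_refine z x.
    by apply: supf_refine_lt => //; rewrite ltrDr divr_gt0.
  have cs0 : 0 <= c * s by rewrite mulr_ge0// ltW.
  apply: (le_trans (supf_refine_le (order_idealZ c Ix) cs0)).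
  rewrite -scalerA -scalerDr supfZ//; last exact: Ixz.
  rewrite -mulrA -mulrBr; apply: ltW.
  have -> : d + c * supf_refine z x = c * (d / c + supf_refine z x).
    by field; rewrite gt_eqF.
  by rewrite ltr_pM2l.
- split; first exact: le_trans (supf_refine_le0 Ie) pe.
  exact: le_trans (supf_refine_le0 (order_idealN Ie)) pNe.
Qed.

(** The value at [s = 1]. For a minimal [p], it forces [p] to be odd. *)
Lemma supf_refineN : supf_refine z (- z) <= - p z.
Proof.
have := supf_refine_le (order_idealN Iz) ler01.
by rewrite scale1r addNr supf0 mul1r sub0r.
Qed.

End SupFunctional.

(** Zorn's lemma below [p], with smaller functionals counted as later. The relation is only a
    preorder, since functionals that agree on the ideal may differ outside it. *)
Lemma sup_functional_minimal p : sup_functional p ->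
  exists q, [/\ sup_functional q, forall x, I x -> q x <= p x &
    forall q', sup_functional q' -> (forall x, I x -> q' x <= q x) ->
      forall x, I x -> q x <= q' x].
Proof.
move=> hp.
pose T := {q : V -> R | sup_functional q}.
pose rel (q q' : T) := `[< forall x, I x -> sval q' x <= sval q x >].
pose T' := {q : T | rel (exist _ p hp) q}.
pose rel' (q q' : T') := rel (sval q) (sval q').
have relxx (q : T) : rel q q by apply/asboolP => x _.
have rel_trans (q r s : T) : rel q r -> rel r s -> rel q s.
  move=> /asboolP qr /asboolP rs; apply/asboolP => x Ix.
  exact: le_trans (rs x Ix) (qr x Ix).
have [A tA|q hq] := @ZL_preorder T' (exist _ (exist _ p hp) (relxx _)) rel'
    (fun t => relxx (sval t)) (fun r s t => rel_trans (sval r) (sval s) (sval t)).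
- have [A0|/forallNP A0] := pselect (exists q, A q); last first.
    by exists (exist _ (exist _ p hp) (relxx _)) => s /A0.
  have [q0 Aq0] := A0.
  pose S x := [set sval (sval q) x | q in A].
  have lbS x : I x -> has_lbound (S x).
    move=> Ix; have [c c0 xc] := order_ideal_bound Ix.
    exists (- (c + 1)) => _ [q Aq <-]; have hq := svalP (sval q).
    apply: (supf_lb hq Ix).
    + apply: (le_trans (vabs_geN x)); apply: (le_trans xc).
      by apply: vscaler_le => //; rewrite lerDl.
    + by rewrite ltr_wpDl.
  have neS x : S x !=set0 by exists (sval (sval q0) x), q0.
  pose m x := inf (S x).
  have mle q x : A q -> I x -> m x <= sval (sval q) x.
    by move=> Aq Ix; apply: ge_inf; [exact: lbS|exists q].
  have mlt x r : m x < r -> exists2 q, A q & sval (sval q) x < r.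
    by move=> /(inf_lt (neS x))[_ [q Aq <-] ?]; exists q.
  (* Since [A] is a chain, a single member is close to the infimum at both points; this transfers
     the conditions on two elements to [m]. *)
  have mlt2 x y r r' : I x -> I y -> m x < r -> m y < r' ->
      exists q, [/\ A q, sval (sval q) x < r & sval (sval q) y < r'].
    move=> Ix Iy /mlt[q Aq qx] /mlt[q' Aq' q'y].
    have [/asboolP qq'|/asboolP qq'] := tA q q' Aq Aq'.
      by exists q'; split => //; exact: le_lt_trans (qq' x Ix) qx.
    by exists q; split => //; exact: le_lt_trans (qq' y Iy) q'y.
  have hm : sup_functional m.
    have Ie := order_ideal_e; split.
    + move=> x y Ix Iy xy; apply: lb_le_inf => // _ [q Aq <-].
      exact: le_trans (mle q x Aq Ix) (supf_le (svalP (sval q)) Ix Iy xy).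
    + move=> x y Ix Iy; apply/ler_addgt0Pl => d d0.
      have [q [Aq qx qy]] : exists q, [/\ A q,
          sval (sval q) x < d + Num.max (m x) (m y) &
          sval (sval q) y < d + Num.max (m x) (m y)].
        by apply: mlt2 => //; rewrite ltr_pwDl// le_max lexx ?orbT.
      apply: (le_trans (mle q _ Aq (order_ideal_join Ix Iy))).
      have [_ h _ _ _] := svalP (sval q).
      by apply: (le_trans (h x y Ix Iy)); rewrite ge_max !ltW.
    + move=> x y Ix Iy; apply/ler_addgt0Pl => d d0.
      have d20 : 0 < d / 2 by rewrite divr_gt0.
      have [q [Aq qx qy]] : exists q, [/\ A q,
          sval (sval q) x < d / 2 + m x & sval (sval q) y < d / 2 + m y].
        by apply: mlt2 => //; rewrite ltrDr.
      apply: (le_trans (mle q _ Aq (order_idealD Ix Iy))).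
      by have := supfD (svalP (sval q)) Ix Iy; lra.
    + move=> c x Ix c0; rewrite mulrC -ler_pdivrMr//.
      apply: lb_le_inf => // _ [q Aq <-]; rewrite ler_pdivrMr// mulrC.
      apply: (le_trans (mle q _ Aq (order_idealZ c Ix))).
      by rewrite (supfZ (svalP (sval q))).
    + have [_ _ _ _ [h1 h2]] := svalP (sval q0); split.
        exact: le_trans (mle q0 e Aq0 Ie) h1.
      exact: le_trans (mle q0 _ Aq0 (order_idealN Ie)) h2.
  have pm : rel (exist _ p hp) (exist _ m hm).
    apply/asboolP => x Ix; apply: (le_trans (mle q0 x Aq0 Ix)).
    by have /asboolP := svalP q0; exact.
  exists (exist _ (exist _ m hm) pm) => s As; apply/asboolP => x Ix /=.
  exact: mle.
- exists (sval (sval q)); split; first exact: svalP (sval q).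
    by have /asboolP := svalP q.
  move=> q' hq' q'q; have r1 : rel (sval q) (exist _ q' hq') by apply/asboolP.
  have r2 := rel_trans _ _ _ (svalP q) r1.
  by have /asboolP := hq (exist _ (exist _ q' hq') r2) r1.
Qed.

(** Minimality against the refinement at [x] gives [q (- x) = - q x]. A subadditive odd functional
    is additive, the inequality for joins becomes an equality by monotonicity, and meets follow by
    negation. *)
Lemma minimal_sup_functional_hom q : sup_functional q ->
  (forall q', sup_functional q' -> (forall x, I x -> q' x <= q x) ->
      forall x, I x -> q x <= q' x) ->
  lattice_hom e q /\ q e = 1.
Proof.
move=> hq qmin.
have qN x : I x -> q (- x) = - q x.
  move=> Ix; have := qmin _ (supf_refineP hq Ix) (supf_refine_le0 hq Ix) _ (order_idealN Ix).
  move=> /le_trans/(_ (supf_refineN hq Ix)) h.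
  by have := supfN hq Ix => h'; apply/eqP; rewrite eq_le h/= lerNl.
have qD x y : I x -> I y -> q (x + y) = q x + q y.
  move=> Ix Iy; apply/eqP; rewrite eq_le supfD//=.
  have := supfD hq (order_idealN Ix) (order_idealN Iy).
  by rewrite -opprD !qN//; [lra|exact: order_idealD].
have qZ a x : I x -> q (a *: x) = a * q x.
  move=> Ix; have [a0|a0|->] := ltgtP a 0; last by rewrite scale0r supf0// mul0r.
    rewrite -[a *: x]opprK -scaleNr qN; last exact: order_idealZ.
    by rewrite (supfZ hq)// ?oppr_gt0// mulNr opprK.
  exact: supfZ.
have qU x y : I x -> I y -> q (vjoin x y) = Num.max (q x) (q y).
  move=> Ix Iy; have Ixy := order_ideal_join Ix Iy.
  have [_ hU _ _ _] := hq; apply/eqP; rewrite eq_le hU//= ge_max.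
  by rewrite !supf_le ?vleUl ?vleUr.
split; first split => //.
- by move=> a x y Ix Iy; rewrite qD ?qZ//; exact: order_idealZ.
- move=> x y Ix Iy; have [Ix' Iy'] := (order_idealN Ix, order_idealN Iy).
  rewrite vmeetE qN; last exact: order_ideal_join.
  by rewrite qU// !qN// oppr_max !opprK.
have [_ _ _ _ [h1 h2]] := hq; move: h2; rewrite qN; last exact: order_ideal_e.
by move=> h2; apply/eqP; rewrite eq_le h1/= -lerN2.
Qed.

Hypothesis arch : archimedean V.

Lemma archimedean_le x y z : 0 <= z ->
  (forall d : R, 0 < d -> x <= y + d *: z) -> x <= y.
Proof.
move=> z0 h; rewrite -[leRHS]addr0 addrC -vlerBlDr; apply: (@arch _ z) => -[|n].
  by rewrite scale0r.
have n0 : 0 < n.+1%:R^-1 :> R by rewrite invr_gt0.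
have := vscale_le (ltW (ltr0Sn R n)) (_ : x - y <= n.+1%:R^-1 *: z).
rewrite scalerA divff ?pnatr_eq0// scale1r; apply.
by rewrite vlerBlDr addrC h.
Qed.

(** In [C(Omega)] this is the maximum of [x], possibly negative: the functional with [K] all of
    [Omega], at which the refinement starts. *)
Definition gauge x : R := inf [set c | x <= c *: e].

Lemma gauge_ne x : I x -> [set c | x <= c *: e] !=set0.
Proof. by move=> [c xc]; exists c; exact: le_trans (vabs_ge x) xc. Qed.

Hypothesis e_neq0 : e != 0.

Lemma gauge_lb x : I x -> has_lbound [set c | x <= c *: e].
Proof.
move=> [d xd]; exists (- d) => c /= xc; rewrite leNgt; apply/negP => cd.
have : 0 <= (c + d) *: e.
  rewrite scalerDl -[0](addNr (vabs x)).
  exact: vleD (le_trans (vabs_geNl x) xc) xd.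
move=> h; have : 0 < - (c + d) by rewrite oppr_gt0; lra.
move=> cd0; have := vscale_le (ltW (_ : 0 < (- (c + d))^-1)) h.
rewrite invr_gt0 scaler0 scalerA => /(_ cd0).
rewrite -[(c + d) in X in _ * X]opprK mulrN mulVf ?gt_eqF// scaleN1r => eN.
by move/eqP : e_neq0; apply; apply/eqP; rewrite eq_le e0 -vleN oppr0 eN.
Qed.

Lemma gauge_le x c : I x -> x <= c *: e -> gauge x <= c.
Proof. by move=> Ix xc; apply: ge_inf => //; exact: gauge_lb. Qed.

Lemma gauge_lt x c : I x -> gauge x < c -> x <= c *: e.
Proof.
move=> Ix /(inf_lt (gauge_ne Ix))[d /= xd dc].
by apply: (le_trans xd); apply: vscaler_le => //; exact: ltW.
Qed.

Lemma gaugeP : sup_functional gauge.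
Proof.
have Ie := order_ideal_e.
split.
- move=> x y Ix Iy xy; apply/ler_addgt0Pl => d d0; apply: gauge_le => //.
  by apply: (le_trans xy); apply: gauge_lt => //; rewrite ltrDr.
- move=> x y Ix Iy; apply/ler_addgt0Pl => d d0.
  apply: gauge_le; first exact: order_ideal_join.
  by rewrite vleUx !gauge_lt// ltr_pwDl// le_max lexx ?orbT.
- move=> x y Ix Iy; apply/ler_addgt0Pl => d d0.
  apply: gauge_le; first exact: order_idealD.
  have -> : d + (gauge x + gauge y) = (d / 2 + gauge x) + (d / 2 + gauge y).
    by field.
  by rewrite scalerDl vleD// gauge_lt// ltrDr divr_gt0.
- move=> c x Ix c0; apply/ler_addgt0Pl => d d0.
  apply: gauge_le; first exact: order_idealZ.
  have -> : d + c * gauge x = c * (d / c + gauge x).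
    by field; rewrite gt_eqF.
  rewrite -scalerA; apply: vscale_le; first exact: ltW.
  by apply: gauge_lt => //; rewrite ltrDr divr_gt0.
- split; first by apply: gauge_le => //; rewrite scale1r.
  apply: gauge_le; first exact: order_idealN.
  by rewrite scaleN1r.
Qed.

(** [gauge z] is positive by the Archimedean property. Refining at [z] before passing to a minimal
    [q] fixes the sign of [q z]: [- q z = q (- z) <= - gauge z]. *)
Lemma exists_hom_gt0 z : I z -> ~ z <= 0 ->
  exists chi, [/\ lattice_hom e chi, chi e = 1 & 0 < chi z].
Proof.
move=> Iz z0; have gz : 0 < gauge z.
  rewrite ltNge; apply/negP => gz; apply: z0.
  apply: (@archimedean_le _ _ e) => // d d0; rewrite add0r.
  by apply: gauge_lt => //; exact: le_lt_trans gz d0.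
have [q [hq qle qmin]] := sup_functional_minimal (supf_refineP gaugeP Iz).
have [qhom qe] := minimal_sup_functional_hom hq qmin.
exists q; split => //; apply: (lt_le_trans gz).
have := le_trans (qle _ (order_idealN Iz)) (supf_refineN gaugeP Iz).
by rewrite (homN qhom)// lerN2.
Qed.

End Ideal.

Lemma hom_order e : archimedean V -> 0 <= e -> forall x y,
  order_ideal e x -> order_ideal e y ->
  (forall chi, lattice_hom e chi -> chi e = 1 -> chi x <= chi y) -> x <= y.
Proof.
move=> arch e0 x y Ix Iy h; rewrite -vsubr_ge0 -vleN opprB oppr0.
have Ixy := order_idealB Ix Iy; apply: contrapT => xy.
(* For [e = 0] no homomorphism satisfies [chi e = 1], but the ideal is then zero. *)
have [ez|ez] := eqVneq e 0.
  apply: xy; case: Ixy => c; rewrite ez scaler0 => /vabs_eq0 ->.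
  exact: lexx.
have [chi [hchi chie]] := exists_hom_gt0 e0 arch ez Ixy xy.
by rewrite (homB hchi)// subr_gt0 ltNge h.
Qed.

Lemma hom_eq e : archimedean V -> 0 <= e -> forall x y,
  order_ideal e x -> order_ideal e y ->
  (forall chi, lattice_hom e chi -> chi e = 1 -> chi x = chi y) -> x = y.
Proof.
move=> arch e0 x y Ix Iy h; apply/eqP; rewrite eq_le.
by apply/andP; split; apply: (hom_order arch e0) => // chi hc hce; rewrite h.
Qed.

End Homomorphisms.
(** * Kakutani's representation theorem *)

Section Topology.

Lemma compact_set_type (T : topologicalType) (K : set T) :
  compact K -> compact [set: set_type K].
Proof.
move=> cK F FF _.
have [|p [Kp clp]] := cK (set_val @ F).
  by apply: (@filterS _ F FF setT); [move=> x _; exact: set_valP|exact: filterT].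
exists (exist _ p (mem_set Kp)); split=> // A B FA [/= B' [[W oW <-]] Wp WB].
have [|q [[r Ar rq] Wq]] := clp (set_val @` A) W _ (open_nbhs_nbhs (conj oW Wp)).
  by apply: (@filterS _ F FF A) => // x Ax; exists x.
by exists r; split => //; apply: WB => /=; rewrite rq.
Qed.

Lemma hausdorff_set_type (T : topologicalType) (K : set T) :
  hausdorff_space T -> hausdorff_space (set_type K).
Proof.
move=> hT p q clpq; apply: val_inj; apply: hT => A B nA nB.
have cv : continuous (set_val : set_type K -> T) by exact: initial_continuous.
have [r [Ar Br]] := clpq _ _ (cv p _ nA) (cv q _ nB).
by exists (set_val r).
Qed.

(** If near each point the property holds for all late indices, then one index serves all points.
    The indices will be lattice elements, directed by meets and then by joins, which gives the two
    halves of the Stone-Weierstrass argument. *)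
Lemma near_covering_directed (T : topologicalType) (I : Type) (le : I -> I -> Prop)
    (D : set I) (P : I -> T -> Prop) :
  compact [set: T] -> D !=set0 -> (forall i, le i i) ->
  (forall i j, D i -> D j -> exists k, [/\ D k, le i k & le j k]) ->
  (forall i j k, le i j -> le j k -> le i k) ->
  (forall t : T, exists2 i, D i & \forall t' \near t, forall j, D j -> le i j -> P j t') ->
  exists2 i, D i & forall t, P i t.
Proof.
move=> /compact_near_coveringP cT D0 lexx dir trans hP.
pose F := filter_from D (fun i => [set j | D j /\ le i j]).
have FF : Filter F.
  apply: filter_from_filter => // i j Di Dj.
  have [k [Dk ik jk]] := dir i j Di Dj; exists k => // l [Dl kl].
  by split; split => //; [exact: trans ik kl|exact: trans jk kl].
have [i Di hi] : \near F, [set: T] `<=` P F.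
  apply: cT => t _; have [i Di it] := hP t.
  exists ([set t' | forall j, D j -> le i j -> P j t'], [set j | D j /\ le i j]).
    by split => //=; exists i.
  by move=> [t' j] [/= h [Dj ij]]; exact: h.
by exists i => // t; apply: (hi i).
Qed.

Section RealContinuity.
Context {R : realType} {T : topologicalType}.
Variables (f g h : T -> R).
Hypotheses (cf : continuous f) (cg : continuous g) (ch : continuous h).

Lemma continuous_defect_lin (a : R) : continuous (fun t => f t - (a * g t + h t)).
Proof.
move=> t; apply: cvgB; first exact: cf.
by apply: cvgD; [apply: cvgM; [exact: cvg_cst|exact: cg]|exact: ch].
Qed.

Lemma continuous_defect_max : continuous (fun t => f t - Num.max (g t) (h t)).
Proof.
move=> t; apply: cvgB; first exact: cf.
by apply: continuous_max; [exact: cg|exact: ch].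
Qed.

Lemma continuous_defect_min : continuous (fun t => f t - Num.min (g t) (h t)).
Proof.
move=> t; apply: cvgB; first exact: cf.
by apply: continuous_min; [exact: cg|exact: ch].
Qed.

Lemma continuous_defect_cst (c : R) : continuous (fun t => f t - c).
Proof. by move=> t; apply: cvgB; [exact: cf|exact: cvg_cst]. Qed.

Lemma near_lt_continuous t : f t < g t -> \forall s \near t, f s < g s.
Proof.
rewrite -subr_gt0 => fg; have : (fun s => g s - f s) @ t --> g t - f t.
  by apply: cvgB; [exact: cg|exact: cf].
by move/cvgr_gt/(_ _ fg); apply: filterS => s; rewrite subr_gt0.
Qed.

End RealContinuity.

End Topology.

Section Kakutani.
Context {R : realType} {V : vectorLatticeType R} (e : V).
Hypotheses (arch : archimedean V) (e0 : 0 <= e).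
Notation I := (order_ideal e).
Notation P := (prod_topology (fun _ : V => R)).

(** The values outside the ideal are fixed, so that the characters form a
    compact Hausdorff space. *)
Definition characters : set P :=
  [set chi | [/\ lattice_hom e chi, chi e = 1 & forall x, ~ I x -> chi x = 0]].

Lemma character_hom (w : set_type characters) : lattice_hom e (set_val w).
Proof. by have [] := set_valP w. Qed.

Lemma character1 (w : set_type characters) : set_val w e = 1.
Proof. by have [] := set_valP w. Qed.

Lemma hom_character chi : lattice_hom e chi -> chi e = 1 ->
  exists w : set_type characters, forall x, I x -> set_val w x = chi x.
Proof.
move=> hchi chie.
pose chi' x := if asbool (I x) then chi x else 0.
have E x : I x -> chi' x = chi x by rewrite /chi' => /asboolT ->.
have K : characters chi'.
  split.
  - split.
    + move=> a x y Ix Iy; rewrite !E//; first exact: (hom_lin hchi).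
      by apply: order_idealD => //; exact: order_idealZ.
    + by move=> x y Ix Iy; rewrite !E ?(hom_join hchi)//; exact: order_ideal_join.
    + by move=> x y Ix Iy; rewrite !E ?(hom_meet hchi)//; exact: order_ideal_meet.
  - by rewrite E//; exact: order_ideal_e.
  - by move=> x nIx; rewrite /chi' asboolF.
by exists (exist _ (chi' : P) (mem_set K)) => x Ix; rewrite -E.
Qed.

Lemma proj_cont (x : V) : continuous (fun chi : P => chi x).
Proof. exact: (@proj_continuous V (fun=> R) x). Qed.

Lemma characters_compact : compact characters.
Proof.
have /choice[N hN] : forall x, exists N : R, forall chi, characters chi -> `|chi x| <= N.
  move=> x; have [Ix|nIx] := pselect (I x); last first.
    by exists 0 => chi [_ _ ->//]; rewrite normr0.
  have [c c0 xc] := order_ideal_bound e0 Ix; exists c => chi [hchi chie _].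
  rewrite -(hom_abs hchi)// -[c]mulr1 -chie -(homZ hchi); last exact: order_ideal_e.
  apply: (hom_le hchi) => //; first exact: order_ideal_abs.
  by apply: order_idealZ; exact: order_ideal_e.
apply: subclosed_compact (@tychonoff _ _ (fun x => `[- N x, N x]%classic) _) _; last 2 first.
- by move=> x; exact: segment_compact.
- by move=> chi hchi x /=; rewrite in_itv/= -ler_norml hN.
(* Each condition defining a character says that some continuous function of [chi] vanishes. Taking
   all continuous functions that vanish on [characters] treats these conditions uniformly. *)
pose D := [set F : P -> R | continuous F /\ forall chi, characters chi -> F chi = 0].
have -> : characters = \bigcap_(F in D) F @^-1` [set 0].
  apply/seteqP; split=> [chi hchi F [_ hF]|chi hchi]; first exact: hF.
  have h (F : P -> R) : continuous F -> (forall chi, characters chi -> F chi = 0) -> F chi = 0.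
    by move=> cF hF; apply: hchi.
  split; first split.
  - move=> a x y Ix Iy; apply/eqP; rewrite -subr_eq0; apply/eqP.
    apply: (h (fun chi => chi (a *: x + y) - (a * chi x + chi y))).
      exact: continuous_defect_lin (@proj_cont _) (@proj_cont _) (@proj_cont _) _.
    by move=> f [hf _ _]; rewrite (hom_lin hf)// subrr.
  - move=> x y Ix Iy; apply/eqP; rewrite -subr_eq0; apply/eqP.
    apply: (h (fun chi => chi (vjoin x y) - Num.max (chi x) (chi y))).
      exact: continuous_defect_max (@proj_cont _) (@proj_cont _) (@proj_cont _).
    by move=> f [hf _ _]; rewrite (hom_join hf)// subrr.
  - move=> x y Ix Iy; apply/eqP; rewrite -subr_eq0; apply/eqP.
    apply: (h (fun chi => chi (vmeet x y) - Num.min (chi x) (chi y))).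
      exact: continuous_defect_min (@proj_cont _) (@proj_cont _) (@proj_cont _).
    by move=> f [hf _ _]; rewrite (hom_meet hf)// subrr.
  - apply/eqP; rewrite -subr_eq0; apply/eqP; apply: (h (fun chi => chi e - 1)).
      exact: continuous_defect_cst (@proj_cont _) _.
    by move=> f [_ -> _]; rewrite subrr.
  - move=> x nIx; apply: (h (fun chi => chi x)); first exact: proj_cont.
    by move=> f [_ _ ->].
apply: closed_bigI => F [cF _]; move/continuous_closedP : cF; apply.
exact: closed_eq.
Qed.

(** Completeness of the ideal for the order unit norm of [e], stated for sequences with geometric
    increments. The constant [C] leaves room for splitting the increments between X0 and X1. *)
Definition uniformly_complete : Prop := forall u : nat -> V,
  (forall n, vabs (u n.+1 - u n) <= 2^-1 ^+ n *: e) ->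
  exists x, exists2 C : R, 0 <= C & forall n, vabs (x - u n) <= (C * 2^-1 ^+ n) *: e.

Hypothesis complete : uniformly_complete.

Notation Omega := (set_type characters).

Let ev_cont x : continuous (fun w : Omega => set_val w x : R).
Proof.
move=> w; apply: (@continuous_comp _ _ _ (set_val : Omega -> P) (fun chi => chi x)).
  exact: initial_continuous.
exact: proj_cont.
Qed.

Let Omega_compact : compact [set: Omega].
Proof. exact/compact_set_type/characters_compact. Qed.

Section Approximation.
Variables (f : Omega -> R) (cf : continuous f) (d : R) (d0 : 0 < d).

(** Interpolation at two points by an affine function of an element separating them. Only the
    one-sided bounds used later are kept, the second one strict so that it persists near [w']. *)
Let interpolate w w' : exists2 x, I x & f w <= set_val w x /\ set_val w' x < f w' + d.
Proof.
have Ie := order_ideal_e e0.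
have [<-|ww'] := pselect (w = w').
  exists (f w *: e); first exact: order_idealZ.
  by rewrite !(homZ (character_hom w))// character1 mulr1 lexx ltrDl.
(* Characters vanish outside the ideal, so distinct ones already differ on it. *)
have [y [Iy wy]] : exists y, I y /\ set_val w y != set_val w' y.
  apply: contrapT => h; apply: ww'; apply: val_inj; apply: funext => x.
  have [Ix|nIx] := pselect (I x).
    by apply: contrapT => /eqP wx; apply: h; exists x.
  by have [_ _ ->//] := set_valP w; have [_ _ ->] := set_valP w'.
set a := set_val w y in wy *; set b := set_val w' y in wy *.
have ab : a - b != 0 by rewrite subr_eq0.
pose k := (f w - f w') / (a - b).
have Iky : I (k *: (y - a *: e)).
  by apply/order_idealZ/order_idealB => //; exact: order_idealZ.
have Iye : I (y - a *: e) by apply: order_idealB => //; exact: order_idealZ.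
exists (f w *: e + k *: (y - a *: e)); first by apply: order_idealD => //; exact: order_idealZ.
have E (v : Omega) : set_val v (f w *: e + k *: (y - a *: e)) =
    f w + k * (set_val v y - a).
  have hv := character_hom v.
  rewrite (homD hv) ?(homZ hv) ?(homB hv) ?(homZ hv) ?character1 ?mulr1//;
    exact: order_idealZ.
rewrite !E -/a -/b subrr mulr0 addr0; split; first by [].
have -> : f w + k * (b - a) = f w' by rewrite /k; field.
by rewrite ltrDl.
Qed.

Let below w : exists2 x, I x & f w <= set_val w x /\ forall w', set_val w' x < f w' + d.
Proof.
have Ie := order_ideal_e e0.
(* The order is reversed, so that meets are the upper bounds of the directed set. *)
have [|i|x y [Ix fx] [Iy fy]|x y z yx zy|w'|x [Ix fx] h] := @near_covering_directed _ V (fun x y => y <= x)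
  [set x | I x /\ f w <= set_val w x] (fun x (w' : Omega) => set_val w' x < f w' + d) Omega_compact.
- exists (f w *: e); split; first exact: order_idealZ.
  by rewrite (homZ (character_hom w))// character1 mulr1.
- exact: lexx.
- exists (vmeet x y); split; [|exact: vleIl|exact: vleIr].
  split; first exact: order_ideal_meet.
  by rewrite (hom_meet (character_hom w))// le_min fx.
- exact: le_trans zy yx.
- have [x Ix [fx xf]] := interpolate w w'.
  exists x; first by split.
  have xf' : set_val w' x - d < f w' by rewrite ltrBlDr.
  have := near_lt_continuous (continuous_defect_cst (@ev_cont x) (c := d)) cf xf'.
  apply: filterS => t; rewrite ltrBlDr => ht y [Iy _] yx.
  by apply: le_lt_trans ht; exact: (hom_le (character_hom t)).
- by exists x.
Qed.

Lemma characters_dense : exists2 x, I x & forall w, `|f w - set_val w x| < d.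
Proof.
have Ie := order_ideal_e e0.
have [[w0]|/forallNP nO] := pselect (exists w : Omega, True); last first.
  by exists 0; [exact: order_ideal0|move=> w; have := nO w].
have [|i|x y [Ix fx] [Iy fy]|x y z|w|x [Ix fx] h] := @near_covering_directed _ V (fun x y => x <= y)
  [set x | I x /\ forall w, set_val w x < f w + d]
  (fun x (w : Omega) => f w - d < set_val w x) Omega_compact.
- by have [x Ix [_ ?]] := below w0; exists x.
- exact: lexx.
- exists (vjoin x y); split; [|exact: vleUl|exact: vleUr].
  split; first exact: order_ideal_join.
  by move=> w; rewrite (hom_join (character_hom w))// gt_max fx fy.
- exact: le_trans.
- have [x Ix [fx xf]] := below w.
  exists x; first by split.
  have fx' : f w - d < set_val w x by rewrite ltrBlDr (le_lt_trans fx)// ltrDl.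
  have := near_lt_continuous (continuous_defect_cst cf (c := d)) (@ev_cont x) fx'.
  apply: filterS => t ht y [Iy _] xy.
  by apply: lt_le_trans ht _; exact: (hom_le (character_hom t)).
- exists x => // w; rewrite ltr_norml; have := fx w; have := h w; lra.
Qed.

End Approximation.

Lemma vabs_le_characters x c : I x -> (forall w : Omega, `|set_val w x| <= c) ->
  vabs x <= c *: e.
Proof.
move=> Ix h; have Ie := order_ideal_e e0.
apply: (hom_order arch e0); [exact: order_ideal_abs|exact: order_idealZ|].
move=> chi hchi chie; have [w hw] := hom_character hchi chie.
by rewrite (hom_abs hchi)// (homZ hchi)// chie mulr1 -hw.
Qed.

Lemma pow2_lt (d : R) : 0 < d -> exists n : nat, 2^-1 ^+ n < d.
Proof.
move=> d0; have := @cvg_geometric R 1 2^-1 _; rewrite ger0_norm ?invr_ge0// invf_lt1 ?ltr1n//.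
move=> /(_ isT) /cvgr0Pnorm_lt /(_ d d0) [n _ /(_ n (leqnn n))].
by rewrite /= mul1r normrX ger0_norm ?invr_ge0//; exists n.
Qed.

Lemma characters_surjective (f : Omega -> R) : continuous f ->
  exists2 x, I x & forall w, set_val w x = f w.
Proof.
move=> cf; have Ie := order_ideal_e e0.
(* Consecutive errors, one half and one quarter of [2^-1 ^+ n], add up to less than the increment
   allowed by [complete]. *)
have q0 n : 0 < 2^-1 ^+ n / 2 :> R by rewrite divr_gt0// exprn_gt0// invr_gt0.
have /choice[u hu] : forall n : nat, exists x, I x /\
    forall w, `|f w - set_val w x| < 2^-1 ^+ n / 2.
  by move=> n; have [x Ix h] := characters_dense cf (q0 n); exists x.
have Iu n : I (u n) by have [] := hu n.
have [n|x [C C0 xC]] := complete (u := u).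
  apply: vabs_le_characters; first exact: order_idealB.
  move=> w; rewrite (homB (character_hom w))//.
  have [_ /(_ w) h1] := hu n; have [_ /(_ w) h2] := hu n.+1.
  have -> : set_val w (u n.+1) - set_val w (u n) =
     (f w - set_val w (u n)) - (f w - set_val w (u n.+1)) by ring.
  apply: (le_trans (ler_normB _ _)); move: h1 h2 (q0 n); rewrite exprS; lra.
have Ixu n : I (x - u n) by exists (C * 2^-1 ^+ n).
have Ix : I x by rewrite -[x](subrK (u 0%N)); exact: order_idealD.
exists x => // w; apply/eqP; rewrite -subr_eq0 -normr_le0; apply/ler_addgt0Pl => d d0.
have C1 : 0 < C + 1 by rewrite ltr_wpDl.
have [n hn] := pow2_lt (divr_gt0 d0 C1).
have -> : set_val w x - f w = set_val w (x - u n) - (f w - set_val w (u n)).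
  by rewrite (homB (character_hom w))//; ring.
rewrite addr0; apply: (le_trans (ler_normB _ _)); rewrite -(hom_abs (character_hom w))//.
have [_ /(_ w) h1] := hu n.
have : set_val w (vabs (x - u n)) <= set_val w ((C * 2^-1 ^+ n) *: e).
  apply: (hom_le (character_hom w)) => //; first exact: order_ideal_abs.
  exact: order_idealZ.
rewrite (homZ (character_hom w))// character1 mulr1.
move: hn; rewrite ltr_pdivlMr// => hn; have := q0 n; nra.
Qed.

Theorem kakutani (E : set V) : principal_ideal E e = I ->
  lattice_iso_C (principal_ideal E e) (fun x (w : Omega) => set_val w x).
Proof.
move=> ->; split.
- split.
  + by move=> x Ix; exact: ev_cont.
  + move=> x y; rewrite !inE => Ix Iy xy; apply: (hom_eq arch e0) => // chi hchi chie.
    have [w hw] := hom_character hchi chie; rewrite -!hw//.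
    by have := congr1 (fun g => g w) xy.
  + move=> f cf; have [x Ix h] := characters_surjective cf.
    by exists x => //; exact: funext.
- by move=> a x y Ix Iy w; exact: (hom_lin (character_hom w)).
- by move=> x y Ix Iy w; exact: (hom_join (character_hom w)).
- by move=> x y Ix Iy w; exact: (hom_meet (character_hom w)).
Qed.

Lemma characters_compact_hausdorff :
  compact [set: Omega] /\ hausdorff_space Omega.
Proof.
split; first exact: Omega_compact.
apply: hausdorff_set_type; apply: (@hausdorff_product V (fun=> R)) => _.
exact: Rhausdorff.
Qed.

End Kakutani.
(** * Quasi-Banach lattices and sums of compatible pairs *)

Section QuasiBanach.
Context {R : realType} {E : quasiBanachLatticeType R}.
Implicit Types x y z a : E.

Lemma qnorm0 : qnorm (0 : E) = 0.
Proof. by rewrite -(scale0r (0 : E)) qnormZ normr0 mul0r. Qed.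

Lemma qnorm_abs x : qnorm (vabs x) = qnorm x.
Proof. by apply/eqP; rewrite eq_le !ler_qnorm// vabs_abs. Qed.

Lemma qnorm_le x y : 0 <= x -> x <= y -> qnorm x <= qnorm y.
Proof. by move=> x0 xy; apply: ler_qnorm; rewrite (vabs_id x0) (le_trans xy) ?vabs_ge. Qed.

(** The quasi-norm need not be continuous, so the order is shown to be closed by monotonicity: the
    positive part of [x] is dominated by [vabs (u n - l)], whose quasi-norm tends to 0. *)
Lemma qnorm_limit_le (u : nat -> E) l x (m : nat) :
  qnorm (u n - l) @[n --> \oo] --> (0 : R) ->
  (forall n, (m <= n)%N -> x <= vabs (u n - l)) -> x <= 0.
Proof.
move=> ul xu; have t0 : 0 <= vjoin x 0 by exact: vleUr.
suff /qnorm0_eq0 <- : qnorm (vjoin x 0) = 0 by exact: vleUl.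
apply/eqP; rewrite eq_le qnorm_ge0 andbT; apply/ler_addgt0Pl => d d0.
have /cvgr0Pnorm_lt/(_ d d0)[N _ hN] := ul.
have /= := hN (maxn N m) (leq_maxl _ _); rewrite ger0_norm ?qnorm_ge0// => h.
rewrite addr0; apply: (le_trans _ (ltW h)); rewrite -qnorm_abs.
rewrite -[leRHS]qnorm_abs; apply: ler_qnorm; rewrite !vabs_abs (vabs_id t0).
by rewrite vleUx vabs_ge0 andbT xu// leq_maxr.
Qed.

(** The tail estimate holds in the order and not only in quasi-norm, because differences of partial
    sums satisfy it and it survives the limit by [qnorm_limit_le]. *)
Lemma qnorm_series (c : nat -> E) a : 0 <= a ->
  (forall n, vabs (c n) <= 2^-1 ^+ n *: a) ->
  exists l, forall n, vabs (l - \sum_(i < n) c i) <= (2 * 2^-1 ^+ n) *: a.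
Proof.
move=> a0 ca; pose S n := \sum_(i < n) c i.
have p0 n : 0 <= 2^-1 ^+ n :> R by rewrite exprn_ge0// invr_ge0.
have SD n k : vabs (S (n + k)%N - S n) <= (2 * 2^-1 ^+ n - 2 * 2^-1 ^+ (n + k)) *: a.
  elim: k => [|k ih]; first by rewrite addn0 !subrr scale0r vabs0.
  have -> : S (n + k.+1)%N - S n = (S (n + k)%N - S n) + c (n + k)%N.
    by rewrite addnS /S big_ord_recr/= addrAC.
  apply: (le_trans (vabsD _ _)); apply: (le_trans (vleD ih (ca _))).
  rewrite -scalerDl; apply: vscaler_le => //; rewrite addnS exprS; lra.
have SB m n N : (N <= m)%N -> (N <= n)%N ->
    vabs (S m - S n) <= (2 * 2^-1 ^+ N) *: a.
  have wl (m' n' : nat) : (N <= n')%N -> (n' <= m')%N ->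
      vabs (S m' - S n') <= (2 * 2^-1 ^+ N) *: a.
    move=> Nn nm; rewrite -(subnKC nm); apply: (le_trans (SD _ _)).
    apply: vscaler_le => //; rewrite -[leRHS]subr0 lerB ?mulr_ge0//.
    by rewrite ler_pM2l// ler_wiXn2l// ?invr_ge0// invf_le1// ler1n.
  move=> Nm Nn; have [nm|/ltnW mn] := leqP n m; first exact: wl.
  by rewrite vabsB; exact: wl.
have [e e0|l ul] := qnorm_complete S.
  have q0 : 0 < 2 * (qnorm a + 1) by rewrite mulr_gt0// ltr_wpDl// qnorm_ge0.
  have [N hN] := pow2_lt (divr_gt0 e0 q0).
  exists N => m n Nm Nn.
  have h0 : 0 <= (2 * 2^-1 ^+ N) *: a by rewrite vscale_ge0// mulr_ge0.
  apply: (@le_lt_trans _ _ (qnorm ((2 * 2^-1 ^+ N) *: a))).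
    by apply: ler_qnorm; rewrite [leRHS]vabs_id// SB.
  rewrite qnormZ ger0_norm ?mulr_ge0//; move: hN; rewrite ltr_pdivlMr//.
  apply: le_lt_trans; rewrite -mulrA mulrCA ler_wpM2l// ler_wpM2l//.
  by rewrite lerDl.
exists l => n; rewrite -/(S n).
suff : vabs (l - S n) - (2 * 2^-1 ^+ n) *: a <= 0 by rewrite vlerBlDr add0r.
apply: (qnorm_limit_le (m := n) ul) => m nm.
rewrite vlerBlDr; have -> : l - S n = (l - S m) + (S m - S n) by rewrite addrA subrK.
by rewrite (le_trans (vabsD _ _))// vleD ?SB// vabsB.
Qed.

End QuasiBanach.

(** The positive part of [x] lies below [2^-1 ^+ n] times that of [e], which tends to 0 by
    continuity of the scalar multiplication. Hence it belongs to every solid neighbourhood of 0, and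
    is 0 by separation. *)
Lemma locally_solid_archimedean (R : realType) (X : locallySolidType R) :
  hausdorff_space X -> archimedean X.
Proof.
move=> hX x e xe; pose x' := vjoin x 0; pose e' := vjoin e 0.
have x0 : 0 <= x' by exact: vleUr.
have e0 : 0 <= e' by exact: vleUr.
have xe' n : n%:R *: x' <= e'.
  case: n => [|n]; first by rewrite scale0r.
  have n0 : 0 < n.+1%:R :> R by [].
  rewrite vscale_ler_pdivl// vleUx; apply/andP; split.
    by rewrite -vscale_ler_pdivl// (le_trans (xe _) (vleUl _ _)).
  by apply: vscale_ge0; rewrite ?invr_ge0.
suff -> : 0 = x' by exact: vleUl.
apply: hX => A B nA nB.
have [U [nU sU UA]] := locally_solid A nA.
exists x'; split; last exact: nbhs_singleton.
apply: UA; have nU' : nbhs ((0 : R^o) *: e') U by rewrite scale0r.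
have [[P Q] /= [nP nQ] PQ] := @scale_continuous _ X (0 : R^o, e') U nU'.
have /nbhs_ballP[d /= d0 hd] := nP.
have [n nd] := pow2_lt d0.
have h : U (2^-1 ^+ n *: e').
  apply: (PQ (2^-1 ^+ n, e')); split => /=; last exact: nbhs_singleton.
  by apply: hd; rewrite /ball/= sub0r normrN ger0_norm// exprn_ge0// invr_ge0.
apply: sU h; rewrite !vabs_id//; last by rewrite vscale_ge0// exprn_ge0// invr_ge0.
(* The hypothesis is used at the integer [2 ^ n]. *)
by rewrite exprVn -vscale_ler_pdivl ?exprn_gt0// -natrX.
Qed.

Section Embedding.
Context {R : realType} {E : quasiBanachLatticeType R} {X : locallySolidType R}.
Variables (j : {linear E -> X}) (hj : compatible_embedding j).

Lemma emb_join x y : j (vjoin x y) = vjoin (j x) (j y).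
Proof. by have [_ _ [h _] _] := hj; exact: h. Qed.

Lemma emb_le x y : (j x <= j y) = (x <= y).
Proof.
have [ij _ _ _] := hj; apply/idP/idP => /vjoin_idPr h; apply/vjoin_idPr.
  by apply: ij; rewrite emb_join.
by rewrite -emb_join h.
Qed.

Lemma emb_ge0 x : (0 <= j x) = (0 <= x).
Proof. by rewrite -(linear0 j) emb_le. Qed.

Lemma emb_abs x : j (vabs x) = vabs (j x).
Proof. by rewrite /vabs emb_join linearN. Qed.

(** Translation by [j a] moves [z] into the interval from 0 to [j (a + a)], to which interval
    preservation applies. *)
Lemma emb_abs_le (z : X) a : 0 <= a -> vabs z <= j a ->
  exists2 x, z = j x & vabs x <= a.
Proof.
move=> a0; rewrite vabs_le => /andP[z1 z2].
have [_ _ _ /(_ (a + a) (vaddr_ge0 a0 a0))] := hj.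
have : [set y | 0 <= y /\ y <= j (a + a)] (z + j a).
  split; first by have := vleD2r _ _ z z2; rewrite addNr addrC.
  by rewrite linearD; exact: vleD2r.
move=> + h; rewrite -{}h => -[y [y0 ya] yz].
exists (y - a); first by rewrite linearB /= yz addrK.
rewrite vabs_le opprB !vlerBlDr ya/=; exact: vlerDl.
Qed.

End Embedding.

Section SumSpace.
Context {R : realType} {X0 X1 : quasiBanachLatticeType R} {X : locallySolidType R}.
Variables (j0 : {linear X0 -> X}) (j1 : {linear X1 -> X}).
Hypothesis hj : compatible_pair j0 j1.
Notation S := (sum_space j0 j1).
Notation N := (sum_qnorm j0 j1).

Let h0 : compatible_embedding j0. Proof. by have [] := hj. Qed.
Let h1 : compatible_embedding j1. Proof. by have [] := hj. Qed.

Lemma sum_archimedean : archimedean X.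
Proof. by have [hX _ _] := hj; exact: locally_solid_archimedean. Qed.

Lemma sum_spaceI x0 x1 : S (j0 x0 + j1 x1).
Proof. by exists x0, x1. Qed.

Lemma sum_space0l x : S (j0 x).
Proof. by exists x, 0; rewrite linear0 addr0. Qed.

Lemma sum_space_lin (a : R) x y : S x -> S y -> S (a *: x + y).
Proof.
move=> [x0 [x1 ->]] [y0 [y1 ->]]; exists (a *: x0 + y0), (a *: x1 + y1).
by rewrite scalerDr addrACA !linearD /= !linearZ.
Qed.

Lemma sum_space0 : S 0.
Proof. by rewrite -(linear0 j0); exact: sum_space0l. Qed.

Lemma sum_spaceD x y : S x -> S y -> S (x + y).
Proof. by move=> Sx Sy; rewrite -[x]scale1r; exact: sum_space_lin. Qed.

Lemma sum_spaceZ (a : R) x : S x -> S (a *: x).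
Proof. by move=> Sx; rewrite -[_ *: _]addr0; exact: sum_space_lin sum_space0. Qed.

Lemma sum_spaceB x y : S x -> S y -> S (x - y).
Proof. by move=> Sx Sy; rewrite addrC -scaleN1r; exact: sum_space_lin. Qed.

Lemma sum_space_sum (I : Type) (r : seq I) (F : I -> X) :
  (forall i, S (F i)) -> S (\sum_(i <- r) F i).
Proof.
by move=> SF; elim/big_ind : _ => //; [exact: sum_space0|exact: sum_spaceD].
Qed.

(** The truncation of [z] at [j0 a] and its remainder, below [j1 b], are pulled back separately.
    Solidity of X0 + X1 and monotonicity of its quasi-norm both rest on this control of the two
    components. *)
Lemma sum_space_decomp z a b : 0 <= a -> 0 <= b -> vabs z <= j0 a + j1 b ->
  exists x0 x1, [/\ z = j0 x0 + j1 x1, vabs x0 <= a & vabs x1 <= b].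
Proof.
move=> a0 b0 zab; have ja : 0 <= j0 a by rewrite (emb_ge0 h0).
have jb : 0 <= j1 b by rewrite (emb_ge0 h1).
have [x0 E0 x0a] := emb_abs_le h0 a0 (vabs_clamp z ja).
have [x1 E1 x1b] := emb_abs_le h1 b0 (vabs_subclamp ja jb zab).
by exists x0, x1; split => //; rewrite -E0 -E1 addrC subrK.
Qed.

Lemma vabs_sum_space x0 x1 : vabs (j0 x0 + j1 x1) <= j0 (vabs x0) + j1 (vabs x1).
Proof. by rewrite (emb_abs h0) (emb_abs h1) vabsD. Qed.

Lemma sum_space_solid x y : vabs x <= vabs y -> S y -> S x.
Proof.
move=> xy [y0 [y1 yE]].
have [|x0 [x1 [-> _ _]]] := sum_space_decomp (vabs_ge0 y0) (vabs_ge0 y1) (z := x).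
  by rewrite (le_trans xy)// yE vabs_sum_space.
exact: sum_spaceI.
Qed.

Lemma sum_space_abs x : S x -> S (vabs x).
Proof. by apply: sum_space_solid; rewrite vabs_abs. Qed.

Lemma sum_space_le x y : 0 <= x -> x <= y -> S y -> S x.
Proof.
move=> x0 xy; apply: sum_space_solid; rewrite (vabs_id x0).
exact: le_trans (vabs_ge _).
Qed.

Let lb x : has_lbound [set r | exists x0 x1, x = j0 x0 + j1 x1 /\ r = qnorm x0 + qnorm x1].
Proof. by exists 0 => _ [x0 [x1 [_ ->]]]; rewrite addr_ge0 ?qnorm_ge0. Qed.

Lemma sum_qnorm_ge0 x : S x -> 0 <= N x.
Proof.
move=> [x0 [x1 xE]]; apply: lb_le_inf; first by exists (qnorm x0 + qnorm x1), x0, x1.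
by move=> _ [y0 [y1 [_ ->]]]; rewrite addr_ge0 ?qnorm_ge0.
Qed.

Lemma sum_qnorm_le x0 x1 : N (j0 x0 + j1 x1) <= qnorm x0 + qnorm x1.
Proof. by apply: ge_inf => //; exists x0, x1. Qed.

Lemma sum_qnorm_lt x r : S x -> N x < r ->
  exists x0 x1, x = j0 x0 + j1 x1 /\ qnorm x0 + qnorm x1 < r.
Proof.
move=> [x0 [x1 xE]] /inf_lt[|_ [y0 [y1 [yE ->]]] lt]; last by exists y0, y1.
by exists (qnorm x0 + qnorm x1), x0, x1.
Qed.

Lemma sum_qnorm_mono x y : S y -> vabs x <= vabs y -> N x <= N y.
Proof.
move=> Sy xy; apply/ler_addgt0Pl => d d0.
have [|y0 [y1 [yE lt]]] := @sum_qnorm_lt y (d + N y) Sy; first by rewrite ltrDr.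
have [|x0 [x1 [-> x0y x1y]]] := sum_space_decomp (vabs_ge0 y0) (vabs_ge0 y1) (z := x).
  by rewrite (le_trans xy)// yE vabs_sum_space.
apply: (le_trans (sum_qnorm_le _ _)); apply: (le_trans _ (ltW lt)).
by rewrite lerD// ler_qnorm.
Qed.

Lemma sum_qnorm0 : N 0 = 0.
Proof.
apply/eqP; rewrite eq_le sum_qnorm_ge0; last exact: sum_space0.
have := sum_qnorm_le 0 0; rewrite !linear0 addr0 !qnorm0 addr0 => ->.
by [].
Qed.

Lemma sum_qnorm_abs x : S x -> N (vabs x) = N x.
Proof.
move=> Sx; apply/eqP; rewrite eq_le !sum_qnorm_mono ?vabs_abs//.
exact: sum_space_abs.
Qed.

Lemma sum_qnormZ (a : R) x : S x -> N (a *: x) <= `|a| * N x.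
Proof.
move=> Sx; have [->|a0] := eqVneq a 0.
  by rewrite scale0r sum_qnorm0 normr0 mul0r.
apply/ler_addgt0Pl => d d0; have na : 0 < `|a| by rewrite normr_gt0.
have [|x0 [x1 [-> lt]]] := @sum_qnorm_lt x (d / `|a| + N x) Sx.
  by rewrite ltrDr divr_gt0.
have -> : a *: (j0 x0 + j1 x1) = j0 (a *: x0) + j1 (a *: x1).
  by rewrite scalerDr !linearZ.
apply: (le_trans (sum_qnorm_le _ _)); rewrite !qnormZ -mulrDr.
set r := N _ in lt *; have -> : d + `|a| * r = `|a| * (d / `|a| + r).
  by field; rewrite gt_eqF.
by rewrite ler_pM2l// ltW.
Qed.

Lemma sum_qnormD : exists2 C : R, 1 <= C &
  forall x y, S x -> S y -> N (x + y) <= C * (N x + N y).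
Proof.
have [C0 C01 hC0] := @ler_qnormD _ X0; have [C1 C11 hC1] := @ler_qnormD _ X1.
exists (C0 + C1); first by lra.
have C0' : 0 < C0 + C1 by lra.
move=> x y Sx Sy; rewrite mulrC -ler_pdivrMr//; apply/ler_addgt0Pl => d d0.
have d20 : 0 < d / 2 by rewrite divr_gt0.
have [|x0 [x1 [xE xlt]]] := @sum_qnorm_lt x (d / 2 + N x) Sx; first by rewrite ltrDr.
have [|y0 [y1 [yE ylt]]] := @sum_qnorm_lt y (d / 2 + N y) Sy; first by rewrite ltrDr.
rewrite ler_pdivrMr//.
have -> : x + y = j0 (x0 + y0) + j1 (x1 + y1) by rewrite xE yE !linearD /= addrACA.
apply: (le_trans (sum_qnorm_le _ _)).
have := hC0 x0 y0; have := hC1 x1 y1.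
have := qnorm_ge0 x0; have := qnorm_ge0 x1; have := qnorm_ge0 y0; have := qnorm_ge0 y1.
move: (N x) (N y) (qnorm x0) (qnorm x1) (qnorm y0) (qnorm y1) xlt ylt => Nx Ny a b c e xlt ylt c0 a1 b0 a0 h1' h2'.
apply: (le_trans (lerD h2' h1')).
have : (C0 + C1) * ((a + b) + (c + e)) <= (C0 + C1) * ((d / 2 + Nx) + (d / 2 + Ny)).
  by rewrite ler_pM2l// lerD// ltW.
nra.
Qed.

Lemma sum_principal_ideal e : S e -> 0 <= e ->
  principal_ideal S e = order_ideal e.
Proof.
move=> Se e0; apply/seteqP; split=> [x []//|x [c xc]]; split; last by exists c.
apply: (sum_space_solid (y := c *: e)); last exact: sum_spaceZ.
exact: le_trans xc (vabs_ge _).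
Qed.

(** Each increment splits into an increment dominated by a multiple of [a] and one dominated by a
    multiple of [b]. The two series are summed in X0 and in X1, so completeness of X0 + X1 itself is
    not involved. *)
Lemma sum_uniformly_complete a b : 0 <= a -> 0 <= b ->
  uniformly_complete (vjoin (j0 a) (j1 b)).
Proof.
move=> a0 b0 u; set e := vjoin _ _ => hu.
have p0 n : 0 <= 2^-1 ^+ n :> R by rewrite exprn_ge0// invr_ge0.
have ee : j0 a + j1 b <= 2 *: e.
  by rewrite scaler_nat mulr2n vleD// ?vleUl ?vleUr.
have ja : 0 <= j0 a by rewrite (emb_ge0 h0).
have jb : 0 <= j1 b by rewrite (emb_ge0 h1).
have e1 : e <= j0 a + j1 b by rewrite vleUx vlerDl// vlerDr.
have /choice[c hc] : forall n, exists c : X0 * X1,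
    [/\ u n.+1 - u n = j0 c.1 + j1 c.2, vabs c.1 <= 2^-1 ^+ n *: a &
        vabs c.2 <= 2^-1 ^+ n *: b].
  move=> n; have [||| x0 [x1 [E x0a x1b]]] := @sum_space_decomp (u n.+1 - u n)
      (2^-1 ^+ n *: a) (2^-1 ^+ n *: b); try exact: vscale_ge0.
    rewrite !linearZ /= -scalerDr; apply: (le_trans (hu n)).
    exact: vscale_le.
  by exists (x0, x1).
have hc0 n : vabs (c n).1 <= 2^-1 ^+ n *: a by have [] := hc n.
have hc1 n : vabs (c n).2 <= 2^-1 ^+ n *: b by have [] := hc n.
have [l0 hl0] := qnorm_series (c := fun n => (c n).1) a0 hc0.
have [l1 hl1] := qnorm_series (c := fun n => (c n).2) b0 hc1.
(* One factor 2 comes from the tails of the geometric series, the other from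
   [j0 a + j1 b <= 2 *: e]. *)
exists (u 0%N + (j0 l0 + j1 l1)), 4; first by [].
move=> n.
have uE : u n = u 0%N + (j0 (\sum_(i < n) (c i).1) + j1 (\sum_(i < n) (c i).2)).
  elim: n => [|n ih]; first by rewrite !big_ord0 !linear0 !addr0.
  have [E _ _] := hc n; rewrite !big_ord_recr/= !linearD /= addrACA -E addrA -ih.
  by rewrite addrC subrK.
have -> : u 0%N + (j0 l0 + j1 l1) - u n =
    j0 (l0 - \sum_(i < n) (c i).1) + j1 (l1 - \sum_(i < n) (c i).2).
  by rewrite uE opprD addrACA subrr add0r opprD addrACA !linearB.
apply: (le_trans (vabs_sum_space _ _)).
have -> : 4 * 2^-1 ^+ n = (2 * 2^-1 ^+ n) * 2 :> R by ring.
have m2 : 0 <= 2 * 2^-1 ^+ n :> R by rewrite mulr_ge0.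
rewrite -scalerA; apply: le_trans (vscale_le m2 ee).
rewrite scalerDr -!linearZ /=; apply: vleD.
  by rewrite (emb_le h0) hl0.
by rewrite (emb_le h1) hl1.
Qed.

End SumSpace.
(** * Quasi-concave functions *)

Section ClassP.
Context {R : realType}.
Variables (phi : R -> R -> R) (hphi : class_P phi).
Implicit Types (s t a b c d : R).

Let phiZ l s t : 0 < l -> 0 < s -> 0 < t -> phi (l * s) (l * t) = l * phi s t.
Proof. by have [_ h _ _ _] := hphi; exact: h. Qed.

Let phi11 : phi 1 1 = 1. Proof. by have [] := hphi. Qed.

Lemma phi_mono s s' t t' : 0 < s -> 0 < t -> s <= s' -> t <= t' ->
  phi s t <= phi s' t'.
Proof.
have [_ _ h1 h2 _] := hphi; move=> s0 t0 ss' tt'.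
exact: le_trans (h1 _ _ _ s0 t0 ss') (h2 _ _ _ (lt_le_trans s0 ss') t0 tt').
Qed.

Lemma phi_gt0 s t : 0 < s -> 0 < t -> 0 < phi s t.
Proof.
move=> s0 t0; have m0 : 0 < Num.min s t by rewrite lt_min s0.
apply: (lt_le_trans m0); rewrite -[leLHS]mulr1 -phi11 -phiZ// !mulr1.
by apply: phi_mono => //; rewrite ge_min lexx ?orbT.
Qed.

(** The continuous extension of [phi] to the closed quadrant, see
    [quadrant_extE]. *)
Definition phi_ext s t : R :=
  inf [set r | exists2 d : R, 0 < d & r = phi (s + d) (t + d)].

Let lb s t : 0 <= s -> 0 <= t ->
  lbound [set r | exists2 d : R, 0 < d & r = phi (s + d) (t + d)] 0.
Proof. by move=> s0 t0 _ [d d0 ->]; rewrite ltW// phi_gt0// ltr_wpDl. Qed.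

Let ne s t : [set r | exists2 d : R, 0 < d & r = phi (s + d) (t + d)] !=set0.
Proof. by exists (phi (s + 1) (t + 1)), 1. Qed.

Lemma phi_ext_ge0 s t : 0 <= s -> 0 <= t -> 0 <= phi_ext s t.
Proof. by move=> s0 t0; apply: lb_le_inf => //; exact: lb. Qed.

Lemma phi_ext_le s t d : 0 <= s -> 0 <= t -> 0 < d ->
  phi_ext s t <= phi (s + d) (t + d).
Proof.
by move=> s0 t0 d0; apply: ge_inf; [exists 0; exact: lb|exists d].
Qed.

Lemma phi_ext_lt s t r : phi_ext s t < r ->
  exists2 d, 0 < d & phi (s + d) (t + d) < r.
Proof. by move=> /(inf_lt (ne s t))[_ [d d0 ->] dr]; exists d. Qed.

Lemma phi_ext_ge s t r : (forall d, 0 < d -> r <= phi (s + d) (t + d)) ->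
  r <= phi_ext s t.
Proof. by move=> h; apply: lb_le_inf => // _ [d d0 ->]; exact: h. Qed.

(** A shift by [k] times the smaller of [s'] and [t'] is absorbed by the dilation with factor
    [1 + k], which costs [k * phi s' t' = d]. *)
Lemma phi_ext_le_phi s s' t t' : 0 <= s -> 0 <= t -> 0 < s' -> 0 < t' ->
  s <= s' -> t <= t' -> phi_ext s t <= phi s' t'.
Proof.
move=> s0 t0 s'0 t'0 ss' tt'; apply/ler_addgt0Pl => d d0.
have p0 := phi_gt0 s'0 t'0.
set m := Num.min s' t'; have m0 : 0 < m by rewrite lt_min s'0.
have ms : m <= s' by rewrite ge_min lexx.
have mt : m <= t' by rewrite ge_min lexx orbT.
pose k := d / phi s' t'; have k0 : 0 < k by rewrite divr_gt0.
have k1 : 0 < 1 + k by rewrite addr_gt0.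
have -> : d + phi s' t' = (1 + k) * phi s' t' by rewrite /k; field; rewrite gt_eqF.
rewrite -phiZ//; have km : 0 < k * m by rewrite mulr_gt0.
apply: (le_trans (phi_ext_le s0 t0 km)).
apply: phi_mono; rewrite ?ltr_wpDl//.
  by rewrite mulrDl mul1r lerD// ler_pM2l.
by rewrite mulrDl mul1r lerD// ler_pM2l.
Qed.

Lemma phi_ext_mono s s' t t' : 0 <= s -> 0 <= t -> s <= s' -> t <= t' ->
  phi_ext s t <= phi_ext s' t'.
Proof.
move=> s0 t0 ss' tt'; apply: phi_ext_ge => d d0.
have s'0 := le_trans s0 ss'; have t'0 := le_trans t0 tt'.
apply: phi_ext_le_phi; rewrite ?ltr_wpDl//.
  by rewrite (le_trans ss')// lerDl ltW.
by rewrite (le_trans tt')// lerDl ltW.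
Qed.

Lemma phi_extE s t : 0 < s -> 0 < t -> phi_ext s t = phi s t.
Proof.
move=> s0 t0; apply/eqP; rewrite eq_le; apply/andP; split.
  by apply: phi_ext_le_phi => //; exact: ltW.
by apply: phi_ext_ge => d d0; apply: phi_mono => //; rewrite lerDl ltW.
Qed.

Lemma phi_ext00 : phi_ext 0 0 = 0.
Proof.
apply/eqP; rewrite eq_le phi_ext_ge0// andbT; apply/ler_addgt0Pl => d d0.
have := phi_ext_le (lexx 0) (lexx 0) d0; rewrite !add0r addr0.
by rewrite -[d in phi d d]mulr1 phiZ// phi11 mulr1.
Qed.

Lemma phi_extZ c s t : 0 <= c -> 0 <= s -> 0 <= t ->
  phi_ext (c * s) (c * t) = c * phi_ext s t.
Proof.
have le k s' t' : 0 < k -> 0 <= s' -> 0 <= t' ->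
    phi_ext (k * s') (k * t') <= k * phi_ext s' t'.
  move=> k0 s0 t0; rewrite [leRHS]mulrC -ler_pdivrMr//; apply: phi_ext_ge => d d0.
  rewrite ler_pdivrMr// [leRHS]mulrC -phiZ ?ltr_wpDl//.
  rewrite !mulrDr; apply: phi_ext_le; rewrite ?mulr_gt0// mulr_ge0// ltW//.
rewrite le_eqVlt => /predU1P[<-|c0] s0 t0; first by rewrite !mul0r phi_ext00.
apply/eqP; rewrite eq_le le//= [leLHS]mulrC -ler_pdivlMr// [leRHS]mulrC.
have := @le c^-1 (c * s) (c * t); rewrite !mulrA mulVf ?gt_eqF// !mul1r; apply.
- by rewrite invr_gt0.
- by rewrite mulr_ge0// ltW.
- by rewrite mulr_ge0// ltW.
Qed.

(** The upper estimate is built into the infimum. The lower one comes from homogeneity: [s'] and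
    [t'] stay above [(1 - k) * s] and [(1 - k) * t], and [k * x <= e]. *)
Lemma phi_ext_continuous s t e : 0 <= s -> 0 <= t -> 0 < e ->
  exists2 d, 0 < d & forall s' t', 0 <= s' -> 0 <= t' ->
    `|s' - s| < d -> `|t' - t| < d -> `|phi_ext s' t' - phi_ext s t| <= e.
Proof.
move=> s0 t0 e0; have x0 := phi_ext_ge0 s0 t0; set x := phi_ext s t in x0 *.
have [|d d0 dx] := @phi_ext_lt s t (e + x); first by rewrite ltrDr.
have x1 : 0 < x + e by rewrite ltr_wpDl.
pose k := e / (x + e).
have k0 : 0 < k by rewrite divr_gt0.
have k1 : k <= 1 by rewrite /k ler_pdivrMr// mul1r lerDr.
have kx : k * x <= e.
  by rewrite /k mulrAC ler_pdivrMr// ler_pM2l// lerDl ltW.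
(* At a zero coordinate the lower comparison is trivial, and any positive radius will do. *)
pose ds := if s == 0 then d else k * s; pose dt := if t == 0 then d else k * t.
have ds0 : 0 < ds by rewrite /ds; case: eqP => // /eqP sn; rewrite mulr_gt0// lt_def sn.
have dt0 : 0 < dt by rewrite /dt; case: eqP => // /eqP tn; rewrite mulr_gt0// lt_def tn.
exists (Num.min d (Num.min ds dt)); first by rewrite !lt_min d0 ds0.
move=> s' t' s'0 t'0; rewrite !lt_min => /and3P[sd sds _] /and3P[td _ tdt].
rewrite ler_distl; apply/andP; split.
  apply: (@le_trans _ _ ((1 - k) * x)); first by rewrite mulrBl mul1r lerB.
  rewrite /x -phi_extZ ?subr_ge0//.
  apply: phi_ext_mono; rewrite ?mulr_ge0 ?subr_ge0// mulrBl mul1r.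
    move: sds; rewrite /ds ltr_distl; case: eqP => [->|_ /andP[/ltW//]].
    by rewrite mulr0 subr0.
  move: tdt; rewrite /dt ltr_distl; case: eqP => [->|_ /andP[/ltW//]].
  by rewrite mulr0 subr0.
rewrite addrC; apply: (le_trans _ (ltW dx)).
rewrite -phi_extE ?ltr_wpDl//; apply: phi_ext_mono => //.
  by move: sd; rewrite ltr_distl => /andP[_ /ltW].
by move: td; rewrite ltr_distl => /andP[_ /ltW].
Qed.

Lemma phi_ext_comp_continuous (T : topologicalType) (a b : T -> R) :
  continuous a -> continuous b -> (forall w, 0 <= a w) -> (forall w, 0 <= b w) ->
  continuous (fun w => phi_ext (a w) (b w)).
Proof.
move=> ca cb a0 b0 w; apply/cvgrPdist_le => e e0.
have [d d0 hd] := phi_ext_continuous (a0 w) (b0 w) e0.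
have near_lt (c : T -> R) : continuous c -> \forall v \near w, `|c v - c w| < d.
  move=> cc; have /cvgrPdist_lt/(_ d d0) := cc w.
  by apply: filterS => v; rewrite distrC.
by apply: filterS2 (near_lt a ca) (near_lt b cb) => v h1 h2; rewrite distrC hd.
Qed.

Lemma quadrant_extE s t : 0 <= s -> 0 <= t -> quadrant_ext phi s t = phi_ext s t.
Proof.
move=> s0 t0; rewrite /quadrant_ext.
have near_st d : 0 < d -> \forall p \near (s, t), `|p.1 - s| < d /\ `|p.2 - t| < d.
  move=> d0; exists ([set u : R | `|u - s| < d], [set u : R | `|u - t| < d]) => /=.
    by split; apply/nbhs_ballP; exists d => // u; rewrite /ball/= distrC.
  by move=> [u v].
have PF : ProperFilter (within open_quadrant (nbhs ((s, t) : R * R))).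
  apply: within_nbhs_proper => /= B [[P Q] /= [nP nQ] PQ].
  have /nbhs_ballP[d1 /= d10 h1] := nP; have /nbhs_ballP[d2 /= d20 h2] := nQ.
  have p1 : 0 < d1 / 2 by rewrite divr_gt0.
  have p2 : 0 < d2 / 2 by rewrite divr_gt0.
  exists (s + d1 / 2, t + d2 / 2); split; first by split; rewrite /= ltr_wpDl.
  apply: PQ; split => /=; [apply: h1|apply: h2]; rewrite /ball/= opprD addrA subrr sub0r normrN.
    by rewrite gtr0_norm//; lra.
  by rewrite gtr0_norm//; lra.
apply: cvg_lim; first exact: Rhausdorff.
apply/cvgrPdist_le => e e0; have [d d0 hd] := phi_ext_continuous s0 t0 e0.
rewrite near_withinE; apply: filterS (near_st d d0) => -[u v] /= [h1 h2] [/= u0 v0].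
by rewrite distrC -phi_extE//; apply: hd => //; exact: ltW.
Qed.

(** A discrete set of points at which [f] doubles while [f t / t] halves, so that
    the concave functions [t |-> min (f s) (t * f s / s)] add up to at most
    [4 * f], together with the end points of the intermediate intervals, so
    that one of these functions is comparable to [f]. *)
Let f t := phi 1 t.
Let g t := f t / t.

Let f_gt0 t : 0 < t -> 0 < f t. Proof. exact: phi_gt0. Qed.

Let f_le s t : 0 < s -> s <= t -> f s <= f t.
Proof. by move=> s0 st; exact: phi_mono. Qed.

Let fE t : 0 < t -> f t = t * g t.
Proof. by move=> t0; rewrite /g mulrCA divff ?mulr1// gt_eqF. Qed.

Let g_gt0 t : 0 < t -> 0 < g t. Proof. by move=> t0; rewrite divr_gt0// f_gt0. Qed.

Let gE t : 0 < t -> g t = phi t^-1 1.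
Proof.
move=> t0; have tV : 0 < t^-1 by rewrite invr_gt0.
by rewrite /g /f mulrC -phiZ// mulr1 mulVf ?gt_eqF.
Qed.

Let g_ge s t : 0 < s -> s <= t -> g t <= g s.
Proof.
move=> s0 st; have t0 := lt_le_trans s0 st; rewrite !gE//.
by apply: phi_mono; rewrite ?invr_gt0// lef_pV2.
Qed.

Let term_le s t : 0 < s -> 0 < t -> Num.min (f s) (t * g s) <= f t.
Proof.
move=> s0 t0; have [st|/ltW ts] := leP s t; first by rewrite ge_min f_le.
by rewrite ge_min [f t]fE// ler_pM2l// (g_ge t0 ts) orbT.
Qed.

Let sum_term_le (S : seq R) t :
  \sum_(s <- S) Num.min (f s) (t * g s) <= t * \sum_(s <- S) g s.
Proof. by rewrite mulr_sumr; apply: ler_sum => s _; rewrite ge_min lexx orbT. Qed.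

(** Induction on the length of the interval, jumping from [m] to the first dyadic multiple where [f]
    has doubled and [g] has halved. The bound on the sum of the [g s] controls all later nodes when
    [t] lies before them, and the term [- f m] pays for the node added in front. *)
Lemma quasiconcave_nodes n m : 0 < m -> exists S : seq R,
  [/\ m \in S, forall s, s \in S -> m <= s,
      forall t, m <= t -> t <= 2 ^+ n * m ->
        exists2 s, s \in S & f t <= 4 * f s /\ g t <= 4 * g s,
      \sum_(s <- S) g s <= 2 * g m &
      forall t, m <= t -> \sum_(s <- S) Num.min (f s) (t * g s) <= 4 * f t - f m].
Proof.
elim/ltn_ind: n m => n ih m m0; have fm := f_gt0 m0; have gm := g_gt0 m0.
have e2 k : 1 <= 2 ^+ k :> R by rewrite exprn_ege1// ler1n.
have mk k : m <= 2 ^+ k * m by rewrite ler_peMl// ltW.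
have mk0 k : 0 < 2 ^+ k * m by exact: lt_le_trans (mk k).
pose P k := (2 * f m <= f (2 ^+ k * m)) && (2 * g (2 ^+ k * m) <= g m).
(* If no jump is possible up to [M], either [f] or [g] varies by a factor less than 2 on the whole
   interval, and [m] or [M] respectively is comparable to every point. *)
have [Pn|nPn] := boolP (P n); last first.
  set M := 2 ^+ n * m in nPn *; have mM : m <= M := mk n; have M0 : 0 < M := mk0 n.
  have fM := f_gt0 M0; have gM := g_gt0 M0.
  exists [:: m; M]; split.
  - by rewrite inE eqxx.
  - by move=> s; rewrite !inE => /orP[] /eqP->.
  - move=> t mt tM; have t0 := lt_le_trans m0 mt.
    have h1 := f_le t0 tM; have h2 := g_ge m0 mt.
    move: nPn; rewrite negb_and -!ltNge => /orP[h|h].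
      by exists m; [rewrite inE eqxx|split; lra].
    by exists M; [rewrite !inE eqxx orbT|split; lra].
  - by rewrite !big_cons big_nil; have := g_ge m0 mM; lra.
  - move=> t mt; have t0 := lt_le_trans m0 mt; rewrite !big_cons big_nil.
    by have := term_le m0 t0; have := term_le M0 t0; have := f_le m0 mt; lra.
have Pex : exists k, P k by exists n.
case: (ex_minnP Pex) => j Pj jmin; have jn := jmin n Pn.
have j0 : (0 < j)%N.
  by rewrite lt0n; apply: contraL Pj => /eqP->; rewrite /P expr0 mul1r; lra.
set m' := 2 ^+ j * m in Pj *; have m'0 : 0 < m' := mk0 j; have mm' : m <= m' := mk j.
have [|S [mS Sm cov sg sf]] := ih (n - j)%N _ m' m'0; first by rewrite ltn_subrL j0 (leq_trans j0).
move: Pj => /andP[Pf Pg]; have fm' := f_gt0 m'0; have gm' := g_gt0 m'0.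
exists (m :: S); split.
- by rewrite inE eqxx.
- by move=> s; rewrite inE => /predU1P[->//|/Sm]; exact: le_trans.
- move=> t mt tM; have t0 := lt_le_trans m0 mt.
  have [m't|/ltW tm'] := leP m' t.
    have [|s sS hs] := cov t m't.
      by rewrite mulrA -exprD subnK.
    by exists s => //; rewrite inE sS orbT.
  (* By minimality of [j], one of [f] and [g] varies by less than 2 between [m] and [h]. The last
     step, from [h] to [m'], costs at most another factor 2, whence the 4. *)
  set h := 2 ^+ j.-1 * m; have h0 : 0 < h := mk0 _.
  have m'h : m' = 2 * h by rewrite /m' /h mulrA -exprS prednK.
  have hm' : h <= m' by rewrite m'h; lra.
  have : ~~ P j.-1.
    by apply/negP => /jmin; rewrite leqNgt prednK ?leqnn.
  have f1 := f_le h0 hm'; have g1 := g_ge h0 hm'.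
  have fh : f m' <= 2 * f h by rewrite (fE m'0) (fE h0) m'h -mulrA ler_pM2l// ler_pM2l// -m'h.
  have gh : g h <= 2 * g m'.
    rewrite -(ler_pM2l h0) -fE//; apply: (le_trans f1).
    by rewrite (fE m'0) {1}m'h -mulrA mulrCA.
  have h1 := f_le t0 tm'; have h2 := g_ge m0 mt.
  rewrite negb_and -!ltNge -/h => /orP[hh|hh].
    by exists m; [rewrite inE eqxx|split; lra].
  by exists m'; [rewrite inE mS orbT|split; lra].
- by rewrite big_cons; lra.
- move=> t mt; have t0 := lt_le_trans m0 mt; rewrite big_cons.
  have h1 : Num.min (f m) (t * g m) <= f m by rewrite ge_min lexx.
  have [m't|/ltW tm'] := leP m' t; first by have := sf t m't; lra.
  have h2 := f_le m0 mt; have := sum_term_le S t.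
  have : t * \sum_(s <- S) g s <= t * (2 * g m') by rewrite ler_pM2l.
  have : t * g m' <= f t by rewrite (fE t0) ler_pM2l// g_ge.
  lra.
Qed.

(** The function [(a, b) |-> min (a / p) (b / q)], where [1 / 0] is infinite. *)
Definition piece (pq : R * R) a b : R :=
  if pq.2 == 0 then a / pq.1 else if pq.1 == 0 then b / pq.2
  else Num.min (a / pq.1) (b / pq.2).

Definition is_piece (pq : R * R) : bool :=
  [&& 0 <= pq.1, 0 <= pq.2 & (pq.1 != 0) || (pq.2 != 0)].

Lemma piece_ge0 pq a b : is_piece pq -> 0 <= a -> 0 <= b -> 0 <= piece pq a b.
Proof.
case: pq => p q /and3P[/= p0 q0 _] a0 b0; rewrite /piece/=.
by case: ifP => _; [rewrite divr_ge0|case: ifP => _; rewrite ?le_min !divr_ge0].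
Qed.

Lemma piece_lel pq a b : is_piece pq -> 0 <= a -> pq.1 * piece pq a b <= a.
Proof.
case: pq => p q /and3P[/= p0 q0 pq] a0; rewrite /piece/=.
have [->|pn] := eqVneq p 0; first by rewrite mul0r.
have pp : 0 < p by rewrite lt_def pn.
case: ifP => _; first by rewrite mulrCA divff// mulr1.
by rewrite mulrC -ler_pdivlMr// ge_min lexx.
Qed.

Lemma piece_ler pq a b : is_piece pq -> 0 <= b -> pq.2 * piece pq a b <= b.
Proof.
case: pq => p q /and3P[/= p0 q0 pq] b0; rewrite /piece/=.
have [->|qn] := eqVneq q 0; first by rewrite mul0r.
have qp : 0 < q by rewrite lt_def qn.
case: ifP => _; first by rewrite mulrCA divff// mulr1.
by rewrite mulrC -ler_pdivlMr// ge_min lexx orbT.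
Qed.

(** With [piece_lel] and [piece_ler], this identifies the piece as the largest [z] satisfying both
    constraints; [is_piece] rules out the case without any constraint. *)
Lemma le_piece pq a b z : is_piece pq -> pq.1 * z <= a -> pq.2 * z <= b ->
  z <= piece pq a b.
Proof.
case: pq => p q /and3P[/= p0 q0 pq] pz qz; rewrite /piece/=.
have [q00|qn] := eqVneq q 0.
  move: pq; rewrite q00 eqxx orbF => pn.
  by rewrite ler_pdivlMr 1?mulrC// lt_def pn.
have qp : 0 < q by rewrite lt_def qn.
have [p00|pn] := eqVneq p 0; first by rewrite ler_pdivlMr 1?mulrC.
have pp : 0 < p by rewrite lt_def pn.
by rewrite le_min !ler_pdivlMr// ![z * _]mulrC pz.
Qed.

Lemma piece_continuous (T : topologicalType) (a b : T -> R) pq :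
  continuous a -> continuous b -> continuous (fun w => piece pq (a w) (b w)).
Proof.
move=> ca cb; case: pq => p q; rewrite /piece/=.
case: (q == 0); first by move=> w; apply: cvgM; [exact: ca|exact: cvg_cst].
case: (p == 0); first by move=> w; apply: cvgM; [exact: cb|exact: cvg_cst].
move=> w; apply: (@continuous_min _ _ (fun w => a w / p) (fun w => b w / q)).
  by apply: cvgM; [exact: ca|exact: cvg_cst].
by apply: cvgM; [exact: cb|exact: cvg_cst].
Qed.

(** Weights with sum at most [1], concentrated on the pieces that are comparable
    to [phi_ext], the term [e ^+ 2] avoiding a division by [0]. *)
Definition weight (S : seq (R * R)) e a b (pq : R * R) : R :=
  piece pq a b ^+ 2 / (\sum_(r <- S) piece r a b ^+ 2 + e ^+ 2).

Let weight_den (S : seq (R * R)) e a b : 0 < e ->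
  0 < \sum_(r <- S) piece r a b ^+ 2 + e ^+ 2.
Proof. by move=> e0; rewrite ltr_wpDl ?exprn_gt0// sumr_ge0// => r _; exact: sqr_ge0. Qed.

Lemma weight_ge0 S e a b pq : 0 < e -> 0 <= weight S e a b pq.
Proof. by move=> e0; rewrite divr_ge0 ?sqr_ge0// ltW// weight_den. Qed.

Lemma weight_continuous (T : topologicalType) S e (a b : T -> R) pq : 0 < e ->
  continuous a -> continuous b -> continuous (fun w => weight S e (a w) (b w) pq).
Proof.
move=> e0 ca cb w.
have cp r : piece r (a v) (b v) ^+ 2 @[v --> w] --> piece r (a w) (b w) ^+ 2.
  have h : piece r (a v) (b v) @[v --> w] --> piece r (a w) (b w).
    exact: piece_continuous.
  exact: (cvgM h h).
apply: cvgM; first exact: cp.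
apply: cvgV; first by rewrite gt_eqF// weight_den.
apply: cvgD; last exact: cvg_cst.
elim: S => [|r S ih].
  by under eq_fun do rewrite big_nil; rewrite big_nil; exact: cvg_cst.
under eq_fun do rewrite big_cons; rewrite big_cons; apply: cvgD => //; exact: cp.
Qed.

Section Weight.
Variables (S : seq (R * R)) (e a b : R).
Hypotheses (e0 : 0 < e) (a0 : 0 <= a) (b0 : 0 <= b) (ab1 : Num.max a b = 1).
Hypothesis Sp : all is_piece S.
Hypothesis sumS : \sum_(s <- S) piece s a b <= 6 * phi_ext a b.
Hypothesis covS : (exists2 s, s \in S & phi_ext a b <= 4 * piece s a b) \/
        phi_ext a b <= e * Num.max a b.

Let D := \sum_(r <- S) piece r a b ^+ 2 + e ^+ 2.
Let D0 : 0 < D. Proof. exact: weight_den. Qed.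

Let phi0 : 0 <= phi_ext a b. Proof. exact: phi_ext_ge0. Qed.

Let phi_sqr : phi_ext a b ^+ 2 <= 16 * (D - e ^+ 2) \/ phi_ext a b <= e.
Proof.
case: covS => [[s sS h]|]; last by rewrite ab1 mulr1; right.
left; rewrite /D addrK; apply: (@le_trans _ _ (16 * piece s a b ^+ 2)).
  rewrite (_ : 16 * _ = (4 * piece s a b) ^+ 2); last by ring.
  by rewrite ler_sqr ?nnegrE// (le_trans phi0).
rewrite ler_pM2l// (perm_big _ (perm_to_rem sS)) big_cons /= lerDl sumr_ge0// => r _.
exact: sqr_ge0.
Qed.

Let phi_sqr_den : phi_ext a b ^+ 2 <= 16 * D.
Proof.
have e20 : 0 <= e ^+ 2 by exact: sqr_ge0.
have D0' : 0 <= D - e ^+ 2.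
  by rewrite /D addrK sumr_ge0// => r _; exact: sqr_ge0.
case: phi_sqr => [h|h]; first lra.
have : phi_ext a b ^+ 2 <= e ^+ 2 by rewrite ler_sqr ?nnegrE// ltW.
lra.
Qed.

(** Since [p s * piece s a b ^+ 2 <= c * piece s a b], the sum is at most [6 * c * phi_ext a b / D].
    Then [phi_ext a b ^+ 2 <= 16 * D] gives [96 = 6 * 16]. *)
Let weight_sum (p : R * R -> R) c : 0 <= c ->
  (forall s : R * R, s \in S -> 0 <= p s /\ p s * piece s a b <= c) ->
  phi_ext a b * \sum_(s <- S) p s * weight S e a b s <= 96 * c.
Proof.
move=> c0 hp.
have h1 : \sum_(s <- S) p s * weight S e a b s <= c * (6 * phi_ext a b) / D.
  apply: (@le_trans _ _ (c * (\sum_(s <- S) piece s a b) / D)); last first.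
    by rewrite ler_pdivrMr// mulfVK ?gt_eqF// ler_wpM2l.
  rewrite mulr_sumr mulr_suml big_seq [leRHS]big_seq; apply: ler_sum => s sS.
  have [ps hs] := hp s sS; rewrite /weight -/D mulrA ler_pM2r ?invr_gt0//.
  rewrite expr2 mulrA ler_wpM2r// piece_ge0//.
  exact: (allP Sp).
apply: (le_trans (ler_wpM2l phi0 h1)).
rewrite (mulrA (phi_ext a b)) ler_pdivrMr//.
have : c * phi_ext a b ^+ 2 <= c * (16 * D) by rewrite ler_wpM2l.
lra.
Qed.

Lemma weight_sum1 : phi_ext a b * \sum_(s <- S) s.1 * weight S e a b s <= 96 * a.
Proof.
apply: weight_sum => // s sS; have hs := allP Sp _ sS; split.
  by have /and3P[] := hs.
exact: piece_lel.
Qed.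

Lemma weight_sum2 : phi_ext a b * \sum_(s <- S) s.2 * weight S e a b s <= 96 * b.
Proof.
apply: weight_sum => // s sS; have hs := allP Sp _ sS; split.
  by have /and3P[] := hs.
exact: piece_ler.
Qed.

Lemma weight_defect :
  phi_ext a b * `|1 - \sum_(s <- S) weight S e a b s| <= 2 * e.
Proof.
have -> : 1 - \sum_(s <- S) weight S e a b s = e ^+ 2 / D.
  by rewrite /weight -mulr_suml -/D -[1](@divff _ D) ?gt_eqF// -mulrBl addrC /D addKr.
rewrite ger0_norm ?divr_ge0 ?sqr_ge0 ?(ltW D0)// mulrA ler_pdivrMr// expr2 mulrA.
rewrite [leRHS]mulrAC ler_pM2r//.
case: phi_sqr => h; last first.
  have : phi_ext a b * e <= e * e by rewrite ler_pM2r.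
  have : e ^+ 2 <= D by rewrite /D lerDr sumr_ge0// => r _; exact: sqr_ge0.
  rewrite expr2; have := mulr_gt0 e0 e0; lra.
(* The inequality between the arithmetic and geometric means bounds [phi_ext a b * e / 2] by
   [phi_ext a b ^+ 2 / 16 + e ^+ 2], hence by [D]. *)
have : 0 <= (phi_ext a b / 4 - e) ^+ 2 by exact: sqr_ge0.
rewrite sqrrB; move: h; have -> : (phi_ext a b / 4) ^+ 2 = phi_ext a b ^+ 2 / 16 by field.
by rewrite -mulr_natr; lra.
Qed.

End Weight.

(** Nodes cover the ratios [b / a] between [m] and [M]; the pieces [al * a] and [be * b] cover the
    remaining ratios when [al] or [be] is positive. The constant 6 is 4 for the nodes plus 1 for
    each degenerate piece. *)
Lemma quasiconcave_pieces e : 0 < e -> exists S : seq (R * R),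
  [/\ all is_piece S,
      forall a b, 0 <= a -> 0 <= b -> \sum_(s <- S) piece s a b <= 6 * phi_ext a b &
      forall a b, 0 <= a -> 0 <= b ->
        (exists2 s, s \in S & phi_ext a b <= 4 * piece s a b) \/
        phi_ext a b <= e * Num.max a b].
Proof.
move=> e0.
pose al := phi_ext 1 0; pose be := phi_ext 0 1.
have al0 : 0 <= al by exact: phi_ext_ge0.
have be0 : 0 <= be by exact: phi_ext_ge0.
(* The margin is the limit itself when that is positive, so that [f m] is at most twice [al];
   otherwise it is [e], the admissible error. The same holds for [g M] and [be]. *)
have pick (x : R) : 0 <= x ->
    exists2 r, 0 < r & (0 < x -> r = x) /\ (x = 0 -> r = e).
  rewrite le_eqVlt => /predU1P[<-|x0]; first by exists e => //; split; rewrite ?ltxx.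
  by exists x => //; split => // x00; rewrite x00 ltxx in x0.
have [r1 r10 [r1al r1e]] := pick _ al0; have [r2 r20 [r2be r2e]] := pick _ be0.
have [|m m0 hm] := @phi_ext_lt 1 0 (al + r1); first by rewrite ltrDl.
have [|d d0 hd] := @phi_ext_lt 0 1 (be + r2); first by rewrite ltrDl.
have {}hm : f m < al + r1.
  by apply: le_lt_trans hm; rewrite add0r; apply: phi_mono => //; rewrite lerDl ltW.
(* This makes [M^-1] smaller than [d], so that [g M = phi M^-1 1] falls below [be + r2]. *)
have [n hn] := pow2_lt (mulr_gt0 d0 m0).
have p2 : 0 < 2 ^+ n :> R by rewrite exprn_gt0.
set M := 2 ^+ n * m; have M0 : 0 < M by rewrite mulr_gt0.
have {}hd : g M < be + r2.
  apply: le_lt_trans hd; rewrite add0r gE//; apply: phi_mono; rewrite ?invr_gt0//.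
    rewrite -[leLHS]mul1r ler_pdivrMr// /M mulrCA -ler_pdivrMl// mulr1 -exprVn.
    by rewrite ltW.
  by rewrite lerDl ltW.
have [S [mS Sm cov sg sf]] := quasiconcave_nodes n m0.
have S0 s : s \in S -> 0 < s by move=> /Sm; exact: lt_le_trans.
have pE s a b : 0 < s -> piece ((f s)^-1, (g s)^-1) a b = Num.min (f s * a) (g s * b).
  move=> s0; rewrite /piece/= !invr_eq0 !gt_eqF ?f_gt0 ?g_gt0// !invrK.
  by rewrite mulrC [g s * b]mulrC.
have extE a b : 0 < a -> 0 < b -> phi_ext a b = a * f (b / a).
  by move=> a0 b0; rewrite phi_extE// /f -phiZ// ?divr_gt0// mulr1 mulrCA divff ?mulr1// gt_eqF.
exists ((if 0 < al then [:: (al^-1, 0)] else [::]) ++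
  (if 0 < be then [:: (0, be^-1)] else [::]) ++
  [seq ((f s)^-1, (g s)^-1) | s <- S]); split.
- rewrite !all_cat; apply/and3P; split.
  + by case: ifP => //= al1; rewrite /is_piece/= lexx invr_ge0 al0 invr_eq0 gt_eqF.
  + by case: ifP => //= be1; rewrite /is_piece/= lexx invr_ge0 be0 eqxx invr_eq0 gt_eqF.
  + apply/allP => _ /mapP[s sS ->]; rewrite /is_piece/= !invr_ge0 invr_eq0.
    by rewrite !ltW ?f_gt0 ?g_gt0 ?S0// gt_eqF// f_gt0// S0.
- move=> a b a0 b0; rewrite !big_cat/= big_map.
  have x0 := phi_ext_ge0 a0 b0; set x := phi_ext a b in x0 *.
  have h1 : \sum_(s <- if 0 < al then [:: (al^-1, 0)] else [::]) piece s a b <= x.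
    case: ifP => al1; last by rewrite big_nil.
    rewrite big_seq1 /piece/= eqxx invrK /al -phi_extZ// mulr0 mulr1.
    exact: phi_ext_mono.
  have h2 : \sum_(s <- if 0 < be then [:: (0, be^-1)] else [::]) piece s a b <= x.
    case: ifP => be1; last by rewrite big_nil.
    rewrite big_seq1 /piece/= eqxx invr_eq0 gt_eqF// invrK /be -phi_extZ// mulr0 mulr1.
    exact: phi_ext_mono.
  suff h3 : \sum_(s <- S) piece ((f s)^-1, (g s)^-1) a b <= 4 * x by lra.
  rewrite big_seq; under eq_bigr => s sS do rewrite (pE _ _ _ (S0 s sS)).
  rewrite -big_seq; move: a0; rewrite le_eqVlt => /predU1P[a0|a0].
    apply: (@le_trans _ _ 0); last by rewrite mulr_ge0.
    by apply: sumr_le0 => s _; rewrite ge_min -a0 mulr0 lexx.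
  move: b0; rewrite le_eqVlt => /predU1P[b0|b0].
    apply: (@le_trans _ _ 0); last by rewrite mulr_ge0.
    by apply: sumr_le0 => s _; rewrite ge_min -b0 mulr0 lexx orbT.
  rewrite /x extE//; set t := b / a; have t0 : 0 < t by rewrite divr_gt0.
  have -> : \sum_(s <- S) Num.min (f s * a) (g s * b) =
      a * \sum_(s <- S) Num.min (f s) (t * g s).
    rewrite mulr_sumr; apply: eq_bigr => s _; rewrite minr_pMr ?ltW// /t.
    by congr (Num.min _ _); [rewrite mulrC|field; rewrite gt_eqF].
  rewrite mulrCA ler_pM2l//; have [mt|/ltW tm] := leP m t.
    by have := sf t mt; have := f_gt0 m0; lra.
  have := sum_term_le S t; have : t * \sum_(s <- S) g s <= t * (2 * g m) by rewrite ler_pM2l.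
  have : t * g m <= f t by rewrite (fE t0) ler_pM2l// g_ge.
  by have := f_gt0 t0; lra.
- move=> a b a0 b0.
  move: a0; rewrite le_eqVlt => /predU1P[a0|a0]; last first.
    have [bm|/ltW mb] := leP b (m * a).
      have h : phi_ext a b <= a * (al + r1).
        apply: (le_trans (phi_ext_mono (ltW a0) b0 (lexx a) bm)).
        rewrite extE ?mulr_gt0// ler_pM2l// -mulrA divff ?gt_eqF// mulr1.
        exact: ltW.
      move: al0; rewrite le_eqVlt => /predU1P[al0|al0].
        right; apply: (le_trans h); rewrite -al0 add0r r1e// mulrC ler_pM2l//.
        by rewrite le_max lexx.
      left; exists (al^-1, 0); first by rewrite al0 inE eqxx.
      rewrite /piece/= eqxx invrK; apply: (le_trans h); rewrite r1al//.
      have := mulr_gt0 a0 al0; lra.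
    have b1 : 0 < b by apply: lt_le_trans mb; rewrite mulr_gt0.
    have [Mb|/ltW bM] := leP (M * a) b; last first.
      set t := b / a; have t0 : 0 < t by rewrite divr_gt0.
      have [||s sS [hf hg]] := cov t; rewrite ?ler_pdivlMr ?ler_pdivrMr//.
      left; exists ((f s)^-1, (g s)^-1).
        by rewrite !mem_cat map_f ?orbT.
      rewrite pE ?S0// extE// -/t minr_pMr// le_min; apply/andP; split.
        by rewrite mulrC mulrA ler_pM2r.
      have -> : a * f t = b * g t by rewrite fE// /t; field; rewrite gt_eqF.
      by rewrite [leRHS]mulrA [leRHS]mulrC ler_pM2l.
    have h : phi_ext a b <= b * (be + r2).
      rewrite extE//; have -> : a * f (b / a) = b * g (b / a).
        by rewrite fE ?divr_gt0//; field; rewrite gt_eqF.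
      rewrite ler_pM2l//; apply: (le_trans _ (ltW hd)); apply: g_ge => //.
      by rewrite ler_pdivlMr.
    move: be0; rewrite le_eqVlt => /predU1P[be0|be0].
      right; apply: (le_trans h); rewrite -be0 add0r r2e// mulrC ler_pM2l//.
      by rewrite le_max lexx orbT.
    left; exists (0, be^-1); first by rewrite !mem_cat be0 inE eqxx orbT.
    rewrite /piece/= eqxx invr_eq0 gt_eqF// invrK; apply: (le_trans h); rewrite r2be//.
    have := mulr_gt0 b1 be0; lra.
  have h : phi_ext a b = b * be.
    by rewrite /be -phi_extZ// mulr0 mulr1 a0.
  move: be0; rewrite le_eqVlt => /predU1P[be0|be0].
    by right; rewrite h -be0 mulr0; apply: mulr_ge0; [exact: ltW|rewrite le_max b0 orbT].
  left; exists (0, be^-1); first by rewrite !mem_cat be0 inE eqxx orbT.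
  rewrite /piece/= eqxx invr_eq0 gt_eqF// invrK h.
  have := mulr_ge0 b0 (ltW be0); lra.
Qed.

End ClassP.
(** * The functional calculus *)

Section FunctionalCalculus.
Context {R : realType} {V : vectorLatticeType R}.

Lemma lattice_iso_hom (Omega : topologicalType) (e : V) (h : V -> Omega -> R) :
  lattice_iso_C (order_ideal e) h -> forall w, lattice_hom e (h ^~ w).
Proof. by move=> [_ hl hU hI] w; split => *; [exact: hl|exact: hU|exact: hI]. Qed.

Lemma lattice_iso_le (Omega : topologicalType) (e : V) (h : V -> Omega -> R) :
  lattice_iso_C (order_ideal e) h -> forall x y, order_ideal e x -> order_ideal e y ->
  (forall w, h x w <= h y w) -> x <= y.
Proof.
move=> hiso x y Ix Iy xy; have [[_ hinj _] _ _ hI] := hiso.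
have Ixy := order_ideal_meet Ix Iy.
suff <- : vmeet x y = x by exact: vleIr.
apply: hinj; rewrite ?inE//; apply: funext => w.
by rewrite hI//; apply/min_idPl; exact: xy.
Qed.

Lemma lattice_iso_surj (Omega : topologicalType) (e : V) (h : V -> Omega -> R) :
  lattice_iso_C (order_ideal e) h -> forall f : Omega -> R, continuous f ->
  exists2 x, order_ideal e x & forall w, h x w = f w.
Proof. by move=> [[_ _ hsurj] _ _ _] f /hsurj[x Ix <-]; exists x. Qed.

Lemma lattice_iso_cont (Omega : topologicalType) (e : V) (h : V -> Omega -> R) :
  lattice_iso_C (order_ideal e) h -> forall x, order_ideal e x -> continuous (h x).
Proof. by move=> [[hc _ _] _ _ _] x /hc. Qed.

End FunctionalCalculus.

Section CompatibleCalculus.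
Context {R : realType} {X0 X1 : quasiBanachLatticeType R} {X : locallySolidType R}.
Variables (j0 : {linear X0 -> X}) (j1 : {linear X1 -> X}).
Hypothesis hj : compatible_pair j0 j1.
Variables (phi : R -> R -> R) (hphi : class_P phi).
Notation S := (sum_space j0 j1).
Notation calc a b z := (func_calculus S phi (j0 a) (j1 b) z).
Notation ext := (phi_ext phi).

Let arch : archimedean X. Proof. exact: sum_archimedean hj. Qed.
Let h0 : compatible_embedding j0. Proof. by have [] := hj. Qed.
Let h1 : compatible_embedding j1. Proof. by have [] := hj. Qed.

Section Pair.
Variables (a : X0) (b : X1).
Hypotheses (a0 : 0 <= a) (b0 : 0 <= b).
Notation e := (vjoin (j0 a) (j1 b)).

Let ja0 : 0 <= j0 a. Proof. by rewrite (emb_ge0 h0). Qed.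
Let jb0 : 0 <= j1 b. Proof. by rewrite (emb_ge0 h1). Qed.

Lemma calc_e_ge0 : 0 <= e. Proof. exact: le_trans ja0 (vleUl _ _). Qed.

Lemma calc_e_le : e <= j0 a + j1 b.
Proof. by rewrite vleUx vlerDl// vlerDr. Qed.

Lemma calc_e_sum : S e.
Proof. by apply: (sum_space_le hj calc_e_ge0 calc_e_le); exact: sum_spaceI. Qed.

Lemma calc_ideal : principal_ideal S e = order_ideal e.
Proof. exact (sum_principal_ideal hj calc_e_sum calc_e_ge0). Qed.

Lemma calc_ideall : order_ideal e (j0 a).
Proof. exact: order_ideal_le ja0 (vleUl _ _) (order_ideal_e calc_e_ge0). Qed.

Lemma calc_idealr : order_ideal e (j1 b).
Proof. exact: order_ideal_le jb0 (vleUr _ _) (order_ideal_e calc_e_ge0). Qed.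

Lemma calc_exists : exists z, calc a b z.
Proof.
have e0 := calc_e_ge0; have Ia := calc_ideall; have Ib := calc_idealr.
have iso := kakutani arch e0 (sum_uniformly_complete hj a0 b0) calc_ideal.
have iso' := iso; rewrite calc_ideal in iso'.
set h := (fun x (w : set_type (characters e)) => set_val w x) in iso iso'.
have hpos x w : order_ideal e x -> 0 <= x -> 0 <= h x w.
  by move=> Ix x0; exact: (hom_ge0 (lattice_iso_hom iso' w)).
have [|z Iz hz] := lattice_iso_surj iso' (f := fun w => ext (h (j0 a) w) (h (j1 b) w)).
  apply: (phi_ext_comp_continuous hphi) => [||w|w].
  - exact: lattice_iso_cont iso' _ Ia.
  - exact: lattice_iso_cont iso' _ Ib.
  - exact: hpos.
  - exact: hpos.
exists z, (set_type (characters e)), h; split => //.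
- exact: characters_compact_hausdorff.
- by move=> w; exact: character1.
- by rewrite calc_ideal.
- by move=> w; rewrite hz (quadrant_extE hphi)//; exact: hpos.
Qed.

Variables (z : X) (hz : calc a b z).

Lemma calc_repr : exists (Omega : topologicalType) (h : X -> Omega -> R),
  [/\ lattice_iso_C (order_ideal e) h, forall w, h e w = 1, order_ideal e z &
      forall w, h z w = ext (h (j0 a) w) (h (j1 b) w)].
Proof.
have [Om [h [_ iso he Iz hzE]]] := hz; exists Om, h.
rewrite calc_ideal in iso Iz; split => // w; rewrite hzE (quadrant_extE hphi)//.
  exact: (hom_ge0 (lattice_iso_hom iso w)) calc_ideall ja0.
exact: (hom_ge0 (lattice_iso_hom iso w)) calc_idealr jb0.
Qed.

Lemma calc_in_ideal : order_ideal e z.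
Proof. by have [? [? []]] := calc_repr. Qed.

Lemma calc_ge0 : 0 <= z.
Proof.
have [Om [h [iso he Iz hzE]]] := calc_repr.
apply: (lattice_iso_le iso) => //; first exact: order_ideal0.
move=> w; have hw := lattice_iso_hom iso w; rewrite (hom0 hw) hzE.
by apply: phi_ext_ge0 => //; apply: (hom_ge0 hw); [exact: calc_ideall| |exact: calc_idealr|].
Qed.

Lemma calc_sum : S z.
Proof. by have [? [? [_ _ _ []]]] := hz. Qed.

(** [chi] is a multiple of a point evaluation on the ideal of [e], but it is
    enough that finitely many elements of its kernel are simultaneously small
    at some point of [Omega]: otherwise their join would dominate a multiple
    of [e]. *)
Lemma hom_calc e' chi : 0 <= e' -> order_ideal e' e -> lattice_hom e' chi ->
  chi z = ext (chi (j0 a)) (chi (j1 b)).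
Proof.
move=> e'0 Ie hchi; have e0 := calc_e_ge0.
have sub x : order_ideal e x -> order_ideal e' x.
  move=> [c xc]; apply: order_ideal_solid (order_idealZ c Ie).
  exact: le_trans xc (vabs_ge _).
have [Om [h [iso he Iz hzE]]] := calc_repr.
have Ia := calc_ideall; have Ib := calc_idealr; have Iee := order_ideal_e e0.
have ge0 x : order_ideal e x -> 0 <= x -> 0 <= chi x.
  by move=> Ix; apply: (hom_ge0 hchi); exact: sub.
(* On the larger ideal of [e'], [chi] may vanish at [e]; it then vanishes on the whole ideal of
   [e]. *)
have := ge0 _ Iee e0; rewrite le_eqVlt => /predU1P[chie|chie].
  have van x : order_ideal e x -> chi x = 0.
    move=> Ix; have [c c0 xc] := order_ideal_bound e0 Ix.
    apply/eqP; rewrite -normr_le0 -(hom_abs hchi); last exact: sub.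
    rewrite -[leRHS](mulr0 c) chie -(homZ hchi); last exact: sub.
    by apply: (hom_le hchi) => //; [exact/sub/order_ideal_abs|exact/sub/order_idealZ].
  by rewrite !van// phi_ext00.
pose c := chi e; pose s := chi (j0 a) / c; pose t := chi (j1 b) / c; pose r := chi z / c.
have s0 : 0 <= s by rewrite divr_ge0 ?ge0// ltW.
have t0 : 0 <= t by rewrite divr_ge0 ?ge0// ltW.
suff rE : r = ext s t.
  rewrite -[chi z](divfK (_ : c != 0)) ?gt_eqF// -/r rE mulrC -(phi_extZ hphi)//.
    by rewrite /s /t ![c * _]mulrC !divfK ?gt_eqF.
  exact: ltW.
have approx d : 0 < d -> exists w, [/\ `|h (j0 a) w - s| < d, `|h (j1 b) w - t| < d &
    `|h z w - r| < d].
  move=> d0; apply: contrapT => nw.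
  pose g x y := vabs (x - (y *: e)).
  have Ig x y : order_ideal e x -> order_ideal e (g x y).
    by move=> Ix; apply/order_ideal_abs/order_idealB => //; exact: order_idealZ.
  have Ig1 := Ig _ s Ia; have Ig2 := Ig _ t Ib; have Ig3 := Ig _ r Iz.
  have Ig12 := order_ideal_join Ig1 Ig2; have IG := order_ideal_join Ig12 Ig3.
  have Ide := order_idealZ d Iee.
  have chig x : order_ideal e x -> chi (g x (chi x / c)) = 0.
    move=> Ix; have Ixe := order_idealZ (chi x / c) Iee.
    rewrite (hom_abs hchi); last by apply/sub/order_idealB.
    rewrite (homB hchi) ?(homZ hchi) ?divfK ?gt_eqF// ?subrr ?normr0//; exact: sub.
  have : d *: e <= vjoin (vjoin (g (j0 a) s) (g (j1 b) t)) (g z r).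
    apply: (lattice_iso_le iso) => // w; have hw := lattice_iso_hom iso w.
    have hg x y : order_ideal e x -> h (g x y) w = `|h x w - y|.
      move=> Ix; have Iye := order_idealZ y Iee.
      rewrite (hom_abs hw); last exact: order_idealB.
      by rewrite (homB hw)// (homZ hw)// he mulr1.
    rewrite (homZ hw)// he mulr1 (hom_join hw)// (hom_join hw)// !hg//.
    rewrite leNgt; apply/negP; rewrite !gt_max => /andP[/andP[w1 w2] w3].
    by apply: nw; exists w.
  move=> /(hom_le hchi (sub _ Ide) (sub _ IG)).
  have k1 : chi (g (j0 a) s) = 0 := chig _ Ia.
  have k2 : chi (g (j1 b) t) = 0 := chig _ Ib.
  have k3 : chi (g z r) = 0 := chig _ Iz.
  rewrite (hom_join hchi (sub _ Ig12) (sub _ Ig3)).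
  rewrite (hom_join hchi (sub _ Ig1) (sub _ Ig2)) k1 k2 k3 !maxxx.
  by rewrite (homZ hchi _ (sub _ Iee)) leNgt mulr_gt0.
apply/eqP; rewrite -subr_eq0 -normr_le0; apply/ler_addgt0Pl => d d0.
have d20 : 0 < d / 2 by rewrite divr_gt0.
have [d' d'0 hd'] := phi_ext_continuous hphi s0 t0 d20.
have [|w [w1 w2 w3]] := approx (Num.min (d / 2) d'); first by rewrite lt_min d20.
have hw := lattice_iso_hom iso w.
move: w1 w2 w3; rewrite !lt_min => /andP[_ w1] /andP[_ w2] /andP[w3 _].
have := hd' _ _ (hom_ge0 hw Ia ja0) (hom_ge0 hw Ib jb0) w1 w2.
rewrite -hzE addr0 => h3; rewrite -(subrKA (h z w)) (le_trans (ler_normD _ _))//.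
by rewrite [`|r - _|]distrC; lra.
Qed.

End Pair.

(** The two calculi may live on different ideals and different spaces [Omega]. The homomorphisms of
    the ideal of [e + e'] evaluate both. In particular [z] depends only on [a] and [b]. *)
Lemma calc_mono a b a' b' z z' (c : R) : 0 <= c ->
  0 <= a -> 0 <= b -> 0 <= a' -> 0 <= b' -> calc a b z -> calc a' b' z' ->
  a <= c *: a' -> b <= c *: b' -> z <= c *: z'.
Proof.
move=> c0 a0 b0 a'0 b'0 hz hz' aa' bb'.
have e0 := calc_e_ge0 b a0; have e'0 := calc_e_ge0 b' a'0.
set e := vjoin (j0 a) (j1 b) in e0; set e' := vjoin (j0 a') (j1 b') in e'0.
have E0 : 0 <= e + e' by exact: vaddr_ge0.
have IE := order_ideal_e E0.
have sub x : order_ideal e x -> order_ideal (e + e') x.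
  by move=> /(order_ideal_bound e0)[k k0 xk]; exists k; apply: (le_trans xk);
     apply: vscale_le => //; exact: vlerDl.
have sub' x : order_ideal e' x -> order_ideal (e + e') x.
  by move=> /(order_ideal_bound e'0)[k k0 xk]; exists k; apply: (le_trans xk);
     apply: vscale_le => //; exact: vlerDr.
have Ia := sub _ (calc_ideall b a0); have Ib := sub _ (calc_idealr a0 b0).
have Ia' := sub' _ (calc_ideall b' a'0); have Ib' := sub' _ (calc_idealr a'0 b'0).
have Iz := sub _ (calc_in_ideal a0 b0 hz); have Iz' := sub' _ (calc_in_ideal a'0 b'0 hz').
apply: (hom_order arch E0) => //; first exact: order_idealZ.
move=> chi hchi _; rewrite (homZ hchi)//.
rewrite (hom_calc a0 b0 hz E0 (sub _ (order_ideal_e e0)) hchi).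
rewrite (hom_calc a'0 b'0 hz' E0 (sub' _ (order_ideal_e e'0)) hchi).
have pos x : order_ideal (e + e') x -> 0 <= x -> 0 <= chi x by exact: (hom_ge0 hchi).
have le1 : chi (j0 a) <= c * chi (j0 a').
  rewrite -(homZ hchi)//; apply: (hom_le hchi) => //; first exact: order_idealZ.
  by rewrite -linearZ (emb_le h0).
have le2 : chi (j1 b) <= c * chi (j1 b').
  rewrite -(homZ hchi)//; apply: (hom_le hchi) => //; first exact: order_idealZ.
  by rewrite -linearZ (emb_le h1).
have ja' : 0 <= j0 a' by rewrite (emb_ge0 h0).
have jb' : 0 <= j1 b' by rewrite (emb_ge0 h1).
have ja : 0 <= j0 a by rewrite (emb_ge0 h0).
have jb : 0 <= j1 b by rewrite (emb_ge0 h1).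
rewrite -(phi_extZ hphi) ?pos//; apply: phi_ext_mono; rewrite ?pos//.
Qed.

(** The pieces recombine: a sum of terms dominated by the pieces of
    [(y0, y1)] is dominated by [phi(y0, y1)]. *)
Lemma calc_sum_pieces y0 y1 z (Q : seq (R * R)) (t : R * R -> X) :
  0 <= y0 -> 0 <= y1 -> calc y0 y1 z -> all is_piece Q ->
  (forall a b, 0 <= a -> 0 <= b -> \sum_(s <- Q) piece s a b <= 6 * ext a b) ->
  (forall s, s \in Q -> s.1 *: vabs (t s) <= j0 y0 /\ s.2 *: vabs (t s) <= j1 y1) ->
  vabs (\sum_(s <- Q) t s) <= 6 *: z.
Proof.
move=> y00 y10 hz Qp Qs ht.
have e0 := calc_e_ge0 y1 y00; set e := vjoin (j0 y0) (j1 y1) in e0.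
have Ia := calc_ideall y1 y00; have Ib := calc_idealr y00 y10.
have Iz := calc_in_ideal y00 y10 hz.
have It s : s \in Q -> order_ideal e (t s).
  move=> sQ; have [t1 t2] := ht s sQ; have /and3P[p0 q0 pq] := allP Qp s sQ.
  have key (p : R) y : 0 <= p -> p != 0 -> order_ideal e y -> p *: vabs (t s) <= y ->
      order_ideal e (t s).
    move=> p0' pn Iy; rewrite vscale_ler_pdivl; last by rewrite lt_def pn.
    move=> ty; apply: order_ideal_solid (order_idealZ p^-1 Iy).
    exact: le_trans ty (vabs_ge _).
  by case/orP: pq => pn; [exact: key t1|exact: key t2].
(* Outside [Q] nothing places [t s] in the ideal, whereas [hom_sum] asks this of every index. *)
pose t' s := if s \in Q then t s else 0.
have tE : \sum_(s <- Q) t s = \sum_(s <- Q) t' s.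
  by apply: eq_big_seq => s sQ; rewrite /t' sQ.
have It' s : order_ideal e (t' s).
  by rewrite /t'; case: ifP => [/It//|_]; exact: order_ideal0.
rewrite tE; have Isum := order_ideal_sum Q It'.
apply: (hom_order arch e0); [exact: order_ideal_abs|exact: order_idealZ|].
move=> chi hchi _; rewrite (hom_abs hchi)// (hom_sum hchi)// (homZ hchi)//.
rewrite (hom_calc y00 y10 hz e0 (order_ideal_e e0) hchi).
have ja : 0 <= j0 y0 by rewrite (emb_ge0 h0).
have jb : 0 <= j1 y1 by rewrite (emb_ge0 h1).
have ca : 0 <= chi (j0 y0) by exact: (hom_ge0 hchi).
have cb : 0 <= chi (j1 y1) by exact: (hom_ge0 hchi).
apply: (le_trans (ler_norm_sum _ _ _)); apply: le_trans (Qs _ _ ca cb).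
rewrite big_seq [leRHS]big_seq; apply: ler_sum => s sQ.
have [t1 t2] := ht s sQ; rewrite -(hom_abs hchi)// /t' sQ.
have Its := order_ideal_abs (It s sQ).
apply: le_piece; first exact: (allP Qp).
  by rewrite -(homZ hchi)//; apply: (hom_le hchi) => //; exact: order_idealZ.
by rewrite -(homZ hchi)//; apply: (hom_le hchi) => //; exact: order_idealZ.
Qed.

(** [u i s] is the product of [x i] with the weight of the piece [s], formed in [C(Omega)]. With the
    factor 2 in the hypothesis on the [x i], the bounds 96 and [2 * eps] for the weights become 192
    and [4 * eps]. *)
Lemma calc_decomposition a b z (I : finType) (x : I -> X) (Q : seq (R * R)) (eps : R) :
  0 <= a -> 0 <= b -> calc a b z -> 0 < eps -> all is_piece Q ->
  (forall a b, 0 <= a -> 0 <= b -> \sum_(s <- Q) piece s a b <= 6 * ext a b) ->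
  (forall a b, 0 <= a -> 0 <= b ->
     (exists2 s, s \in Q & ext a b <= 4 * piece s a b) \/
     ext a b <= eps * Num.max a b) ->
  \sum_i vabs (x i) <= 2 *: z ->
  exists u : I -> R * R -> X,
    [/\ \sum_i \sum_(s <- Q) vabs (s.1 *: u i s) <= 192 *: j0 a,
        \sum_i \sum_(s <- Q) vabs (s.2 *: u i s) <= 192 *: j1 b,
        forall i s, S (u i s) &
        forall i, vabs (x i - \sum_(s <- Q) u i s) <= (4 * eps) *: (j0 a + j1 b)].
Proof.
move=> a0 b0 hz eps0 Qp Qs Qc xz.
have [Om [h [iso he Iz hzE]]] := calc_repr a0 b0 hz.
have e0 := calc_e_ge0 b a0; set e := vjoin (j0 a) (j1 b) in iso he Iz e0.
have Ia := calc_ideall b a0; have Ib := calc_idealr a0 b0.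
have ja : 0 <= j0 a by rewrite (emb_ge0 h0).
have jb : 0 <= j1 b by rewrite (emb_ge0 h1).
have I2z : order_ideal e (2 *: z) := order_idealZ 2 Iz.
have Ixs : order_ideal e (\sum_i vabs (x i)).
  by apply: order_ideal_le _ xz I2z; apply: vsum_ge0 => i; exact: vabs_ge0.
have Ix i : order_ideal e (x i).
  apply: order_ideal_solid Ixs; rewrite [leRHS]vabs_id.
    by apply: (vsum_sup (fun i => vabs_ge0 (x i))); exact: mem_index_enum.
  by apply: vsum_ge0 => k; exact: vabs_ge0.
have hhom w := lattice_iso_hom iso w.
have ha w : 0 <= h (j0 a) w by exact: (hom_ge0 (hhom w)).
have hb w : 0 <= h (j1 b) w by exact: (hom_ge0 (hhom w)).
have hab w : Num.max (h (j0 a) w) (h (j1 b) w) = 1 by rewrite -(hom_join (hhom w)).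
pose W s w := weight Q eps (h (j0 a) w) (h (j1 b) w) s.
have W0 s w : 0 <= W s w by exact: weight_ge0.
have cW s : continuous (W s).
  by apply: weight_continuous => //; exact: lattice_iso_cont iso _ _.
have /choice[u hu] : forall p : I * (R * R), exists v, order_ideal e v /\
    forall w, h v w = h (x p.1) w * W p.2 w.
  move=> [i s]; have [|v Iv hv] := lattice_iso_surj iso (f := fun w => h (x i) w * W s w).
    by move=> w; apply: cvgM; [exact: (lattice_iso_cont iso (Ix i))|exact: cW].
  by exists v.
have Iu p : order_ideal e (u p) by have [] := hu p.
have uE i s w : h (u (i, s)) w = h (x i) w * W s w by have [_ ->] := hu (i, s).
have xsum w : \sum_i `|h (x i) w| <= 2 * ext (h (j0 a) w) (h (j1 b) w).
  rewrite -hzE -(homZ (hhom w))//.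
  have -> : \sum_i `|h (x i) w| = h (\sum_i vabs (x i)) w.
    rewrite (hom_sum (hhom w)); last by move=> i; exact: order_ideal_abs.
    by apply: eq_bigr => i _; rewrite (hom_abs (hhom w)).
  exact: (hom_le (hhom w)).
have key (p : R * R -> R) (j : X) : (forall s, s \in Q -> 0 <= p s) -> order_ideal e j ->
    (forall w, ext (h (j0 a) w) (h (j1 b) w) * \sum_(s <- Q) p s * W s w <= 96 * h j w) ->
    \sum_i \sum_(s <- Q) vabs (p s *: u (i, s)) <= 192 *: j.
  move=> p0 Ij hp.
  have Ipu i s : order_ideal e (vabs (p s *: u (i, s))).
    by apply/order_ideal_abs/order_idealZ.
  apply: (lattice_iso_le iso).
  - by apply: order_ideal_sum => i; apply: order_ideal_sum.
  - exact: order_idealZ.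
  move=> w; rewrite (hom_sum (hhom w)); last by move=> i; exact: order_ideal_sum.
  rewrite (homZ (hhom w))//.
  have -> : \sum_i h (\sum_(s <- Q) vabs (p s *: u (i, s))) w =
      (\sum_i `|h (x i) w|) * \sum_(s <- Q) p s * W s w.
    rewrite mulr_suml; apply: eq_bigr => i _; rewrite (hom_sum (hhom w))//.
    rewrite mulr_sumr; apply: eq_big_seq => s sQ.
    rewrite (hom_abs (hhom w)) ?(homZ (hhom w))//; last exact: order_idealZ.
    by rewrite uE (normrM (p s)) (normrM (h (x i) w)) (ger0_norm (W0 s w)) (ger0_norm (p0 s sQ)) mulrCA.
  have pW0 : 0 <= \sum_(s <- Q) p s * W s w.
    rewrite big_seq; apply: sumr_ge0 => s sQ; apply: mulr_ge0 => //; exact: p0.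
  apply: (le_trans (ler_wpM2r pW0 (xsum w))); rewrite -mulrA.
  have := hp w; lra.
have Qs' w := Qs _ _ (ha w) (hb w).
have Qc' w := Qc _ _ (ha w) (hb w).
exists (fun i s => u (i, s)); split.
- apply: key => // [s sQ|w]; first by have /and3P[] := allP Qp s sQ.
  exact: weight_sum1.
- apply: key => // [s sQ|w]; first by have /and3P[] := allP Qp s sQ.
  exact: weight_sum2.
- move=> i s; have := Iu (i, s); rewrite -calc_ideal => //.
  by move=> [].
- move=> i; have Ius : order_ideal e (\sum_(s <- Q) u (i, s)) by exact: order_ideal_sum.
  have Id := order_idealB (Ix i) Ius.
  apply: (@le_trans _ _ ((4 * eps) *: e)); last first.
    by apply: vscale_le; [rewrite mulr_ge0// ltW|exact: calc_e_le].
  apply: (lattice_iso_le iso).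
  + exact: order_ideal_abs.
  + by apply: order_idealZ; exact: order_ideal_e.
  move=> w; rewrite (hom_abs (hhom w))// (homB (hhom w))//.
  rewrite (homZ (hhom w)) ?he ?mulr1; last exact: order_ideal_e.
  rewrite (hom_sum (hhom w))//.
  have -> : \sum_(s <- Q) h (u (i, s)) w = h (x i) w * \sum_(s <- Q) W s w.
    by rewrite mulr_sumr; apply: eq_bigr => s _; rewrite uE.
  rewrite -[X in X - _]mulr1 -mulrBr normrM.
  have xi : `|h (x i) w| <= 2 * ext (h (j0 a) w) (h (j1 b) w).
    apply: le_trans (xsum w).
    by rewrite (bigD1 i)//= lerDl sumr_ge0.
  apply: (le_trans (ler_wpM2r (normr_ge0 _) xi)); rewrite -mulrA.
  have := weight_defect hphi eps0 (ha w) (hb w) (hab w) (Qc' w).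
  by rewrite /W; lra.
Qed.

End CompatibleCalculus.
(** * Gagliardo completions and regular operators *)

Section BigJoin.
Context {R : realType} {V : vectorLatticeType R}.

Lemma bigjoin_ge0 (I : Type) (r : seq I) (F : I -> V) :
  0 <= \big[vjoin/0]_(i <- r) F i.
Proof.
by elim: r => [|i r ih]; rewrite ?big_nil// big_cons (le_trans ih)// vleUr.
Qed.

Lemma bigjoin_sup (I : eqType) (r : seq I) (F : I -> V) i : i \in r ->
  F i <= \big[vjoin/0]_(i <- r) F i.
Proof.
elim: r => // j r ih; rewrite inE big_cons => /predU1P[->|/ih h]; first exact: vleUl.
exact: le_trans h (vleUr _ _).
Qed.

Lemma bigjoin_le (I : Type) (r : seq I) (F : I -> V) y : 0 <= y ->
  (forall i, F i <= y) -> \big[vjoin/0]_(i <- r) F i <= y.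
Proof.
by move=> y0 Fy; elim/big_ind : _ => // a b ay yb; rewrite vleUx ay.
Qed.

Lemma bigjoinZ (I : Type) (r : seq I) (F : I -> V) (c : R) : 0 < c ->
  \big[vjoin/0]_(i <- r) (c *: F i) = c *: \big[vjoin/0]_(i <- r) F i.
Proof.
move=> c0; elim: r => [|i r ih]; first by rewrite !big_nil scaler0.
rewrite !big_cons ih; apply/eqP; rewrite eq_le; apply/andP; split.
  by rewrite vleUx; apply/andP; split; apply: vscale_le; rewrite ?vleUl ?vleUr ?ltW.
by rewrite -[leRHS]scale1r -(@divff _ c) ?gt_eqF// -scalerA; apply: vscale_le;
  rewrite ?(ltW c0)// vleUx -!vscale_ler_pdivl// vleUl vleUr.
Qed.

Lemma vabs_subjoin (I : Type) (r : seq I) (F G : I -> V) :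
  vabs (\big[vjoin/0]_(i <- r) F i - \big[vjoin/0]_(i <- r) G i) <=
  \sum_(i <- r) vabs (F i - G i).
Proof.
have le (f g : I -> V) : \big[vjoin/0]_(i <- r) f i <=
    \big[vjoin/0]_(i <- r) g i + \sum_(i <- r) vabs (f i - g i).
  elim: r => [|i r ih]; first by rewrite !big_nil addr0.
  rewrite !big_cons vleUx; apply/andP; split.
    apply: (@le_trans _ _ (g i + (f i - g i))); first by rewrite addrC subrK.
    apply: vleD; first exact: vleUl.
    apply: (le_trans (vabs_ge _)); apply: vlerDl.
    by apply: vsum_ge0 => j; exact: vabs_ge0.
  apply: (le_trans ih); apply: vleD; first exact: vleUr.
  exact/vlerDr/vabs_ge0.
rewrite vabs_le opprB !vlerBlDr addrC le/= addrC.
apply: (le_trans (le G F)); apply: vleD => //.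
by apply: vsum_le => i; rewrite vabsB.
Qed.

End BigJoin.

Lemma vabs_subabs (R : realType) (V : vectorLatticeType R) (x y : V) :
  vabs (vabs x - vabs y) <= vabs (x - y).
Proof.
have le a b : vabs a <= vabs (a - b) + vabs b :> V.
  by apply: le_trans (vabsD _ _); rewrite subrK.
by rewrite vabs_le opprB !vlerBlDr le/= vabsB le.
Qed.

Lemma inf1_bound_seq (R : realType) (E F : quasiBanachLatticeType R)
    (T : E -> F) (K : R) (I : Type) (r : seq I) (v : I -> E) :
  inf1_bound setT qnorm qnorm T K ->
  qnorm (\big[vjoin/0]_(i <- r) vabs (T (v i))) <=
  K * qnorm (\sum_(i <- r) vabs (v i)).
Proof. by move=> hT; rewrite !(big_tnth _ _ r); exact: hT. Qed.

Section Gagliardo.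
Context {R : realType} {X0 X1 : quasiBanachLatticeType R} {X : locallySolidType R}.
Variables (j0 : {linear X0 -> X}) (j1 : {linear X1 -> X}).
Hypothesis hj : compatible_pair j0 j1.
Variables (phi : R -> R -> R) (hphi : class_P phi).
Notation S := (sum_space j0 j1).
Notation N := (sum_qnorm j0 j1).
Notation calc a b z := (func_calculus S phi (j0 a) (j1 b) z).
Notation CL_ball := (CL_unit_ball j0 j1 phi).
Notation G_ball := (Gagliardo_unit_ball j0 j1 phi).
Notation G_space := (Gagliardo_space j0 j1 phi).

Let CL_lb y : has_lbound [set l : R | 0 < l /\ exists x0 x1 z,
    [/\ 0 <= x0 /\ qnorm x0 <= 1, 0 <= x1 /\ qnorm x1 <= 1,
        calc x0 x1 z & vabs y <= l *: z]].
Proof. by exists 0 => l [/ltW]. Qed.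

Lemma CL_ball_intro y a b z : 0 <= a -> qnorm a <= 1 -> 0 <= b -> qnorm b <= 1 ->
  calc a b z -> vabs y <= z -> CL_ball y.
Proof.
move=> a0 qa b0 qb hz yz; split.
  split; last by exists a, b, z.
  apply: (sum_space_solid hj) (calc_sum hz).
  exact: le_trans yz (vabs_ge _).
apply: ge_inf; first exact: CL_lb.
by split => //; exists a, b, z; split => //; rewrite scale1r.
Qed.

Lemma CL_space_bound y : CL_space j0 j1 phi y -> exists c a b z,
  [/\ 0 < c, 0 <= a /\ qnorm a <= 1, 0 <= b /\ qnorm b <= 1, calc a b z &
      vabs y <= c *: z].
Proof.
move=> [Sy [x0 [x1 [z [x00 x10 hz yz]]]]].
pose c := 1 + (qnorm x0 + qnorm x1).
have q0 := qnorm_ge0 x0; have q1 := qnorm_ge0 x1.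
have c0 : 0 < c by rewrite /c; lra.
have cV0 : 0 <= c^-1 by rewrite invr_ge0 ltW.
have a0 : 0 <= c^-1 *: x0 by exact: vscale_ge0.
have b0 : 0 <= c^-1 *: x1 by exact: vscale_ge0.
have [z' hz'] := calc_exists hj hphi a0 b0.
exists c, (c^-1 *: x0), (c^-1 *: x1), z'; split => //.
- split=> //; rewrite qnormZ ger0_norm// ler_pdivrMl// mulr1 /c; lra.
- split=> //; rewrite qnormZ ger0_norm// ler_pdivrMl// mulr1 /c; lra.
apply: (le_trans yz); apply: (calc_mono hj hphi (ltW c0) x00 x10 a0 b0 hz hz').
  by rewrite scalerA divff ?gt_eqF// scale1r.
by rewrite scalerA divff ?gt_eqF// scale1r.
Qed.

(** The infimum in [CL_qnorm] need not be attained; 2 is a convenient number above 1. *)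
Lemma CL_ball_bound y : CL_ball y -> exists a b z,
  [/\ 0 <= a /\ qnorm a <= 1, 0 <= b /\ qnorm b <= 1, calc a b z &
      vabs y <= 2 *: z].
Proof.
move=> [Cy qy]; have : CL_qnorm j0 j1 phi y < 2 by rewrite (le_lt_trans qy)// ltr1n.
move=> /inf_lt[|l [l0 [a [b [z [[a0 qa] [b0 qb] hz yz]]]]] l2].
  by have [c [a [b [z [c0 ha hb hz yz]]]]] := CL_space_bound Cy; exists c; split => //; exists a, b, z.
exists a, b, z; split => //; apply: (le_trans yz).
by apply: vscaler_le; [exact: (calc_ge0 hj hphi a0 b0 hz)|exact: ltW].
Qed.

Lemma CL_ball_solid x y : vabs x <= vabs y -> CL_ball y -> CL_ball x.
Proof.
move=> xy [Cy qy]; have [Sy [x0 [x1 [z [x00 x10 hz yz]]]]] := Cy; split.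
  split; first exact: (sum_space_solid hj) xy Sy.
  by exists x0, x1, z; split => //; exact: le_trans yz.
apply: le_trans qy; apply: lb_le_inf.
  by have [c [a [b [t [c0 ha hb ht yt]]]]] := CL_space_bound Cy; exists c; split => //; exists a, b, t.
move=> l [l0 [a [b [t [ha hb ht yt]]]]]; apply: ge_inf; first exact: CL_lb.
by split => //; exists a, b, t; split => //; exact: le_trans yt.
Qed.

(** Truncating [x] at the modulus of an approximant [t] of [y] stays in the unit ball by solidity,
    with an error dominated by [vabs (y - t)]. *)
Lemma G_ball_solid x y : vabs x <= vabs y -> G_ball y -> G_ball x.
Proof.
move=> xy [Sy hy]; split; first exact: (sum_space_solid hj) xy Sy.
move=> e e0; have [t Ct te] := hy e e0.
have St : S t by have [[]] := Ct.
exists (vclamp (vabs t) x).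
  apply: CL_ball_solid Ct; exact/vabs_clamp/vabs_ge0.
apply: le_lt_trans te; apply: (sum_qnorm_mono hj); first exact: (sum_spaceB Sy).
apply: vabs_subclamp; rewrite ?vabs_ge0//.
by apply: (le_trans xy); apply: le_trans (vabsD _ _); rewrite addrC subrK.
Qed.

Lemma G_ball_scale x (c : R) : `|c| <= 1 -> G_ball x -> G_ball (c *: x).
Proof.
move=> c1; apply: G_ball_solid; rewrite vabsZ -[leRHS]scale1r.
by apply: vscaler_le => //; exact: vabs_ge0.
Qed.

Lemma G_ball0 : G_ball 0.
Proof.
have [z hz] := calc_exists hj hphi (lexx (0 : X0)) (lexx (0 : X1)).
split; first exact: sum_space0.
move=> e e0; exists 0; last by rewrite subr0 (sum_qnorm0 j0 j1).
apply: (CL_ball_intro _ _ _ _ hz); rewrite ?qnorm0 ?ler01//.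
by rewrite vabs0; exact: (calc_ge0 hj hphi _ _ hz).
Qed.

(** [phi] is only quasi-concave, but [phi(a, b) + phi(a', b')] is at most
    [2 phi(a + a', b + b')]. *)
Lemma G_ballD : exists2 L : R, 0 < L & forall x y, G_ball x -> G_ball y ->
  G_ball (L^-1 *: (x + y)).
Proof.
have [C0 C01 hC0] := @ler_qnormD _ X0; have [C1 C11 hC1] := @ler_qnormD _ X1.
(* [L] normalizes [a + a'] and [b + b'], whose quasi-norms are at most [2 * C0] and [2 * C1]. The
   further factor 4 accounts for two summands, each bounded with the factor 2 of [CL_ball_bound]. *)
pose L := 2 * (C0 + C1); have L0 : 0 < L by rewrite /L; lra.
have LV0 : 0 <= L^-1 by rewrite invr_ge0 ltW.
have L40 : 0 < 4 * L by rewrite mulr_gt0.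
exists (4 * L) => // x y [Sx hx] [Sy hy].
split; first exact/sum_spaceZ/sum_spaceD.
move=> e e0; have [C C1' hC] := sum_qnormD j0 j1.
have C0' : 0 < C by exact: lt_le_trans C1'.
pose d := (4 * L) * e / (2 * C).
have d0 : 0 < d by rewrite divr_gt0// mulr_gt0.
have [u Cu ud] := hx d d0; have [v Cv vd] := hy d d0.
have Su : S u by have [[]] := Cu.
have Sv : S v by have [[]] := Cv.
exists ((4 * L)^-1 *: (u + v)).
  have [a [b [z [[a0 qa] [b0 qb] hz uz]]]] := CL_ball_bound Cu.
  have [a' [b' [z' [[a'0 qa'] [b'0 qb'] hz' vz']]]] := CL_ball_bound Cv.
  have A0 : 0 <= L^-1 *: (a + a') by apply/vscale_ge0/vaddr_ge0.
  have B0 : 0 <= L^-1 *: (b + b') by apply/vscale_ge0/vaddr_ge0.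
  have [t ht] := calc_exists hj hphi A0 B0.
  have LA : L *: (L^-1 *: (a + a')) = a + a' by rewrite scalerA divff ?gt_eqF// scale1r.
  have LB : L *: (L^-1 *: (b + b')) = b + b' by rewrite scalerA divff ?gt_eqF// scale1r.
  have zt : z <= L *: t.
    by apply: (calc_mono hj hphi (ltW L0) a0 b0 A0 B0 hz ht); rewrite ?LA ?LB vlerDl.
  have z't : z' <= L *: t.
    by apply: (calc_mono hj hphi (ltW L0) a'0 b'0 A0 B0 hz' ht); rewrite ?LA ?LB vlerDr.
  apply: (CL_ball_intro A0 _ B0 _ ht).
  - rewrite qnormZ ger0_norm// ler_pdivrMl// mulr1; apply: (le_trans (hC0 _ _)).
    have : C0 * (qnorm a + qnorm a') <= C0 * 2.
      rewrite ler_wpM2l; lra.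
    rewrite /L; lra.
  - rewrite qnormZ ger0_norm// ler_pdivrMl// mulr1; apply: (le_trans (hC1 _ _)).
    have : C1 * (qnorm b + qnorm b') <= C1 * 2.
      rewrite ler_wpM2l; lra.
    rewrite /L; lra.
  have L4V0 : 0 < (4 * L)^-1 by rewrite invr_gt0.
  rewrite vabsZ gtr0_norm// vscale_ler_pdivl// invrK.
  apply: (le_trans (vabsD _ _)).
  have -> : (4 * L) *: t = 2 *: (L *: t) + 2 *: (L *: t).
    by rewrite !scalerA -scalerDl; congr (_ *: _); ring.
  apply: vleD; first by apply: (le_trans uz); apply: vscale_le.
  by apply: (le_trans vz'); apply: vscale_le.
rewrite -scalerBr opprD addrACA.
have Sxu := sum_spaceB Sx Su; have Syv := sum_spaceB Sy Sv.
apply: (le_lt_trans (sum_qnormZ _ (sum_spaceD Sxu Syv))).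
rewrite ger0_norm ?invr_ge0 ?ltW// ltr_pdivrMl//.
apply: (le_lt_trans (hC _ _ Sxu Syv)).
have -> : 4 * L * e = C * (d + d) by rewrite /d; field; rewrite gt_eqF.
by rewrite ltr_pM2l// ltrD.
Qed.

Lemma G_space_sum x : G_space x -> S x.
Proof.
move=> [l l0 [Sx _]]; rewrite -[x]scale1r -(@divff _ l) ?gt_eqF// -scalerA.
exact: sum_spaceZ.
Qed.

Lemma G_space0 : G_space 0.
Proof. by exists 1 => //; rewrite scaler0; exact: G_ball0. Qed.

Lemma G_space_abs x : G_space x -> G_space (vabs x).
Proof.
move=> [l l0 hx]; exists l => //; apply: G_ball_solid hx.
by rewrite !vabsZ vabs_abs.
Qed.

Lemma G_spaceD x y : G_space x -> G_space y -> G_space (x + y).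
Proof.
move=> [l l0 hx] [m m0 hy]; have [L L0 hL] := G_ballD.
have lm0 : 0 < l + m by rewrite addr_gt0.
exists (L * (l + m)); first by rewrite mulr_gt0.
have down (k : R) z : 0 < k -> k <= l + m -> G_ball (k^-1 *: z) ->
    G_ball ((l + m)^-1 *: z).
  move=> k0 kl hz; have -> : (l + m)^-1 *: z = (k / (l + m)) *: (k^-1 *: z).
    by rewrite scalerA; congr (_ *: _); field; rewrite !gt_eqF.
  apply: G_ball_scale hz; rewrite ger0_norm; last by rewrite divr_ge0// ltW.
  by rewrite ler_pdivrMr// mul1r.
rewrite invfM -scalerA scalerDr; apply: hL.
  by apply: down hx => //; rewrite lerDl ltW.
by apply: down hy => //; rewrite lerDr ltW.
Qed.

Lemma G_space_bigsum (I : Type) (r : seq I) (F : I -> X) :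
  (forall i, G_space (F i)) -> G_space (\sum_(i <- r) F i).
Proof.
by move=> GF; elim/big_ind : _ => //; [exact: G_space0|exact: G_spaceD].
Qed.

(** The quasi-triangle constant is compounded along [r], so [d] depends on the length of the family.
    This is harmless, since it only limits the size of errors. *)
Lemma sum_qnorm_small (I : Type) (r : seq I) (e : R) : 0 < e ->
  exists2 d : R, 0 < d & forall v : I -> X, (forall i, S (v i)) ->
    (forall i, N (v i) <= d) -> N (\sum_(i <- r) vabs (v i)) <= e.
Proof.
move=> e0; have [C C1 hC] := sum_qnormD j0 j1.
have C0 : 0 < C by exact: lt_le_trans C1.
elim: r e e0 => [|i r ih] e e0.
  by exists 1 => // v _ _; rewrite big_nil (sum_qnorm0 j0 j1) ltW.
have e20 : 0 < e / (2 * C) by rewrite divr_gt0// mulr_gt0.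
have [d d0 hd] := ih _ e20; exists (Num.min d (e / (2 * C))); first by rewrite lt_min d0.
move=> v Sv vd; rewrite big_cons.
have Sav k : S (vabs (v k)) by exact: (sum_space_abs hj).
apply: (le_trans (hC _ _ (Sav i) (sum_space_sum _ Sav))).
have -> : e = C * (e / (2 * C) + e / (2 * C)) by field; rewrite gt_eqF.
rewrite ler_pM2l// lerD//.
  rewrite (sum_qnorm_abs hj)//; apply: (le_trans (vd i)).
  by rewrite ge_min lexx orbT.
by apply: hd => // k; apply: (le_trans (vd k)); rewrite ge_min lexx.
Qed.

End Gagliardo.

(** * Interpolation of regular operators between Gagliardo completions *)

Section Interpolation.
Context {R : realType} {X0 X1 Y0 Y1 : quasiBanachLatticeType R}.
Context {X Y : locallySolidType R}.
Variables (j0 : {linear X0 -> X}) (j1 : {linear X1 -> X}).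
Variables (k0 : {linear Y0 -> Y}) (k1 : {linear Y1 -> Y}).
Hypotheses (hj : compatible_pair j0 j1) (hk : compatible_pair k0 k1).
Variables (phi : R -> R -> R) (hphi : class_P phi).
Variables (T : X -> Y) (T0 : {linear X0 -> Y0}) (T1 : {linear X1 -> Y1}).
Hypothesis Tlin : linear_on (sum_space j0 j1) T.
Hypothesis Tsum : forall x, sum_space j0 j1 x -> sum_space k0 k1 (T x).
Variable M : R.
Hypothesis Tbound : forall x, sum_space j0 j1 x ->
  sum_qnorm k0 k1 (T x) <= M * sum_qnorm j0 j1 x.
Hypothesis TT0 : forall x, T (j0 x) = k0 (T0 x).
Hypothesis TT1 : forall x, T (j1 x) = k1 (T1 x).
Variable K : R.
Hypotheses (K_gt0 : 0 < K) (hT0 : inf1_bound setT qnorm qnorm T0 K)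
  (hT1 : inf1_bound setT qnorm qnorm T1 K).

Notation SX := (sum_space j0 j1).
Notation SY := (sum_space k0 k1).
Notation NX := (sum_qnorm j0 j1).
Notation NY := (sum_qnorm k0 k1).

Lemma T_0 : T 0 = 0.
Proof. by rewrite -(linear0 j0) TT0 !linear0. Qed.

Lemma T_Z (c : R) x : SX x -> T (c *: x) = c *: T x.
Proof. by move=> Sx; have := Tlin c Sx (sum_space0 j0 j1); rewrite T_0 !addr0. Qed.

Lemma T_D x y : SX x -> SX y -> T (x + y) = T x + T y.
Proof. by move=> Sx Sy; have := Tlin 1 Sx Sy; rewrite !scale1r. Qed.

Lemma T_B x y : SX x -> SX y -> T (x - y) = T x - T y.
Proof.
move=> Sx Sy; have SNy : SX (- y) by rewrite -scaleN1r; exact: sum_spaceZ.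
by rewrite T_D// -scaleN1r T_Z// scaleN1r.
Qed.

Lemma T_sum (I : Type) (r : seq I) (F : I -> X) : (forall i, SX (F i)) ->
  T (\sum_(i <- r) F i) = \sum_(i <- r) T (F i).
Proof.
move=> SF; elim: r => [|i r ih]; first by rewrite !big_nil T_0.
by rewrite !big_cons T_D ?ih//; exact: sum_space_sum.
Qed.

(** Applied to [X0 -> Y0] and to [X1 -> Y1], [p s] being the weight [1 / f s],
    respectively [s / f s], of the piece [s]. *)
Lemma coordinate_join (E F : quasiBanachLatticeType R) (j : {linear E -> X})
    (k : {linear F -> Y}) (U : {linear E -> F}) (I : finType) (Q : seq (R * R))
    (p : R * R -> R) (u : I -> R * R -> X) (a : E) :
  compatible_embedding j -> compatible_embedding k ->
  (forall x, T (j x) = k (U x)) -> inf1_bound setT qnorm qnorm U K ->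
  0 <= a -> qnorm a <= 1 -> (forall i s, SX (u i s)) ->
  (forall s, s \in Q -> 0 <= p s) ->
  \sum_i \sum_(s <- Q) vabs (p s *: u i s) <= 192 *: j a ->
  exists y : F, [/\ 0 <= y, qnorm y <= 1 & forall i s, s \in Q ->
    p s *: vabs (T (u i s)) <= (192 * K) *: k y].
Proof.
move=> hj' hk' TU hU a0 qa Su p0 ua.
have c0 : 0 < 192 * K by rewrite mulr_gt0.
have term_le i s : s \in Q -> vabs (p s *: u i s) <= j (192 *: a).
  move=> sQ; rewrite linearZ; apply: le_trans ua.
  apply: le_trans (vsum_sup (r := index_enum I) (F := fun i => \sum_(s <- Q) vabs (p s *: u i s))
    (i := i) _ _); rewrite ?mem_index_enum//; last first.
    by move=> i'; apply: vsum_ge0 => s'; exact: vabs_ge0.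
  by apply: (vsum_sup (F := fun s => vabs (p s *: u i s))) => // s'; exact: vabs_ge0.
have a192 : 0 <= 192 *: a by exact: vscale_ge0.
have /choice[v hv] : forall q : I * (R * R), exists v : E,
    q.2 \in Q -> j v = p q.2 *: u q.1 q.2.
  move=> [i s] /=; have [sQ|_] := boolP (s \in Q); last by exists 0.
  by have [v -> _] := emb_abs_le hj' a192 (term_le i s sQ); exists v.
(* All pairs form one family, so a single use of regularity suffices and [K] is not multiplied by
   the number of pieces. *)
pose r := [seq (i, s) | i <- index_enum I, s <- Q].
pose y := \big[vjoin/0]_(q <- r) vabs (U (v q)).
have y0 : 0 <= y by exact: bigjoin_ge0.
exists ((192 * K)^-1 *: y); split.
- by apply: vscale_ge0 => //; rewrite invr_ge0 ltW.
- rewrite qnormZ gtr0_norm ?invr_gt0// ler_pdivrMl// mulr1.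
  apply: (le_trans (inf1_bound_seq r v hU)); rewrite mulrC ler_pM2r//.
  apply: (@le_trans _ _ (qnorm (192 *: a))); last first.
    by rewrite qnormZ ger0_norm// ler_piMr.
  apply: qnorm_le; first by apply: vsum_ge0 => q; exact: vabs_ge0.
  rewrite -(emb_le hj') linear_sum linearZ big_allpairs; apply: le_trans ua.
  apply: vsum_le => i; rewrite le_eqVlt; apply/orP; left; apply/eqP.
  by apply: eq_big_seq => s sQ; rewrite (emb_abs hj') hv.
move=> i s sQ; rewrite linearZ scalerA divff ?gt_eqF// scale1r.
have Tv : T (p s *: u i s) = k (U (v (i, s))) by rewrite -TU hv.
have -> : p s *: vabs (T (u i s)) = k (vabs (U (v (i, s)))).
  by rewrite (emb_abs hk') -Tv T_Z// vabsZ ger0_norm// p0.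
rewrite (emb_le hk'); apply: (bigjoin_sup (fun q => vabs (U (v q)))).
by apply/allpairsP; exists (i, s); split; rewrite ?mem_index_enum.
Qed.

(** The elements [y0] and [y1] do not depend on [i]. Each [vabs (T (x' i))] therefore has the same
    bound [6 * (192 * K)] times [phi(y0, y1)], and the join over [i] costs nothing more. *)
Lemma approximate_image (I : finType) (x : I -> X) a b z (eps : R) :
  0 <= a -> qnorm a <= 1 -> 0 <= b -> qnorm b <= 1 ->
  func_calculus SX phi (j0 a) (j1 b) z -> 0 < eps ->
  \sum_i vabs (x i) <= 2 *: z ->
  exists x' : I -> X, [/\ forall i, SX (x' i),
    forall i, vabs (x i - x' i) <= (4 * eps) *: (j0 a + j1 b) &
    CL_unit_ball k0 k1 phi ((6 * (192 * K))^-1 *: \big[vjoin/0]_i vabs (T (x' i)))].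
Proof.
move=> a0 qa b0 qb hz eps0 xz.
have [_ hj0 hj1] := hj; have [_ hk0 hk1] := hk.
have [Q [Qp Qs Qc]] := quasiconcave_pieces hphi eps0.
have [u [u0 u1 Su xu]] := calc_decomposition hj hphi a0 b0 hz eps0 Qp Qs Qc xz.
have Qp1 s : s \in Q -> 0 <= s.1 by move=> /(allP Qp)/and3P[].
have Qp2 s : s \in Q -> 0 <= s.2 by move=> /(allP Qp)/and3P[].
have [y0 [y00 qy0 hy0]] := coordinate_join hj0 hk0 TT0 hT0 a0 qa Su Qp1 u0.
have [y1 [y10 qy1 hy1]] := coordinate_join hj1 hk1 TT1 hT1 b0 qb Su Qp2 u1.
have c0 : 0 < 192 * K by rewrite mulr_gt0.
have C0 : 0 < 6 * (192 * K) by rewrite !mulr_gt0.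
have [t ht] := calc_exists hk hphi y00 y10.
exists (fun i => \sum_(s <- Q) u i s); split => //.
  by move=> i; exact: sum_space_sum.
apply: (CL_ball_intro hk y00 qy0 y10 qy1 ht).
have t0 := calc_ge0 hk hphi y00 y10 ht.
rewrite vabs_id; last first.
  by apply: vscale_ge0; [rewrite invr_ge0 ltW|exact: bigjoin_ge0].
rewrite vscale_ler_pdivl ?invr_gt0// invrK; apply: bigjoin_le.
  by apply: vscale_ge0 => //; exact: ltW.
move=> i; rewrite T_sum//.
have cV0 : 0 < (192 * K)^-1 by rewrite invr_gt0.
have divc (A B : Y) : A <= (192 * K) *: B -> (192 * K)^-1 *: A <= B.
  by move=> AB; rewrite vscale_ler_pdivl// invrK.
suff h : (192 * K)^-1 *: vabs (\sum_(s <- Q) T (u i s)) <= 6 *: t.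
  by rewrite mulrC -scalerA -[192 * K]invrK -vscale_ler_pdivl.
have cE : vabs ((192 * K)^-1 *: \sum_(s <- Q) T (u i s)) =
    (192 * K)^-1 *: vabs (\sum_(s <- Q) T (u i s)).
  by rewrite vabsZ ger0_norm// invr_ge0 ltW.
rewrite -cE scaler_sumr.
apply: (calc_sum_pieces hk hphi y00 y10 ht Qp Qs) => s sQ.
rewrite vabsZ (gtr0_norm cV0).
have E (p : R) (A : Y) : p *: ((192 * K)^-1 *: A) = (192 * K)^-1 *: (p *: A).
  by rewrite !scalerA mulrC.
by rewrite !E; split; apply: divc; [exact: hy0|exact: hy1].
Qed.

(** The sum of the [vabs (x i)] is only a limit of elements dominated by some [phi(a, b)]. The [x i]
    are altered twice, to fit under an approximant and then to be split into pieces, and the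
    boundedness of [T] on X0 + X1 carries both errors to the image. *)
Lemma G_ball_image (I : finType) (x : I -> X) :
  Gagliardo_unit_ball j0 j1 phi (\sum_i vabs (x i)) ->
  Gagliardo_unit_ball k0 k1 phi
    ((6 * (192 * K))^-1 *: \big[vjoin/0]_i vabs (T (x i))).
Proof.
set w := \sum_i vabs (x i); move=> [Sw hw].
have w0 : 0 <= w by apply: vsum_ge0 => i; exact: vabs_ge0.
have C0 : 0 < 6 * (192 * K) by rewrite !mulr_gt0.
have CV0 : 0 <= (6 * (192 * K))^-1 by rewrite invr_ge0 ltW.
have Sx i : SX (x i).
  apply: (sum_space_solid hj) Sw; rewrite (vabs_id w0).
  by apply: (vsum_sup (fun i => vabs_ge0 (x i))); exact: mem_index_enum.
have SYT i : SY (vabs (T (x i))) by apply: (sum_space_abs hk); exact: Tsum.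
have SYjoin (F : I -> Y) : (forall i, SY (vabs (F i))) -> SY (\big[vjoin/0]_i vabs (F i)).
  move=> SF; apply: (sum_space_le hk) (bigjoin_ge0 _ _) _ (sum_space_sum (index_enum I) SF).
  apply: bigjoin_le; first by apply: vsum_ge0 => i; exact: vabs_ge0.
  by move=> i; apply: (vsum_sup (fun i => vabs_ge0 (F i))); exact: mem_index_enum.
split; first by apply: sum_spaceZ; exact: SYjoin.
move=> e e0.
have [D D1 hD] := sum_qnormD j0 j1.
have D0 : 0 < D by exact: lt_le_trans D1.
have Ce0 : 0 < (6 * (192 * K)) * e / 2 by rewrite divr_gt0// mulr_gt0.
have [d d0 hd] := sum_qnorm_small hk (index_enum I) Ce0.
have M0 : 0 < `|M| + 1 by rewrite ltr_wpDl.
(* Chosen so that the final error [(|M| + 1) * (D * (dl + dl))] equals [d]; the sign of [M] is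
   unknown. *)
pose dl := d / (2 * D * (`|M| + 1)).
have dl0 : 0 < dl by rewrite divr_gt0// !mulr_gt0.
have [y Cy yd] := hw dl dl0.
have Sy : SX y by have [[]] := Cy.
have [a [b [z [[a0 qa] [b0 qb] hz yz]]]] := CL_ball_bound hj hphi Cy.
(* The part of [w] that lies under the approximant; the rest is at most [vabs (w - y)]. *)
pose w' := vmeet (vabs y) w.
have w'0 : 0 <= w' by rewrite vlexI vabs_ge0.
have ww' : 0 <= w - w' by rewrite vsubr_ge0 vleIr.
have ww'y : w - w' <= vabs (w - y).
  rewrite vlerBlDr addrC -vlerBlDr vlexI !vlerBlDr; apply/andP; split.
    apply: (le_trans (vabs_ge w)); apply: le_trans (vabsD _ _).
    by rewrite addrC subrK.
  exact/vlerDl/vabs_ge0.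
have [x1 [x1w xx1]] := riesz_decomposition (x := x) (index_enum_uniq I) w'0 (vleIr _ _).
have x1z : \sum_i vabs (x1 i) <= 2 *: z.
  exact: le_trans x1w (le_trans (vleIl _ _) yz).
(* The second error is [(4 * eps) *: (j0 a + j1 b)], of quasi-norm at most [8 * eps = dl]. *)
have eps0 : 0 < dl / 8 by rewrite divr_gt0.
have [x2 [Sx2 x12 CT]] := approximate_image a0 qa b0 qb hz eps0 x1z.
exists ((6 * (192 * K))^-1 *: \big[vjoin/0]_i vabs (T (x2 i))) => //.
rewrite -scalerBr.
have SYT2 i : SY (vabs (T (x2 i))) by apply: (sum_space_abs hk); exact: Tsum.
have Sd i : SX (x i - x2 i) by exact: sum_spaceB.
have STd i : SY (T (x i - x2 i)) by exact: Tsum.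
have STad i : SY (vabs (T (x i - x2 i))) by exact: (sum_space_abs hk).
apply: (le_lt_trans (sum_qnormZ _ (sum_spaceB (SYjoin _ SYT) (SYjoin _ SYT2)))).
rewrite ger0_norm// ltr_pdivrMl//.
apply: (@le_lt_trans _ _ ((6 * (192 * K)) * e / 2)); last by have := mulr_gt0 C0 e0; lra.
apply: (@le_trans _ _ (NY (\sum_i vabs (T (x i - x2 i))))).
  apply: (sum_qnorm_mono hk); first exact: sum_space_sum.
  rewrite [leRHS]vabs_id; last by apply: vsum_ge0 => i; exact: vabs_ge0.
  apply: (le_trans (vabs_subjoin _ _ _)); apply: vsum_le => i.
  by rewrite T_B//; exact: vabs_subabs.
apply: hd => // i; apply: (le_trans (Tbound (Sd i))).
have Nd0 := sum_qnorm_ge0 (Sd i).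
apply: (@le_trans _ _ ((`|M| + 1) * NX (x i - x2 i))).
  by apply: ler_wpM2r => //; apply: (le_trans (ler_norm _)); rewrite lerDl.
have Sab := sum_spaceI j0 j1 a b.
have Sww' : SX (w - w') by apply: (sum_space_le hj ww' ww'y); exact/(sum_space_abs hj)/sum_spaceB.
have k0' : 0 <= 4 * (dl / 8) by rewrite mulr_ge0// ltW.
have [_ hj0 hj1] := hj.
have ja0 : 0 <= j0 a by rewrite (emb_ge0 hj0).
have jb0 : 0 <= j1 b by rewrite (emb_ge0 hj1).
have Sr : SX ((4 * (dl / 8)) *: (j0 a + j1 b)) by exact: sum_spaceZ.
have NN : NX (x i - x2 i) <= D * (dl + dl).
  apply: (@le_trans _ _ (NX ((w - w') + (4 * (dl / 8)) *: (j0 a + j1 b)))).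
    apply: (sum_qnorm_mono hj); first exact: sum_spaceD.
    rewrite [leRHS]vabs_id; last by apply: vaddr_ge0 => //; apply: vscale_ge0 => //; exact: vaddr_ge0.
    rewrite -(subrKA (x1 i)); apply: (le_trans (vabsD _ _)); apply: vleD => //.
    apply: le_trans xx1; apply: (vsum_sup (F := fun i => vabs (x i - x1 i))).
      by move=> k; exact: vabs_ge0.
    exact: mem_index_enum.
  apply: (le_trans (hD _ _ Sww' Sr)); rewrite ler_pM2l// lerD//.
    apply: (le_trans _ (ltW yd)); rewrite -(sum_qnorm_abs hj (sum_spaceB Sw Sy)).
    apply: (sum_qnorm_mono hj); first exact/(sum_space_abs hj)/sum_spaceB.
    by rewrite vabs_abs (vabs_id ww').
  apply: (le_trans (sum_qnormZ _ Sab)); rewrite ger0_norm//.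
  have := sum_qnorm_le j0 j1 a b.
  have : NX (j0 a + j1 b) <= 2 -> 4 * (dl / 8) * NX (j0 a + j1 b) <= 4 * (dl / 8) * 2.
    by move=> h; apply: ler_wpM2l.
  move: (NX _) => n; lra.
apply: (le_trans (ler_wpM2l (ltW M0) NN)).
rewrite le_eqVlt; apply/orP; left; apply/eqP.
by rewrite /dl; field; rewrite !gt_eqF.
Qed.

Lemma G_space_image x : Gagliardo_space j0 j1 phi x -> Gagliardo_space k0 k1 phi (T x).
Proof.
move=> Gx; have Sx := G_space_sum Gx; have [l l0 hx] := Gx.
have C0 : 0 < 6 * (192 * K) by rewrite !mulr_gt0.
exists (6 * (192 * K) * l); first by rewrite mulr_gt0.
have h := @G_ball_image _ (fun i : 'I_1 => l^-1 *: x).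
rewrite !big_ord_recl !big_ord0 addr0 in h.
have hv : Gagliardo_unit_ball j0 j1 phi (vabs (l^-1 *: x)).
  by apply: (G_ball_solid hj hphi _ hx); rewrite vabs_abs.
apply: (G_ball_solid hk hphi _ (h hv)).
have -> : vjoin (vabs (T (l^-1 *: x))) 0 = vabs (T (l^-1 *: x)).
  by rewrite vjoinC; apply/vjoin_idPr/vabs_ge0.
rewrite T_Z//.
by rewrite [leRHS]vabsZ vabs_abs !vabsZ invfM normrM scalerA.
Qed.

Lemma inf1_bound_image :
  inf1_bound (Gagliardo_space j0 j1 phi)
    (Gagliardo_qnorm j0 j1 phi) (Gagliardo_qnorm k0 k1 phi) T (6 * (192 * K)).
Proof.
move=> n x Gx; have Sx i := G_space_sum (Gx i).
have C0 : 0 < 6 * (192 * K) by rewrite !mulr_gt0.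
have [l l0 hl] : Gagliardo_space j0 j1 phi (\sum_(i < n) vabs (x i)).
  by apply: (G_space_bigsum hj hphi) => i; exact: (G_space_abs hj hphi).
rewrite mulrC -ler_pdivrMr//; apply: lb_le_inf; first by exists l.
move=> m [m0 hm]; rewrite ler_pdivrMr// mulrC.
apply: ge_inf; first by exists 0 => r [/ltW].
split; first by rewrite mulr_gt0.
have mV0 : 0 < m^-1 by rewrite invr_gt0.
have E1 : m^-1 *: (\sum_(i < n) vabs (x i)) = \sum_(i < n) vabs (m^-1 *: x i).
  by rewrite scaler_sumr; apply: eq_bigr => i _; rewrite vabsZ gtr0_norm.
rewrite E1 in hm; have := G_ball_image hm.
have -> : \big[vjoin/0]_(i < n) vabs (T (m^-1 *: x i)) =
    m^-1 *: \big[vjoin/0]_(i < n) vabs (T (x i)).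
  rewrite -bigjoinZ//; apply: eq_bigr => i _.
  by rewrite T_Z// vabsZ gtr0_norm.
by rewrite scalerA -invfM.
Qed.

End Interpolation.

(** Bounds are stable under increase, so any [K] above the infimum is one. Working strictly above it
    also covers the case where the infimum is 0, which is not an admissible bound. *)
Lemma inf1_bound_gt_rho (R : realType) (E F : quasiBanachLatticeType R)
    (T : E -> F) (K : R) :
  inf1_regular setT qnorm qnorm T -> rho_inf1 setT qnorm qnorm T < K ->
  0 < K /\ inf1_bound setT qnorm qnorm T K.
Proof.
move=> [K0 K00 hK0] /inf_lt[|K1 [K10 hK1] K1K]; first by exists K0.
split; first exact: lt_trans K1K.
move=> n x Ex; apply: (le_trans (hK1 n x Ex)).
by apply: ler_wpM2r; [exact: qnorm_ge0|exact: ltW].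
Qed.

Theorem theorem3p1 (R : realType) (X0 X1 Y0 Y1 : quasiBanachLatticeType R)
    (phi : R -> R -> R) (hphi : class_P phi) :
  exists2 C : R, 0 < C &
    forall (X Y : locallySolidType R)
      (j0 : {linear X0 -> X}) (j1 : {linear X1 -> X})
      (k0 : {linear Y0 -> Y}) (k1 : {linear Y1 -> Y}),
    compatible_pair j0 j1 -> compatible_pair k0 k1 ->
    forall (T : X -> Y) (T0 : {linear X0 -> Y0}) (T1 : {linear X1 -> Y1}),
    linear_on (sum_space j0 j1) T ->
    (forall x, sum_space j0 j1 x -> sum_space k0 k1 (T x)) ->
    (exists M : R, forall x, sum_space j0 j1 x ->
       sum_qnorm k0 k1 (T x) <= M * sum_qnorm j0 j1 x) ->
    (forall x, T (j0 x) = k0 (T0 x)) ->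
    (forall x, T (j1 x) = k1 (T1 x)) ->
    inf1_regular setT qnorm qnorm T0 ->
    inf1_regular setT qnorm qnorm T1 ->
    [/\ forall x, Gagliardo_space j0 j1 phi x ->
          Gagliardo_space k0 k1 phi (T x),
        inf1_regular (Gagliardo_space j0 j1 phi)
          (Gagliardo_qnorm j0 j1 phi) (Gagliardo_qnorm k0 k1 phi) T &
        rho_inf1 (Gagliardo_space j0 j1 phi)
          (Gagliardo_qnorm j0 j1 phi) (Gagliardo_qnorm k0 k1 phi) T <=
        C * Num.max (rho_inf1 setT qnorm qnorm T0)
                    (rho_inf1 setT qnorm qnorm T1)].
Proof.
(* [192] comes from [calc_decomposition] and [6] from [calc_sum_pieces]. *)
pose c : R := 6 * 192; have c0 : 0 < c by rewrite mulr_gt0.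
exists c => // X Y j0 j1 k0 k1 hj hk T T0 T1 Tlin Tsum [M hM] TT0 TT1 r0 r1.
set m := Num.max _ _.
have bound (K : R) : m < K -> 0 < K /\ inf1_bound (Gagliardo_space j0 j1 phi)
    (Gagliardo_qnorm j0 j1 phi) (Gagliardo_qnorm k0 k1 phi) T (c * K).
  rewrite gt_max => /andP[/(inf1_bound_gt_rho r0)[K0 h0] /(inf1_bound_gt_rho r1)[_ h1]].
  split => //; rewrite /c -mulrA.
  exact: (inf1_bound_image hj hk hphi Tlin Tsum hM TT0 TT1 K0 h0 h1).
have m1 : m < m + 1 by rewrite ltrDl.
have [K0 hK] := bound _ m1; split.
- move: m1; rewrite gt_max => /andP[/(inf1_bound_gt_rho r0)[_ h0] /(inf1_bound_gt_rho r1)[_ h1]].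
  exact: (G_space_image hj hk hphi Tlin Tsum hM TT0 TT1 K0 h0 h1).
- by exists (c * (m + 1)) => //; rewrite mulr_gt0.
(* The excess [d / c] over [m] becomes the error [d] after multiplication by [c]. *)
- apply/ler_addgt0Pl => d d0.
  have mK : m < m + d / c by rewrite ltrDl divr_gt0.
  have [K1 hK1] := bound _ mK.
  have -> : d + c * m = c * (m + d / c) by field; rewrite gt_eqF.
  apply: ge_inf; first by exists 0 => r [/ltW].
  by split => //; rewrite mulr_gt0.
Qed.
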